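(* Let $(M^{2n},g,J_A,J_B)$ be a compact generalized Kähler manifold with $[J_A,J_B]=0$, let $k=\operatorname{rank}T_+^{1,0}$, $l=\operatorname{rank}T_-^{1,0}$, and let $u\in C^\infty(M)$ (real valued) and functions $F_\pm$ and a constant $\lambda$ satisfy $$(\omega_++\sqrt{-1}\,\partial_+\bar\partial_+u)^k=e^{F_+}\omega_+^k,\qquad (\omega_--\sqrt{-1}\,\partial_-\bar\partial_-u)^l=e^{F_-}\omega_-^l,\qquad \operatorname{tr}_\omega\sqrt{-1}\,\partial\bar\partial u>-\lambda .$$ Then there exists a constant $C=C(\sup F_+,\inf F_-,\lambda)$ (depending in addition only on the fixed background $(M,g,J_A,J_B)$) such that $$\operatorname{osc}_Mu=\sup_Mu-\inf_Mu\le C .$$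
   Context: A generalized Kähler structure on $M$ is a triple $(g,J_A,J_B)$ of a Riemannian metric and two integrable complex structures, with $g$ Hermitian for both, such that with $\omega_A=g(J_A\cdot,\cdot)$, $\omega_B=g(J_B\cdot,\cdot)$ and $d^c=\sqrt{-1}(\bar\partial-\partial)$ for the respective complex structure, $d^c_A\omega_A=-d^c_B\omega_B$ and $dd^c_A\omega_A=-dd^c_B\omega_B=0$. Manifolds are connected. When $[J_A,J_B]=0$, $\Pi:=J_AJ_B$ satisfies $\Pi^2=\mathrm{Id}$ and is $g$-orthogonal; all of the following is on the complex manifold $(M,J_A)$: $T_\pm^{1,0}=\ker(\Pi\mp I)\subset T^{1,0}(M,J_A)$, $T^{1,0}=T_+^{1,0}\oplus T_-^{1,0}$, dually $\Lambda^{1,0}=\Lambda^{1,0}_+\oplus\Lambda^{1,0}_-$, and $\partial=\partial_++\partial_-$, $\bar\partial=\bar\partial_++\bar\partial_-$. In particular $\sqrt{-1}\partial_\pm\bar\partial_\pm u$ is the component of $\sqrt{-1}\partial\bar\partial u$ in $\Lambda_\pm^{1,0}\wedge\Lambda_\pm^{0,1}$. The Kähler form $\omega=\omega_A$ splits as $\omega=\omega_++\omega_-$ with $\omega_\pm\in\Lambda^{1,0}_\pm\wedge\Lambda_\pm^{0,1}$. *)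

(* Defs.v *)
From HB Require Import structures.
From mathcomp Require Import all_boot all_order all_algebra all_fingroup.
From mathcomp Require Import complex.
From mathcomp Require Import all_classical all_reals all_analysis.

Set Implicit Arguments.
Unset Strict Implicit.
Unset Printing Implicit Defensive.

Import Order.TTheory GRing.Theory Num.Theory.
Import numFieldNormedType.Exports.

Local Open Scope classical_set_scope.
Local Open Scope ring_scope.
Local Open Scope complex_scope.

(* Tangent vectors are row vectors: an endomorphism with matrix [J] acts by   *)
(* [v *m J], so the operator [f \o g] has matrix [G *m F], and the            *)
(* differential of a map acts by [v *m jacobian f x].                         *)

Section Smooth.
Context {R : realType}.

Fixpoint Cr_on m (r : nat) (U : set 'rV[R]_m) (f : 'rV[R]_m -> R) : Prop :=
  (forall x, U x -> {for x, continuous f}) /\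
  match r with
  | 0 => True
  | r'.+1 => forall a : 'I_m,
      (forall x, U x -> derivable f x (delta_mx 0 a)) /\
      Cr_on r' U (fun x => 'D_(delta_mx 0 a) f x)
  end.

(* For open [U] only. *)
Definition smooth_on m (U : set 'rV[R]_m) (f : 'rV[R]_m -> R) : Prop :=
  forall r, Cr_on r U f.

Definition smooth_mx_on m p q (U : set 'rV[R]_m) (F : 'rV[R]_m -> 'M[R]_(p, q))
    : Prop :=
  forall a b, smooth_on U (fun x => F x a b).

End Smooth.

(* The chart [i] is [chart i], defined on [chart_dom i], with inverse         *)
(* [chart_inv i]; values outside the relevant domains are irrelevant.         *)
Record smooth_atlas (R : realType) (m : nat) (M : topologicalType) := SmoothAtlas {
  chart_index : Type;
  chart_dom : chart_index -> set M;
  chart : chart_index -> M -> 'rV[R]_m;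
  chart_inv : chart_index -> 'rV[R]_m -> M;
  chart_dom_open : forall i, open (chart_dom i);
  chart_img_open : forall i, open (chart i @` chart_dom i);
  chart_cover : forall p : M, exists i, chart_dom i p;
  chartK : forall i p, chart_dom i p -> chart_inv i (chart i p) = p;
  chart_continuous : forall i p, chart_dom i p -> {for p, continuous (chart i)};
  chart_inv_continuous : forall i x, (chart i @` chart_dom i) x ->
    {for x, continuous (chart_inv i)};
  chart_transition : forall i j,
    smooth_mx_on (chart i @` (chart_dom i `&` chart_dom j))
                 (chart j \o chart_inv i)
}.

Section Tensors.
Context {R : realType} {m : nat} {M : topologicalType}.
Variable A : smooth_atlas R m M.

Definition chart_img (i : chart_index A) : set 'rV[R]_m :=
  chart i @` chart_dom i.

Definition overlap (i j : chart_index A) : set 'rV[R]_m :=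
  chart i @` (chart_dom i `&` chart_dom j).

Definition transition (i j : chart_index A) : 'rV[R]_m -> 'rV[R]_m :=
  chart j \o chart_inv i.

Definition smooth_fun (u : M -> R) : Prop :=
  forall i : chart_index A, smooth_on (chart_img i) (u \o chart_inv i).

(* The matrices of a tensor field in every chart, as functions of the         *)
(* coordinates.                                                               *)
Definition tensor := chart_index A -> 'rV[R]_m -> 'M[R]_m.

Definition bilinear_field (g : tensor) : Prop :=
  (forall i, smooth_mx_on (chart_img i) (g i)) /\
  forall i j x, overlap i j x ->
    let D := jacobian (transition i j) x in
    g i x = D *m g j (transition i j x) *m D^T.

Definition endo_field (J : tensor) : Prop :=
  (forall i, smooth_mx_on (chart_img i) (J i)) /\
  forall i j x, overlap i j x ->
    let D := jacobian (transition i j) x in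
    J i x *m D = D *m J j (transition i j x).

Definition riemannian_metric (g : tensor) : Prop :=
  bilinear_field g /\
  forall i x, chart_img i x ->
    (g i x)^T = g i x /\
    forall v : 'rV[R]_m, v != 0 -> 0 < (v *m g i x *m v^T) 0 0.

Definition hermitian_for (g J : tensor) : Prop :=
  forall i x, chart_img i x -> J i x *m g i x *m (J i x)^T = g i x.

End Tensors.

(* Multiplication by the imaginary unit on C^n = R^n x R^n, i.e.              *)
(* (x, y) |-> (- y, x).                                                       *)
Definition std_J (R : realType) (n : nat) : 'M[R]_(n + n) :=
  block_mx 0 1%:M (- 1%:M) 0.

(* An integrable almost complex structure: around every point there are       *)
(* holomorphic coordinates [psi], i.e. smooth coordinates whose differential  *)
(* intertwines [J] with the complex structure of C^n.                         *)
Definition complex_structure (R : realType) (n : nat) (M : topologicalType)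
    (A : smooth_atlas R (n + n) M) (J : tensor A) : Prop :=
  [/\ endo_field J,
      (forall i x, chart_img i x -> J i x *m J i x = - 1%:M) &
      forall i x, chart_img i x ->
        exists (W : set 'rV[R]_(n + n))
               (psi phi : 'rV[R]_(n + n) -> 'rV[R]_(n + n)),
          [/\ [/\ open W, W x & W `<=` chart_img i],
              open (psi @` W) /\ (forall y, W y -> phi (psi y) = y),
              smooth_mx_on W psi,
              smooth_mx_on (psi @` W) phi &
              forall y, W y ->
                J i y *m jacobian psi y = jacobian psi y *m std_J R n] ].

(* Complex differential forms on an open subset of R^m, given by their values *)
(* on complex tangent vectors.                                                *)
Section Forms.
Context {R : realType} {m : nat}.
Local Notation C := R[i].
Local Notation toC := (map_mx (real_complex R)).

Definition form (p : nat) := 'rV[R]_m -> ('I_p -> 'rV[C]_m) -> C.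

Definition form0 (f : 'rV[R]_m -> R) : form 0 := fun x _ => (f x)%:C.

Definition form_of_mx (W : 'rV[R]_m -> 'M[R]_m) : form 2 := fun x v =>
  (v ord0 *m toC (W x) *m (v ord_max)^T) 0 0.

Definition mx_of_form (a : form 2) (x : 'rV[R]_m) : 'M[C]_m :=
  \matrix_(s, t) a x (fun e => if e == ord0 then delta_mx 0 s else delta_mx 0 t).

Definition partial (f : 'rV[R]_m -> C) (a : 'I_m) (x : 'rV[R]_m) : C :=
  ('D_(delta_mx 0 a) (fun y => complex.Re (f y)) x) +i*
  ('D_(delta_mx 0 a) (fun y => complex.Im (f y)) x).

(* Constant (complex) vector fields commute, hence                            *)
(* da(v_0, ..., v_p) = \sum_s (-1)^s v_s . a(v_0, .., v_s omitted, .., v_p).  *)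
Definition ext_d p (a : form p) : form p.+1 := fun x v =>
  \sum_(s < p.+1) (-1) ^+ s *
    \sum_(j < m) v s 0 j * partial (fun y => a y (fun t => v (lift s t))) j x.

Definition wedge p q (a : form p) (b : form q) : form (p + q) := fun x v =>
  ((p`! * q`!)%:R)^-1 *
  \sum_(s : 'S_(p + q)) (-1) ^+ odd_perm s *
    a x (fun t => v (s (lshift q t))) * b x (fun t => v (s (rshift p t))).

Fixpoint wedge_pow (a : form 2) (k : nat) : form (k * 2) :=
  match k return form (k * 2) with
  | 0 => form0 (fun=> 1)
  | k'.+1 => wedge a (@wedge_pow a k')
  end.

#[global] Arguments wedge_pow a k : clear implicits.

Section TypeDecomposition.
Variable J : 'rV[R]_m -> 'M[R]_m.

(* The projections of the complexified tangent space onto the eigenspaces     *)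
(* T^{1,0} and T^{0,1} of J, for the eigenvalues i and -i.                    *)
Definition proj10 (x : 'rV[R]_m) : 'M[C]_m :=
  2^-1 *: (1%:M - 'i%C *: toC (J x)).
Definition proj01 (x : 'rV[R]_m) : 'M[C]_m :=
  2^-1 *: (1%:M + 'i%C *: toC (J x)).

(* The component of bidegree (p, r - p). *)
Definition bideg r (p : nat) (a : form r) : form r := fun x v =>
  \sum_(S : {set 'I_r} | #|S| == p)
    a x (fun t => v t *m (if t \in S then proj10 x else proj01 x)).

Definition del r (a : form r) : form r.+1 := fun x v =>
  \sum_(p < r.+1) bideg p.+1 (ext_d (bideg p a)) x v.

Definition delbar r (a : form r) : form r.+1 := fun x v =>
  \sum_(p < r.+1) bideg p (ext_d (bideg p a)) x v.

Definition dc r (a : form r) : form r.+1 := fun x v =>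
  'i%C * (delbar a x v - del a x v).

Definition ddbar (u : 'rV[R]_m -> R) : form 2 := fun x v =>
  'i%C * del (delbar (form0 u)) x v.

(* For [Pi] an involution commuting with [J] and [eps = 1] or [-1]: the       *)
(* component of a 2-form in Lambda_eps^{1,0} /\ Lambda_eps^{0,1}, obtained    *)
(* by projecting the arguments onto ker (Pi - eps).                           *)
Definition part_pm (Pi : 'rV[R]_m -> 'M[R]_m) (eps : R) (a : form 2) : form 2 :=
  fun x v => bideg 1 a x (fun t => v t *m toC (2^-1 *: (1%:M + eps *: Pi x))).

(* The complex rank of T_eps^{1,0} = ker (Pi - eps) \cap T^{1,0}. *)
Definition rank_T (Pi : 'rV[R]_m -> 'M[R]_m) (eps : R) (x : 'rV[R]_m) : nat :=
  \rank (kermx (toC (Pi x) - (eps%:C)%:M) :&: kermx (toC (J x) - 'i%C%:M))%MS.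

End TypeDecomposition.

(* tr_w a = w^{j \bar k} a_{j \bar k} for (1,1)-forms. The trace of w^-1 a on *)
(* the whole complexified tangent space counts T^{1,0} and T^{0,1}, whence    *)
(* the factor 1/2; thus tr_w w is the complex dimension.                      *)
Definition trace_form (w a : form 2) (x : 'rV[R]_m) : C :=
  2^-1 * \tr (invmx (mx_of_form w x) *m mx_of_form a x).

End Forms.

Section GeneralizedKahler.
Context {R : realType} {n : nat} {M : topologicalType}.
Variable A : smooth_atlas R (n + n) M.

(* g(J u, v) *)
Definition fundamental_form (g J : tensor A) (i : chart_index A) :
    @form R (n + n) 2 :=
  form_of_mx (fun x => J i x *m g i x).

Record generalized_kahler (g JA JB : tensor A) : Prop := {
  gk_metric : riemannian_metric g;
  gk_JA : complex_structure JA;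
  gk_JB : complex_structure JB;
  gk_hermitian_A : hermitian_for g JA;
  gk_hermitian_B : hermitian_for g JB;
  gk_dc : forall i x v, chart_img i x ->
    dc (JA i) (fundamental_form g JA i) x v =
    - dc (JB i) (fundamental_form g JB i) x v;
  gk_ddc_A : forall i x v, chart_img i x ->
    ext_d (dc (JA i) (fundamental_form g JA i)) x v = 0;
  gk_ddc_B : forall i x v, chart_img i x ->
    ext_d (dc (JB i) (fundamental_form g JB i)) x v = 0
}.

Definition commuting (JA JB : tensor A) : Prop :=
  forall i x, chart_img i x -> JA i x *m JB i x = JB i x *m JA i x.

(* The operator JA \o JB. *)
Definition Pi_of (JA JB : tensor A) : tensor A := fun i x => JB i x *m JA i x.

Definition omega_pm (g JA JB : tensor A) (eps : R) (i : chart_index A) :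
    @form R (n + n) 2 :=
  part_pm (JA i) (Pi_of JA JB i) eps (fundamental_form g JA i).

Definition ddbar_pm (JA JB : tensor A) (eps : R) (u : M -> R)
    (i : chart_index A) : @form R (n + n) 2 :=
  part_pm (JA i) (Pi_of JA JB i) eps (ddbar (JA i) (u \o chart_inv i)).

End GeneralizedKahler.

(* Main.v *)
Require Import Defs.
From HB Require Import structures.
From mathcomp Require Import all_boot all_order all_algebra all_fingroup.
From mathcomp Require Import complex.
From mathcomp Require Import all_classical all_reals all_analysis.
From mathcomp Require Import ring lra zify.

Set Implicit Arguments.
Unset Strict Implicit.
Unset Printing Implicit Defensive.

Import Order.TTheory GRing.Theory Num.Theory.
Import numFieldNormedType.Exports.

Local Open Scope classical_set_scope.
Local Open Scope ring_scope.
Local Open Scope complex_scope.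

(* The trace condition makes w = sup u - u a supersolution, up to a constant, of a
   fixed linear elliptic operator, so it suffices to bound w from below by a
   multiple of its maximum.  Near a minimum point x0 of u consider the points where
   u plus a small paraboloid is touched from below by a hyperplane.  There the
   Hessian of u is almost nonnegative, the equation on T_+ then bounds
   i del delbar u from above on T_+ in terms of sup F_+, and the positivity of
   omega_- - i del_- delbar_- u does so on T_-; hence the Hessian is bounded.
   As in the Alexandrov-Bakelman-Pucci estimate, slopes in a fine grid are thus
   attained at separated contact points: about h^-m points at mutual distance at
   least h, near all of which w is almost maximal.  A sum of powers q^-s with poles
   at these points is a subsolution of size h^-m, and comparison gives
   w >= c w(x0) - C on a whole coordinate cube.  The same comparison with a single
   pole propagates such bounds from one cube to another; since M is compact and
   connected, they hold everywhere, in particular where w = 0. *)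

(** * Differential calculus on R^m *)

(** The scale h of the contact points depends on the modulus of continuity of the Hessian of u and
    is not controlled; only N h^m, with N the number of points, is bounded below by the background,
    so the constants may see h only through this product. This dictates the exponent of the barrier
    |z|^-(m-1): exceeding m - 2, it leaves room for variable coefficients and drift on a small cube;
    being less than m, it keeps the sum over h-separated poles of order h^-m even next to a pole.
    Finitely many grid slopes replace the area formula. Positivity of omega_- - i del_- delbar_- u
    is not assumed: it spreads from a maximum of u by connectedness, and e^{F_-} > 0 prevents
    degeneration. On the contact set the gradient of u is O(eps), so the torsion due to a varying J
    and the negative part of the Hessian are both absorbed in g/2 by an eps that depends on the
    background only. Growth bounds have the form K <= B (w + 1), which survives chaining and at w =
    0 bounds the oscillation. *)

Section Calculus.
Context {R : realType} {m : nat}.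
Local Notation rV := 'rV[R]_m.
Local Notation e_ a := (delta_mx 0 a : 'rV[R]_m).

Lemma coord_le_norm (x : rV) a : `|x 0 a| <= `|x|.
Proof.
rewrite [leRHS]/Num.norm /= mx_normrE.
by apply/bigmax_geP; right => /=; exists (0, a).
Qed.

Lemma norm_le_coord (x : rV) c : 0 <= c -> (forall a, `|x 0 a| <= c) -> `|x| <= c.
Proof.
move=> c0 xc; rewrite [leLHS]/Num.norm /= mx_normrE.
by apply/bigmax_leP; split => // -[i a] _ /=; rewrite ord1.
Qed.

Lemma norm_delta_le1 a : `|e_ a| <= 1.
Proof.
apply: norm_le_coord => // b; rewrite mxE /=.
by case: (b == a); rewrite ?normr1 ?normr0.
Qed.

Lemma is_derive_line (W : normedModType R) (f : rV -> W) (x v : rV) t d :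
  is_derive (x + t *: v) v f d -> is_derive t (1 : R) (fun s => f (x + s *: v)) d.
Proof.
move=> [df dE].
have E : (fun h : R => h^-1 *: (((fun s => f (x + s *: v)) \o shift t) (h *: (1 : R))
           - f (x + t *: v))) =
         (fun h : R => h^-1 *: ((f \o shift (x + t *: v)) (h *: v) - f (x + t *: v))).
  apply: boolp.funext => h /=; congr (_ *: (f _ - _)).
  by rewrite /= scalerDl [h *: 1]mulr1 addrCA addrA.
by split; rewrite /derivable /derive /= E.
Qed.

(** With c the expected slope this is a differentiability estimate, with c = 0 a Lipschitz bound.
    The interval |t| <= |s| is symmetric so that one statement covers both signs of s. *)
Lemma mvt_bound (f df : R -> R) (s c e : R) :
  (forall t : R, `|t| <= `|s| -> is_derive t (1 : R) f (df t)) ->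
  (forall t : R, `|t| <= `|s| -> `|df t - c| <= e) ->
  `|f s - f 0 - s * c| <= e * `|s|.
Proof.
move=> fd dfc.
have main a b : a <= b -> (forall t, a <= t <= b -> `|t| <= `|s|) ->
    `|f b - f a - (b - a) * c| <= e * (b - a).
  move=> ab abs.
  have [x xab ->] : exists2 x, x \in `[a, b] & f b - f a = df x * (b - a).
    apply: MVT_segment => //.
      move=> x; rewrite in_itv /= => /andP[ax xb].
      by apply: fd; apply: abs; rewrite !ltW.
    apply: derivable_within_continuous => x; rewrite in_itv /= => axb.
    by have [] := fd _ (abs _ axb).
  rewrite [_ * c]mulrC -mulrBl normrM [`|b - a|]ger0_norm ?subr_ge0 //.
  by apply: ler_wpM2r; rewrite ?subr_ge0//; apply: dfc; apply: abs; rewrite in_itv /= in xab.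
have [s0|s0] := leP 0 s.
  have := main 0 s s0; rewrite subr0 ger0_norm //; apply => t /andP[t0 ts].
  by rewrite ger0_norm.
have := main s 0 (ltW s0); rewrite sub0r ltr0_norm // mulNr opprK => H.
rewrite (_ : f s - f 0 - s * c = - (f 0 - f s + s * c)); last by ring.
rewrite normrN; apply: H => t /andP[st t0].
by rewrite (ler0_norm t0) lerN2.
Qed.

(** The derivatives are data, so that they can be closed formulas and those of composite functions
    are assembled rule by rule. *)
Definition C1on (U : set rV) (f : rV -> R) (df : 'I_m -> rV -> R) :=
  forall x, U x -> forall a,
    is_derive x (e_ a) f (df a x) /\ {for x, continuous (df a)}.

(* [df a] is the derivative of [f] along the coordinate [a], and [hf a b] is the
   derivative of [df b] along [a]. *)
Definition C2on (U : set rV) (f : rV -> R) df (hf : 'I_m -> 'I_m -> rV -> R) :=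
  C1on U f df /\ forall b, C1on U (df b) (fun a => hf a b).

Lemma near0_lt (r : R) : 0 < r -> \forall h \near (0 : rV), `|h| < r.
Proof. exact: nbhs0_lt. Qed.

Lemma nearVP (x : rV) (P : set rV) :
  (\forall y \near x, P y) <-> exists2 r : R, 0 < r & forall y, `|y - x| < r -> P y.
Proof.
split=> [/nbhs_ballP[r /= r0 H]|[r r0 H]].
  by exists r => // y yx; apply: H; rewrite -ball_normE /= distrC.
apply/nbhs_ballP; exists r => //= y; rewrite -ball_normE /= distrC.
exact: H.
Qed.

Lemma open_ballV (U : set rV) x : open U -> U x ->
  exists2 r : R, 0 < r & forall y, `|y - x| < r -> U y.
Proof. by move=> Uo Ux; apply/nearVP; exact: open_nbhs_nbhs. Qed.

Lemma near_forallV (I : finType) (x : rV) (P : I -> set rV) :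
  (forall i, \forall y \near x, P i y) -> \forall y \near x, forall i, P i y.
Proof.
have F : Filter (nbhs x) by exact: nbhs_filter.
by move=> /filter_forall.
Qed.

Lemma nearS (x : rV) (P Q : set rV) :
  (forall y, P y -> Q y) -> (\forall y \near x, P y) -> \forall y \near x, Q y.
Proof.
have F : Filter (nbhs x) by exact: nbhs_filter.
by move=> PQ; apply: filterS.
Qed.

Lemma nearI (x : rV) (P Q : set rV) :
  (\forall y \near x, P y) -> (\forall y \near x, Q y) ->
  \forall y \near x, P y /\ Q y.
Proof.
have F : Filter (nbhs x) by exact: nbhs_filter.
by move=> H1 H2; apply: filterI.
Qed.

Lemma cts_atP (f : rV -> R) (x : rV) : {for x, continuous f} <->
  (forall e : R, 0 < e -> \forall y \near x, `|f x - f y| <= e).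
Proof.
split=> [fx|H].
  have fx' : f @ x --> (f x : R^o) by [].
  by move: fx' => /cvgrPdist_le.
have F : Filter (nbhs x) by exact: nbhs_filter.
suff : f @ (nbhs x) --> (f x : R^o) by [].
exact/cvgrPdist_le.
Qed.

Let trunc (k : nat) (h : rV) : rV := \row_a (if (a < k)%N then h 0 a else 0).

(** Walk from x to x + h along the coordinate axes, with corners x + [trunc k h]; the mean value
    theorem on each segment costs e |h|. *)
Lemma c1_estimate U f df x : open U -> C1on U f df -> U x -> forall eps, 0 < eps ->
  \forall h \near (0 : rV), `|f (x + h) - f x - \sum_a h 0 a * df a x| <= eps * `|h|.
Proof.
move=> Uo fC Ux eps eps0.
(* There are m segments; dividing by m + 1 also covers m = 0. *)
pose e := eps / m.+1%:R.
have e0 : 0 < e by rewrite divr_gt0.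
have : \forall y \near x, U y /\ forall a, `|df a y - df a x| <= e.
  have /filter_forall H : forall a, \forall y \near x, `|df a y - df a x| <= e.
    move=> a; have [_] := fC _ Ux a => /cvgr_dist_le /(_ _ e0).
    by apply: filterS => y; rewrite distrC.
  near=> y; split; first by near: y; exact: open_nbhs_nbhs.
  by near: y.
move=> /nbhs_ballP[r /= r0 rU].
near=> h.
have hr : `|h| < r.
  by near: h; exact: near0_lt.
have tn k (t : R) (a : 'I_m) : nat_of_ord a = k -> `|t| <= `|h 0 a| ->
    ball x r (x + (trunc k h + t *: e_ a)).
  move=> ak ta; rewrite -ball_normE /= opprD addNKr normrN.
  apply: le_lt_trans hr; apply: norm_le_coord => // b; rewrite !mxE /=.
  have [->|ba] := eqVneq b a.
    by rewrite ak ltnn add0r mulr1 (le_trans ta) // coord_le_norm.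
  by rewrite mulr0 addr0; case: ifP; rewrite ?normr0 // coord_le_norm.
have t0 : trunc 0 h = 0 by apply/rowP => a; rewrite !mxE.
have tm : trunc m h = h by apply/rowP => a; rewrite !mxE ltn_ord.
have tS (a : 'I_m) : trunc a.+1 h = trunc a h + h 0 a *: e_ a.
  apply/rowP => b; rewrite !mxE /= ltnS.
  have [->|ba] := eqVneq b a; first by rewrite leqnn ltnn add0r mulr1.
  by rewrite mulr0 addr0 [in RHS]ltn_neqAle; move: ba; rewrite -val_eqE /= => ->.
have -> : f (x + h) - f x = \sum_(a < m) (f (x + trunc a.+1 h) - f (x + trunc a h)).
  rewrite -(big_mkord xpredT (fun k => f (x + trunc k.+1 h) - f (x + trunc k h))).
  by rewrite (telescope_sumr (fun k => f (x + trunc k h))) // tm t0 addr0.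
rewrite -sumrB; apply: le_trans (ler_norm_sum _ _ _) _.
apply: (@le_trans _ _ (\sum_(a < m) (e * `|h|))); last first.
  rewrite sumr_const card_ord -mulr_natl mulrA ler_wpM2r // /e mulrCA ler_piMr ?(ltW eps0) //.
  by rewrite ler_pdivrMr // mul1r ler_nat.
apply: ler_sum => a _; rewrite tS.
pose g (t : R) := f ((x + trunc a h) + t *: e_ a).
have := @mvt_bound g (fun t => df a ((x + trunc a h) + t *: e_ a)) (h 0 a) (df a x) e.
rewrite /g scale0r addr0 addrA => H.
apply: le_trans (H _ _) _.
- move=> t ta; apply: is_derive_line.
  have [Uy _] := rU _ (tn a t a erefl ta).
  by rewrite -addrA; have [] := fC _ Uy a.
- by move=> t ta; rewrite -addrA; have [_ ] := rU _ (tn a t a erefl ta); apply.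
- by rewrite ler_pM2l // coord_le_norm.
Unshelve. all: by end_near. Qed.

Lemma C1_cts U f df x : open U -> C1on U f df -> U x -> {for x, continuous f}.
Proof.
move=> Uo fC Ux; apply/cts_atP => e e0.
have H := c1_estimate Uo fC Ux ltr01.
pose K := \sum_a `|df a x| + 1.
have K0 : 0 < K by rewrite ltr_wpDl // sumr_ge0.
have [r r0 {}H] := proj1 (nearVP 0 _) H.
apply/nearVP; exists (Num.min r (e / K)).
  by rewrite lt_min r0 divr_gt0.
move=> y; rewrite lt_min => /andP[yr yK].
have {H} := H (y - x); rewrite subr0 => /(_ yr); rewrite subrKC => H.
rewrite distrC.
set h := y - x in yr yK H.
rewrite -(subrK (\sum_a h 0 a * df a x) (_ - _)).
apply: le_trans (ler_normD _ _) _.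
apply: (@le_trans _ _ (`|h| + \sum_a `|h| * `|df a x|)).
  apply: lerD; first by rewrite mul1r in H.
  apply: le_trans (ler_norm_sum _ _ _) _; apply: ler_sum => a _.
  by rewrite normrM ler_wpM2r // coord_le_norm.
rewrite -mulr_sumr -[X in X + _]mulr1 -mulrDr addrC.
by rewrite -ler_pdivlMr // ltW.
Qed.

Lemma diffI (W : normedModType R) (f : rV -> W) (L : {linear rV -> W}) x (K : R) :
  (forall h, `|L h| <= K * `|h|) ->
  (forall eps : R, 0 < eps ->
     \forall h \near (0 : rV), `|f (x + h) - f x - L h| <= eps * `|h|) ->
  differentiable f x /\ 'd f x = L :> (rV -> W).
Proof.
move=> LK fL.
have Lc : continuous L.
  apply/linear_bounded_continuous/linear_boundedP.
  exists K; split; first exact: num_real.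
  by move=> r Kr h; apply: le_trans (LK h) _; rewrite ler_wpM2r // ltW.
have fo : f \o shift x = cst (f x) + L +o_ (0 : rV) id.
  apply/eqaddoP => e e0; have := fL e e0; apply: filterS => h.
  by rewrite !fctE /= /shift opprD addrA [h + x]addrC.
have dE := diff_unique Lc fo.
by split=> //; apply/diff_locallyP; rewrite dE; split.
Qed.

Definition lform (c : 'I_m -> R) (h : rV) : R := \sum_a h 0 a * c a.

Lemma lform_linear c : linear (lform c : rV -> R^o).
Proof.
move=> k u v; rewrite /lform scaler_sumr -big_split; apply: eq_bigr => a _ /=.
by rewrite !mxE mulrDl -mulrA.
Qed.

HB.instance Definition _ c :=
  GRing.isLinear.Build R rV R^o _ (lform c : rV -> R^o) (lform_linear c).

Lemma lform_le c h : `|lform c h| <= (\sum_a `|c a|) * `|h|.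
Proof.
rewrite mulr_suml; apply: le_trans (ler_norm_sum _ _ _) _; apply: ler_sum => a _.
by rewrite normrM mulrC ler_wpM2l // coord_le_norm.
Qed.

Lemma C1_diff U (f : rV -> R) df x : open U -> C1on U f df -> U x ->
  differentiable (f : rV -> R^o) x /\ forall v, 'd (f : rV -> R^o) x v = lform (df^~ x) v.
Proof.
move=> Uo fC Ux.
have [||fd fE] := @diffI R^o f (lform (df^~ x) : rV -> R^o) x (\sum_a `|df a x|).
- exact: lform_le.
- by move=> e e0; have := c1_estimate Uo fC Ux e0; exact.
- by split => // v; rewrite fE.
Qed.

Lemma C1_derive U (f : rV -> R) df x v : open U -> C1on U f df -> U x ->
  is_derive x v (f : rV -> R) (lform (df^~ x) v).
Proof.
move=> Uo fC Ux; have [fd fE] := C1_diff Uo fC Ux.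
split; first exact: diff_derivable.
by rewrite (deriveE v fd) fE.
Qed.

Lemma C1_vec_diff p U (F : rV -> 'rV[R]_p) (DF : 'I_m -> 'I_p -> rV -> R) x :
  open U -> (forall b, C1on U (fun y => F y 0 b) (DF^~ b)) -> U x ->
  differentiable F x /\ jacobian F x = \matrix_(a, b) DF a b x.
Proof.
move=> Uo FC Ux.
pose A : 'M[R]_(m, p) := \matrix_(a, b) DF a b x.
have AE h b : (h *m A) 0 b = lform ((DF^~ b)^~ x) h.
  by rewrite mxE; apply: eq_bigr => a _; rewrite mxE.
have normle (y : 'rV[R]_p) c : 0 <= c -> (forall a, `|y 0 a| <= c) -> `|y| <= c.
  move=> c0 xc; rewrite [leLHS]/Num.norm /= mx_normrE.
  by apply/bigmax_leP; split => // -[i a] _ /=; rewrite ord1.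
have [|e e0|Fd FE] := @diffI _ F (mulmxr A) x (\sum_b \sum_a `|DF a b x|).
- move=> h; apply: normle => [|b].
    by rewrite mulr_ge0 // sumr_ge0 // => b _; rewrite sumr_ge0.
  rewrite AE; apply: le_trans (lform_le _ _) _; apply: ler_wpM2r => //.
  by rewrite (bigD1 b) //= lerDl; apply: sumr_ge0 => c _; exact: sumr_ge0.
- have : \forall h \near (0 : rV), forall b,
      `|F (x + h) 0 b - F x 0 b - lform ((DF^~ b)^~ x) h| <= e * `|h|.
    apply: near_forallV => b; exact: c1_estimate Uo (FC b) Ux e e0.
  apply: nearS => h H; apply: normle => [|b]; first by rewrite mulr_ge0 // ltW.
  by have := H b; rewrite -AE !mxE.
- split => //; rewrite /jacobian; apply/row_matrixP => a.
  by rewrite !rowE mul_rV_lin1 FE.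
Qed.

(** The second difference [D] over a square of side s is symmetric in the two directions; two
    applications of the mean value theorem, in either order, put it within e s^2 of s^2 times the
    mixed derivative. *)
Lemma schwarz U f df hf x a b : open U -> C2on U f df hf -> U x ->
  hf a b x = hf b a x.
Proof.
move=> Uo [fC dfC] Ux.
suff H (e : R) : 0 < e -> `|hf a b x - hf b a x| <= e + e.
  apply/eqP; rewrite -subr_eq0 -normr_le0; apply/ler_addgt0Pl => /= e e0.
  by rewrite addr0; apply: le_trans (H (e / 2) _) _; rewrite ?divr_gt0 // -splitr.
move=> e0.
pose D (a b : 'I_m) s := f (x + s *: e_ a + s *: e_ b) - f (x + s *: e_ b)
                         - (f (x + s *: e_ a) - f x).
have main c d : exists2 r : R, 0 < r & forall s, 0 < s -> s < r ->
    `|D c d s - s * (s * hf c d x)| <= e * s * s.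
  have [_ /cts_atP/(_ e e0)] := dfC d x Ux c; move=> /nearVP[r0 r00 hr0].
  have [r1 r10 hr1] := open_ballV Uo Ux.
  exists (Num.min r0 r1 / 2); first by rewrite divr_gt0 // lt_min r00.
  move=> s s0 sr.
  have near s' t : `|s'| <= `|s| -> `|t| <= `|s| ->
      `|x + s' *: e_ c + t *: e_ d - x| < Num.min r0 r1.
    rewrite (gtr0_norm s0) => s's ts.
    have -> : x + s' *: e_ c + t *: e_ d - x = s' *: e_ c + t *: e_ d.
      by rewrite -(addrA x) (addrC x) addrK.
    apply: le_lt_trans (ler_normD _ _) _; rewrite !normrZ.
    have := norm_delta_le1 c; have := norm_delta_le1 d => d1 c1.
    apply: (@le_lt_trans _ _ (s + s)).
      by apply: lerD; rewrite -[leRHS]mulr1 ler_pM.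
    by rewrite (splitr (Num.min r0 r1)) ltrD.
  have inU s' t : `|s'| <= `|s| -> `|t| <= `|s| -> U (x + s' *: e_ c + t *: e_ d).
    by move=> /near h /h; rewrite lt_min => /andP[_] /hr1.
  pose G t := f (x + s *: e_ c + t *: e_ d) - f (x + t *: e_ d).
  pose dG t := df d (x + s *: e_ c + t *: e_ d) - df d (x + t *: e_ d).
  have := @mvt_bound G dG s (s * hf c d x) (e * s).
  have -> : G s - G 0 = D c d s by rewrite /G /D !scale0r !addr0.
  rewrite (gtr0_norm s0); apply.
    move=> t ts; apply: is_deriveB; apply: is_derive_line.
      have := inU s t (lexx _); rewrite (gtr0_norm s0) => /(_ ts) Uy.
      by have [] := fC _ Uy d.
    have := inU 0 t; rewrite normr0 scale0r addr0 => /(_ (normr_ge0 _)).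
    by rewrite (gtr0_norm s0) => /(_ ts) Uy; have [] := fC _ Uy d.
  move=> t ts.
  pose g s' := df d (x + t *: e_ d + s' *: e_ c).
  have := @mvt_bound g (fun s' => hf c d (x + t *: e_ d + s' *: e_ c)) s (hf c d x) e.
  rewrite /g scale0r addr0 /dG (addrAC x _ (s *: _)) (gtr0_norm s0); apply.
    move=> s' s's; apply: is_derive_line; rewrite addrAC.
    have := inU s' t; rewrite (gtr0_norm s0) => /(_ s's ts) Uy.
    by have [] := dfC d _ Uy c.
  move=> s' s's; rewrite distrC addrAC; apply: hr0.
  have := near s' t; rewrite (gtr0_norm s0) => /(_ s's ts).
  by rewrite lt_min => /andP[].
have [r1 r10 h1] := main a b.
have [r2 r20 h2] := main b a.
pose s := Num.min r1 r2 / 2.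
have s0 : 0 < s by rewrite divr_gt0 // lt_min r10.
have sr : s < Num.min r1 r2 by rewrite ltr_pdivrMr // ltr_pMr ?ltr1n // lt_min r10.
move: (sr); rewrite lt_min => /andP[sr1 sr2].
have := h1 s s0 sr1; have := h2 s s0 sr2.
have -> : D b a s = D a b s by rewrite /D (addrAC x); ring.
move=> H1 H2.
have ss : 0 < s * s by rewrite mulr_gt0.
rewrite -(ler_pM2r ss) -{1}(gtr0_norm ss) -normrM.
rewrite (_ : _ * (s * s) = (D a b s - s * (s * hf b a x)) - (D a b s - s * (s * hf a b x))); last by ring.
apply: le_trans (ler_normB _ _) _; rewrite mulrDl.
by apply: lerD; rewrite [leRHS]mulrA.
Qed.

Lemma C1_min U f df x : open U -> C1on U f df -> U x ->
  (\forall y \near x, f x <= f y) -> forall a, df a x = 0.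
Proof.
move=> Uo fC Ux /nearVP[r r0 fmin] a.
suff H (e : R) : 0 < e -> forall t : R, `|t| = 1 -> - e <= t * df a x.
  apply/eqP; rewrite -normr_le0; apply/ler_addgt0Pl => /= e e0; rewrite addr0.
  have := H e e0 1 (normr1 _); have := H e e0 (-1) (normrN1 _).
  by rewrite ler_norml; lra.
move=> e0 t t1.
have [r1 r10 {}fC] := proj1 (nearVP 0 _) (c1_estimate Uo fC Ux e0).
pose s := Num.min r r1 / 2.
have mr : 0 < Num.min r r1 by rewrite lt_min r0.
have s0 : 0 < s by rewrite divr_gt0.
have sr : s < Num.min r r1 by rewrite ltr_pdivrMr // ltr_pMr ?ltr1n.
pose h : rV := (s * t) *: e_ a.
have hs : `|h| <= s.
  rewrite /h normrZ normrM t1 mulr1 gtr0_norm // -[leRHS]mulr1.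
  by rewrite ler_pM2l // norm_delta_le1.
move: sr; rewrite lt_min => /andP[sr sr1].
have := fC h; rewrite subr0 => /(_ (le_lt_trans hs sr1)).
have := fmin (x + h); rewrite (addrC x) addrK => /(_ (le_lt_trans hs sr)).
rewrite [h + x]addrC (bigD1 a) //= big1 => [|b ba]; last first.
  by rewrite !mxE /= (negbTE ba) mulr0 mul0r.
rewrite !mxE /= eqxx mulr1 addr0 ler_norml => f0 /andP[_ fe].
have : e * `|h| <= e * s by rewrite ler_pM2l.
move=> ehs; rewrite -(ler_pM2l s0); lra.
Qed.

Lemma is_derive_halfsq (q t : R) :
  is_derive t (1 : R) (fun t : R => q * (t * t) / 2) (q * t).
Proof.
have -> : (fun t : R => q * (t * t) / 2) = (q / 2) *: ((id : R -> R) * id).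
  by apply: boolp.funext => z; change (q * (z * z) / 2 = q / 2 * (z * z)); ring.
by apply: is_derive_eq; rewrite /GRing.scale /=; field.
Qed.

(** Along the direction v, subtracting q t^2 / 2 leaves a function whose derivative is at most e s
    for |t| <= s. So f(x + s v) - f(x) is within e s^2 of q s^2 / 2, and a minimum forces q >= - 2
    e. *)
Lemma C2_min U f df hf x : open U -> C2on U f df hf -> U x ->
  (\forall y \near x, f x <= f y) ->
  forall v : rV, 0 <= \sum_b v 0 b * lform (fun a => hf a b x) v.
Proof.
move=> Uo [fC dfC] Ux fmin v.
have df0 := C1_min Uo fC Ux fmin.
set q := \sum_b _.
pose N := `|v| * (\sum_b `|v 0 b|) + 1.
have N0 : 0 < N by rewrite ltr_wpDl // mulr_ge0 // sumr_ge0.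
suff H (e : R) : 0 < e -> - (e + e) <= q.
  rewrite -oppr_le0; apply/ler_addgt0Pl => /= e e0.
  have := H (e / 2) ltac:(rewrite divr_gt0 //); rewrite -splitr; lra.
move=> e0.
have : \forall h \near (0 : rV), forall b,
    `|df b (x + h) - lform (fun a => hf a b x) h| <= e / N * `|h|.
  apply: near_forallV => b.
  have := c1_estimate Uo (dfC b) Ux (divr_gt0 e0 N0).
  by apply: nearS => h; rewrite df0 subr0.
move=> /nearVP[r r0 Hr]; move/nearVP: fmin => [r1 r10 fmin].
have [r2 r20 hU] := open_ballV Uo Ux.
pose rr := Num.min r (Num.min r1 r2).
have rr0 : 0 < rr by rewrite !lt_min r0 r10.
pose s := rr / (`|v| + 1).
have v1 : 0 < `|v| + 1 by rewrite ltr_wpDl.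
have s0 : 0 < s by rewrite divr_gt0.
have sv t : `|t| <= s -> `|t *: v| < rr.
  move=> ts; rewrite normrZ; apply: (@le_lt_trans _ _ (s * `|v|)).
    by rewrite ler_wpM2r.
  rewrite /s -mulrA gtr_pMr // mulrC ltr_pdivrMr // mul1r.
  by rewrite ltrDl.
have inU t : `|t| <= s -> U (x + t *: v).
  move=> /sv; rewrite !lt_min => /and3P[_ _ tr]; apply: hU.
  by rewrite addrC addKr.
pose k t := f (x + t *: v) - q * (t * t) / 2.
pose dk t := lform (df^~ (x + t *: v)) v - q * t.
have := @mvt_bound k dk s 0 (e * s).
rewrite (gtr0_norm s0) => H.
have : `|k s - k 0 - s * 0| <= e * s * s.
  apply: H => t ts.
    apply: is_deriveB; first exact: is_derive_line (C1_derive v Uo fC (inU t ts)).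
    exact: is_derive_halfsq.
  rewrite subr0 /dk /q /lform mulr_suml -sumrB.
  apply: (@le_trans _ _ (\sum_b `|v 0 b| * (e / N * (s * `|v|)))).
    apply: le_trans (ler_norm_sum _ _ _) _; apply: ler_sum => b _.
    rewrite -mulrA -mulrBr normrM ler_wpM2l //.
    have := Hr (t *: v); rewrite subr0 => /(_ _ b).
    have /sv := ts; rewrite !lt_min => /and3P[tr _ _] /(_ tr).
    rewrite [X in _ - X](_ : _ = (\sum_a v 0 a * hf a b x) * t); last first.
      by rewrite mulr_suml; apply: eq_bigr => a _; rewrite mxE; ring.
    move=> /le_trans; apply; apply: ler_wpM2l; first exact: divr_ge0 (ltW e0) (ltW N0).
    by rewrite normrZ ler_wpM2r.
  have -> : \sum_b `|v 0 b| * (e / N * (s * `|v|)) =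
            (\sum_b `|v 0 b|) * (e / N * (s * `|v|)) by rewrite mulr_suml.
  have -> : (\sum_b `|v 0 b|) * (e / N * (s * `|v|)) =
            e * s * ((`|v| * \sum_b `|v 0 b|) / N) by ring.
  rewrite ler_piMr ?mulr_ge0 ?ltW // ltr_pdivrMr // mul1r.
  by rewrite ltrDl.
rewrite mulr0 subr0 /k scale0r addr0 mulr0 mulr0 mul0r subr0 ler_norml => /andP[_ kk].
have : f x <= f (x + s *: v).
  apply: fmin; rewrite addrC addKr.
  by have := sv s; rewrite gtr0_norm // !lt_min => /(_ (lexx _)) /and3P[].
move=> fxs.
have ss : 0 < s * s by rewrite mulr_gt0.
rewrite -(ler_pM2r ss); lra.
Qed.

(** The segment is extended to |t| <= 1 because [mvt_bound] is symmetric about 0. *)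
Lemma C1_lipschitz U f df x y K : open U -> C1on U f df ->
  (forall t : R, `|t| <= 1 -> U (x + t *: (y - x))) ->
  (forall (t : R) a, `|t| <= 1 -> `|df a (x + t *: (y - x))| <= K) ->
  `|f y - f x| <= m%:R * K * `|y - x|.
Proof.
move=> Uo fC inU dK.
have := @mvt_bound (fun t => f (x + t *: (y - x)))
  (fun t => lform (df^~ (x + t *: (y - x))) (y - x)) 1 0 (m%:R * K * `|y - x|).
rewrite scale1r scale0r addr0 subrKC mulr0 subr0 normr1 mulr1; apply => t t1.
  exact: is_derive_line (C1_derive _ Uo fC (inU t t1)).
rewrite subr0; apply: le_trans (lform_le _ _) _; apply: ler_wpM2r => //.
apply: (@le_trans _ _ (\sum_(a < m) K)); first by apply: ler_sum => a _; exact: dK.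
by rewrite sumr_const card_ord mulr_natl.
Qed.

End Calculus.

(** Applied twice, it turns a permutation of 2 + 2k positions fixing the first two into one of the
    last 2k, as needed for induction on wedge powers. *)
Lemma lift_perm_fix0 n (s : 'S_n.+1) : s ord0 = ord0 ->
  exists t : 'S_n, s = lift_perm ord0 ord0 t.
Proof.
move=> s0.
have sl i : s (lift ord0 i) != ord0.
  by rewrite -{2}s0 (inj_eq perm_inj) eq_sym neq_lift.
pose f i := odflt i (unlift ord0 (s (lift ord0 i))).
have fE i : lift ord0 (f i) = s (lift ord0 i).
  rewrite /f; case: unliftP => [j -> //|E].
  by have := sl i; rewrite E eqxx.
have f_inj : injective f.
  by move=> i j fij; apply: (@lift_inj _ ord0); apply: (@perm_inj _ s); rewrite -!fE fij.
exists (perm f_inj); apply/permP => i.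
by case: (unliftP ord0 i) => [j|] ->; rewrite ?lift_perm_id // lift_perm_lift permE fE.
Qed.

(** * Powers of 2-forms *)

Section WedgePower.
Context {R : realType} {m : nat}.
Local Notation C := R[i].
Local Notation V := 'rV[C]_m.

Lemma wedge_pow_ext (a a' : @Defs.form R m 2) x : (forall w, a x w = a' x w) ->
  forall k v, wedge_pow a k x v = wedge_pow a' k x v.
Proof.
move=> aa'; elim=> [|k IH] v //=.
by congr (_ * _); apply: eq_bigr => s _; rewrite aa' IH.
Qed.

(** In every summand each argument occurs exactly once, so the weights [nu] always multiply to the
    full product, and K depends on k alone. *)
Lemma wedge_pow_le k : exists2 K : R, 0 <= K &
  forall (a : @Defs.form R m 2) x (A : R) (nu : V -> R),
    0 <= A -> (forall w, 0 <= nu w) ->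
    (forall w, `|a x w| <= (A * nu (w ord0) * nu (w ord_max))%:C) ->
    forall v, `|wedge_pow a k x v| <= (K * A ^+ k * \prod_i nu (v i))%:C.
Proof.
elim: k => [|k [K K0 IH]].
  exists 1 => // a x A nu A0 nu0 aA v /=.
  by rewrite /form0 normr1 expr0 big_ord0 !mulr1.
pose D : R := ((2`! * (k * 2)`!)%N%:R)^-1.
have D0 : 0 <= D by rewrite invr_ge0.
exists (D * \sum_(s : 'S_(2 + k * 2)) K); first by rewrite mulr_ge0 // sumr_ge0.
move=> a x A nu A0 nu0 aA v /=; rewrite /wedge normrM.
have -> : `|((2`! * (k * 2)`!)%N%:R : C)^-1| = D%:C.
  by rewrite normfV normr_nat /D -[in LHS](rmorph_nat (real_complex R)) fmorphV.
rewrite -!mulrA [(D * _)%:C]rmorphM /=; apply: ler_wpM2l; first by rewrite ler0c.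
rewrite mulr_suml rmorph_sum /=.
apply: le_trans (ler_norm_sum _ _ _) _; apply: ler_sum => s _.
rewrite !normrM normr_sign mul1r.
apply: le_trans (ler_pM _ _ (aA _) (IH a x A nu A0 nu0 aA _)) _ => //.
rewrite -rmorphM /= lecR.
rewrite (reindex_inj (@perm_inj _ s)) /= big_split_ord /= big_ord_recl big_ord1 /=.
set P := \prod_(i < _) nu _.
rewrite le_eqVlt; apply/orP; left; apply/eqP.
rewrite (_ : lift ord0 ord0 = ord_max); last exact: val_inj.
by rewrite exprS; ring.
Qed.

Section Positivity.
Variables (a : @Defs.form R m 2) (x : 'rV[R]_m) (b : V -> V -> C).
Hypothesis ab : forall w, a x w = b (w ord0) (w ord_max).
Hypothesis banti : forall u w, b u w = - b w u.

Lemma wedge_pow_null k (v : 'I_(k * 2) -> V) i : (forall w, b (v i) w = 0) ->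
  wedge_pow a k x v = 0.
Proof.
elim: k v i => [|k IH] v i; first by case: i.
move=> bv /=; rewrite /wedge big1 ?mulr0 // => s _.
pose j : 'I_(2 + k * 2) := (s^-1)%g i.
have {}bv w : b (v (s j)) w = 0 by rewrite /j permKV.
case: (split_ordP j) => j' E.
  rewrite ab; have [E'|E'] : j' = ord0 \/ j' = ord_max.
    by case: j' {E} => [[|[|]]] //= ?; [left|right]; apply: val_inj.
  - by rewrite -E' -E bv !(mulr0, mul0r).
  - by rewrite -E' banti -E bv oppr0 !(mulr0, mul0r).
by rewrite (IH _ j') ?mulr0 // => w; rewrite -E.
Qed.

Lemma wedge_pow_perm k (v : 'I_(k * 2) -> V) (s : 'S_(k * 2)) :
  wedge_pow a k x (fun i => v (s i)) = (-1) ^+ odd_perm s * wedge_pow a k x v.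
Proof.
case: k v s => [|k] v s.
  by rewrite (_ : s = 1%g) ?odd_perm1 ?mul1r //; apply/permP => -[].
rewrite /= /wedge [RHS]mulrCA; congr (_ * _).
rewrite big_distrr /= [RHS](reindex_inj (mulIg s)) /=; apply: eq_bigr => t _.
rewrite (_ : (fun i => v ((t * s)%g (lshift (k * 2) i))) =
             (fun i => v (s (t (lshift (k * 2) i))))); last first.
  by apply: boolp.funext => i; rewrite permM.
rewrite (_ : (fun i => v ((t * s)%g (rshift 2 i))) =
             (fun i => v (s (t (rshift 2 i))))); last first.
  by apply: boolp.funext => i; rewrite permM.
rewrite odd_permM; case: (odd_perm s); case: (odd_perm t); rewrite /= ?expr0 ?expr1; ring.
Qed.

(** The vectors come in consecutive pairs, [i./2] being the index of the pair. The model is a frame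
    e_0, J e_0, e_1, J e_1, ... that is orthogonal for a positive (1,1)-form. *)
Definition block_positive n (v : 'I_n -> V) :=
  (forall i j : 'I_n, i./2 <> j./2 -> b (v i) (v j) = 0) /\
  (forall i j : 'I_n, i./2 = j./2 -> (i < j)%N -> 0 <= b (v i) (v j)).

Let T k (v : 'I_(2 + k * 2) -> V) (s : 'S_(2 + k * 2)) : C :=
  (-1) ^+ odd_perm s * a x (fun t => v (s (lshift (k * 2) t)))
    * wedge_pow a k x (fun t => v (s (rshift 2 t))).

Let l0 k : 'I_(2 + k * 2) := lshift (k * 2) ord0.
Let l1 k : 'I_(2 + k * 2) := lshift (k * 2) ord_max.

(** Such an s permutes the last 2k positions by some t. The sign of t occurs twice, in the sign of s
    and from reordering the arguments of the inner power, and cancels. *)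
Let T_fix k (v : 'I_(2 + k * 2) -> V) (s : 'S_(2 + k * 2)) : (forall w : 'I_(k * 2) -> V, block_positive w -> 0 <= wedge_pow a k x w) ->
  block_positive v -> s (l0 k) = l0 k -> s (l1 k) = l1 k -> 0 <= T v s.
Proof.
move=> IH [v0 v1] s0 s1.
have s0' : (s : 'S_(k * 2).+2) ord0 = ord0.
  by rewrite (_ : ord0 = l0 k) //; exact: val_inj.
have [s' s'E] := @lift_perm_fix0 (k * 2).+1 s s0'.
have : s' ord0 = ord0.
  apply: (@lift_inj _ (ord0 : 'I_(2 + k * 2))).
  rewrite -(lift_perm_lift ord0) -s'E.
  rewrite (_ : lift ord0 ord0 = l1 k); last exact: val_inj.
  by rewrite s1.
move=> /(@lift_perm_fix0 (k * 2)) [t tE].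
have st i : s (rshift 2 i) = rshift 2 (t i).
  rewrite (_ : rshift 2 i = lift ord0 (lift ord0 i)); last exact: val_inj.
  by rewrite s'E lift_perm_lift tE lift_perm_lift; exact: val_inj.
have so : odd_perm s = odd_perm t by rewrite s'E odd_lift_perm tE odd_lift_perm.
rewrite /T so.
rewrite ab -/(l0 k) -/(l1 k) s0 s1.
under [X in wedge_pow _ _ _ X]boolp.eq_fun do rewrite st.
rewrite (wedge_pow_perm (fun i => v (rshift 2 i))).
rewrite mulrACA -signr_addb addbb mul1r mulr_ge0 //; first exact: v1.
apply: IH; split=> i j ij.
  by apply: v0 => /= -[].
by move=> lij; apply: v1; rewrite /= ?ij // ltn_add2l.
Qed.

Let T_swap k (v : 'I_(2 + k * 2) -> V) (s : 'S_(2 + k * 2)) : T v (tperm (l0 k) (l1 k) * s)%g = T v s.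
Proof.
rewrite /T odd_mul_tperm signr_addb !ab !permM -/(l0 k) -/(l1 k) tpermL tpermR.
rewrite (_ : l0 k != l1 k) // expr1 mulN1r (banti (v (s (l1 k)))) mulrNN.
congr (_ * wedge_pow a k x _); apply: boolp.funext => i.
by rewrite permM tpermD.
Qed.

(** If s sends the first two positions to different blocks, the term is zero. Otherwise exchanging
    their block c with block 0, which is an even permutation, reduces to the case where s preserves
    {0, 1}. *)
Let T_ge0 k (v : 'I_(2 + k * 2) -> V) (s : 'S_(2 + k * 2)) : (forall w : 'I_(k * 2) -> V, block_positive w -> 0 <= wedge_pow a k x w) ->
  block_positive v -> 0 <= T v s.
Proof.
move=> IH [v0 v1].
have [E|NE] := eqVneq (s (l0 k))./2 (s (l1 k))./2; last first.
  by rewrite /T ab v0 ?mulr0 ?mul0r //; apply/eqP.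
have [c cE] : exists c, c = (s (l0 k))./2 by eexists.
(* The involution exchanging block 0 with block c; it keeps the order inside each block. *)
pose f (i : nat) := (if i < 2 then i + c.*2 else if i./2 == c then i - c.*2 else i)%N.
have cl : (c.*2.+1 < 2 + k * 2)%N.
  by have := ltn_ord (s (l0 k)); rewrite cE; move: (nat_of_ord _) => z; lia.
have fl i : (i < 2 + k * 2 -> f i < 2 + k * 2)%N.
  rewrite /f; case: ifP => [i2 _|_]; first by lia.
  by case: ifP => // _ H; apply: leq_ltn_trans (leq_subr _ _) H.
have ff i : f (f i) = i.
  rewrite /f; case: (ltnP i 2) => i2.
    have [->|c0] := posnP c; first by rewrite double0 !addn0 i2.
    have -> : (i + c.*2 < 2)%N = false by lia.
    have -> : ((i + c.*2)./2 == c) by lia.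
    by rewrite addnK.
  case: eqP => [ic|ic]; last by rewrite ltnNge i2 /= (introF eqP ic).
  have -> : (i - c.*2 < 2)%N by lia.
  by rewrite /= subnK //; lia.
have fhalf i j : (f i)./2 = (f j)./2 -> i./2 = j./2.
  by rewrite /f; do 4?case: ifP; move=> *; lia.
have flt i j : i./2 = j./2 -> (i < j)%N -> (f i < f j)%N.
  by rewrite /f; do 4?case: ifP; move=> *; lia.
have fhalf' i j : i./2 = j./2 -> (f i)./2 = (f j)./2.
  by move=> ij; apply: fhalf; rewrite !ff.
pose g (i : 'I_(2 + k * 2)) : 'I_(2 + k * 2) := Ordinal (fl i (ltn_ord i)).
have gK : involutive g by move=> i; apply: val_inj; rewrite /= ff.
pose sg := perm (inv_inj gK).
have sgE i : sg i = g i by rewrite permE.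
have v'p : block_positive (fun i => v (sg i)).
  by split=> i j ij; rewrite !sgE; [apply: v0 => /= /fhalf|move=> lij; apply: v1; [exact: fhalf'|exact: flt]].
(* Exchanging two blocks of size two is a product of two transpositions, or the identity if c =
   0. *)
have sgeven : odd_perm sg = false.
  have [c0|c0] := posnP c.
    rewrite (_ : sg = 1%g) ?odd_perm1 //; apply/permP => i.
    rewrite sgE perm1; apply: val_inj; rewrite /= /f c0 addn0 subn0.
    by do ?case: ifP.
  have c0l : (c.*2 < 2 + k * 2)%N by lia.
  have -> : sg = (tperm (l0 k) (Ordinal c0l) * tperm (l1 k) (Ordinal cl))%g.
    apply/permP => i; rewrite sgE permM; apply: val_inj => /=.
    have d1 : l1 k != Ordinal c0l by rewrite -val_eqE /=; apply/eqP; lia.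
    have d2 : Ordinal cl != Ordinal c0l by rewrite -val_eqE /=; apply/eqP; lia.
    have d3 : l1 k != l0 k by [].
    have d4 : Ordinal cl != l0 k by [].
    have c2 : (c.*2 < 2)%N = false by lia.
    have c3 : (c.*2.+1 < 2)%N = false by lia.
    case: (eqVneq i (l0 k)) => [->|n0]; first by rewrite tpermL tpermD.
    case: (eqVneq i (Ordinal c0l)) => [->|n1].
      by rewrite tpermR tpermD // /f /= c2 doubleK eqxx subnn.
    rewrite (tpermD (x := l0 k)) 1?eq_sym //.
    case: (eqVneq i (l1 k)) => [->|n2]; first by rewrite tpermL.
    case: (eqVneq i (Ordinal cl)) => [->|n3].
      rewrite tpermR /f /= c3 (_ : uphalf c.*2 = c) ?eqxx; last by lia.
      by rewrite subSnn.
    rewrite (tpermD (x := l1 k)) 1?eq_sym //.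
    move: n0 n1 n2 n3; rewrite -!val_eqE /= => n0 n1 n2 n3.
    by rewrite /f; do 2?case: ifP; move=> *; lia.
  rewrite odd_permM !odd_tperm.
  have -> : l0 k != Ordinal c0l by rewrite -val_eqE /=; apply/eqP; lia.
  by [].
pose s' := (s * sg)%g.
have TT : T v s = T (fun i => v (sg i)) s'.
  rewrite /T odd_permM sgeven addbF.
  have E' i : sg (s' i) = s i by rewrite /s' permM !sgE gK.
  congr (_ * a x _ * wedge_pow a k x _); apply: boolp.funext => i; by rewrite E'.
have s'0 : (nat_of_ord (s' (l0 k)) < 2)%N.
  by rewrite /s' permM sgE /= /f -cE; case: ifP => h; [lia|rewrite eqxx; lia].
have s'1 : (nat_of_ord (s' (l1 k)) < 2)%N.
  by rewrite /s' permM sgE /= /f -E -cE; case: ifP => h; [lia|rewrite eqxx; lia].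
have s'01 : nat_of_ord (s' (l0 k)) != nat_of_ord (s' (l1 k)).
  by rewrite (inj_eq (@ord_inj _)) (inj_eq perm_inj).
rewrite TT; have [z|nz] := eqVneq (nat_of_ord (s' (l0 k))) 0%N.
  have z1 : nat_of_ord (s' (l1 k)) = 1%N by lia.
  by apply: T_fix => //; apply: ord_inj; rewrite ?z ?z1.
have z0 : nat_of_ord (s' (l0 k)) = 1%N by lia.
have z1 : nat_of_ord (s' (l1 k)) = 0%N by lia.
by rewrite -T_swap; apply: T_fix => //; rewrite permM ?tpermL ?tpermR;
  apply: ord_inj; rewrite ?z0 ?z1.
Qed.

Lemma wedge_pow_ge0 k (v : 'I_(k * 2) -> V) :
  block_positive v -> 0 <= wedge_pow a k x v.
Proof.
elim: k v => [|k IH] v vp; first by rewrite /= /form0 ler01.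
rewrite /= /wedge mulr_ge0 ?invr_ge0 //.
by apply: sumr_ge0 => s _; exact: T_ge0.
Qed.

(** The factorials that normalize the successive wedge products, that is, the coefficient of the
    summand in which all permutations are the identity. *)
Fixpoint wedge_const k : R :=
  if k is k'.+1 then ((2`! * (k' * 2)`!)%N%:R)^-1 * wedge_const k' else 1.

Lemma wedge_const_gt0 k : 0 < wedge_const k.
Proof.
by elim: k => //= k IH; rewrite mulr_gt0 // invr_gt0 ltr0n muln_gt0 !fact_gt0.
Qed.

(* Only permutations respecting the blocks contribute, each with a nonnegative
   term; the identity alone gives the lower bound. *)
Lemma wedge_pow_block k (y : nat -> V) :
  block_positive (fun i : 'I_(k * 2) => y i) ->
  (wedge_const k)%:C * \prod_(i < k) b (y i.*2) (y i.*2.+1)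
    <= wedge_pow a k x (fun i => y i).
Proof.
elim: k y => [|k IH] y yp; first by rewrite big_ord0 mulr1.
have tailp : block_positive (fun i : 'I_(k * 2) => y (2 + i)%N).
  case: yp => y0 y1; split=> i j ij.
    by apply: (y0 (rshift 2 i) (rshift 2 j)) => /= -[].
  by move=> lij; apply: (y1 (rshift 2 i) (rshift 2 j)); rewrite /= ?ij // ltn_add2l.
rewrite big_ord_recl [wedge_const _]/= rmorphM /= fmorphV rmorph_nat /=.
rewrite [leRHS]/wedge -!mulrA; apply: ler_wpM2l; first by rewrite invr_ge0.
rewrite (bigD1 (1%g : 'S_(2 + k * 2))) //= odd_perm1 expr0 mul1r.
apply: (@le_trans _ _ (a x (fun t : 'I_2 => y ((1%g : 'S_(2 + k * 2)) (lshift (k * 2) t))) *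
     wedge_pow a k x (fun t => y ((1%g : 'S_(2 + k * 2)) (rshift 2 t))))); last first.
  rewrite lerDl; apply: sumr_ge0 => s _.
  exact: (@T_ge0 k (fun i => y i) s (@wedge_pow_ge0 k)).
rewrite ab !perm1 /= mulrCA; apply: ler_wpM2l.
  by case: yp => _ yp; exact: (yp (l0 k) (l1 k)).
under [X in wedge_pow _ _ _ X]boolp.eq_fun do rewrite perm1 /=.
exact: (IH (fun i => y (2 + i)%N) tailp).
Qed.

End Positivity.
End WedgePower.

(** * Quadratic forms *)

Section QuadraticForms.
Context {R : realType}.

Definition bf m (A : 'M[R]_m) (u v : 'rV[R]_m) : R := (u *m A *m v^T) 0 0.

Lemma bfE m (A : 'M[R]_m) u v : bf A u v = \sum_a \sum_b u 0 a * A a b * v 0 b.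
Proof.
rewrite /bf mxE exchange_big /=; apply: eq_bigr => b _.
by rewrite !mxE mulr_suml; apply: eq_bigr => a _.
Qed.

Lemma bfDl m (A : 'M[R]_m) u1 u2 v : bf A (u1 + u2) v = bf A u1 v + bf A u2 v.
Proof. by rewrite /bf !mulmxDl mxE. Qed.

Lemma bfDr m (A : 'M[R]_m) u v1 v2 : bf A u (v1 + v2) = bf A u v1 + bf A u v2.
Proof. by rewrite /bf linearD mulmxDr mxE. Qed.

Lemma bfZl m (A : 'M[R]_m) k u v : bf A (k *: u) v = k * bf A u v.
Proof. by rewrite /bf -!scalemxAl mxE. Qed.

Lemma bfZr m (A : 'M[R]_m) k u v : bf A u (k *: v) = k * bf A u v.
Proof. by rewrite /bf linearZ -scalemxAr mxE. Qed.

Lemma bfNl m (A : 'M[R]_m) u v : bf A (- u) v = - bf A u v.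
Proof. by rewrite -scaleN1r bfZl mulN1r. Qed.

Lemma bfNr m (A : 'M[R]_m) u v : bf A u (- v) = - bf A u v.
Proof. by rewrite -scaleN1r bfZr mulN1r. Qed.

Lemma tr11 (M : 'M[R]_1) : M^T 0 0 = M 0 0.
Proof. by rewrite mxE. Qed.

Lemma bf_tr m (A : 'M[R]_m) u v : bf A u v = bf A^T v u.
Proof. by rewrite /bf -tr11 !trmx_mul trmxK mulmxA. Qed.

Lemma bf_mul m (A B C : 'M[R]_m) u v :
  bf (B *m A *m C^T) u v = bf A (u *m B) (v *m C).
Proof. by rewrite /bf trmx_mul !mulmxA. Qed.

Lemma bf_add m (A B : 'M[R]_m) u v : bf (A + B) u v = bf A u v + bf B u v.
Proof. by rewrite /bf mulmxDr mulmxDl mxE. Qed.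

Lemma bf_opp m (A : 'M[R]_m) u v : bf (- A) u v = - bf A u v.
Proof. by rewrite /bf mulmxN mulNmx mxE. Qed.

Lemma bf_scale m k (A : 'M[R]_m) u v : bf (k *: A) u v = k * bf A u v.
Proof. by rewrite /bf -scalemxAr -scalemxAl mxE. Qed.

Lemma bf_le m (A : 'M[R]_m) (K : R) u v : (forall a b, `|A a b| <= K) ->
  `|bf A u v| <= (m%:R * m%:R * K) * (`|u| * `|v|).
Proof.
move=> AK; rewrite bfE; apply: le_trans (ler_norm_sum _ _ _) _.
apply: (@le_trans _ _ (\sum_(a < m) \sum_(b < m) K * (`|u| * `|v|))).
  apply: ler_sum => a _; apply: le_trans (ler_norm_sum _ _ _) _.
  apply: ler_sum => b _; rewrite !normrM [`|u 0 a| * _]mulrC -mulrA.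
  by rewrite ler_pM // ler_pM // coord_le_norm.
by rewrite !sumr_const !card_ord -mulrnA -[leLHS]mulr_natl natrM !mulrA.
Qed.

Definition psd m (A : 'M[R]_m) := forall v, 0 <= bf A v v.
Definition pdf m (A : 'M[R]_m) := forall v, v != 0 -> 0 < bf A v v.

Lemma psd_null m (A : 'M[R]_m) v : A^T = A -> psd A -> bf A v v = 0 ->
  forall w, bf A v w = 0.
Proof.
move=> Asym Ap v0 w.
have H t : 0 <= t * (2 * bf A v w) + t ^+ 2 * bf A w w.
  have := Ap (v + t *: w).
  rewrite !(bfDl, bfDr, bfZl, bfZr) v0 (bf_tr A w v) Asym => HH.
  by apply: le_trans HH _; rewrite le_eqVlt; apply/orP; left; apply/eqP; ring.
have Aw := Ap w; set p := bf A v w in H *; set q := bf A w w in H Aw.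
have q1 : 0 < q + 1 by rewrite ltr_wpDl.
(* The minimizer would be - p / q; adding 1 covers q = 0 and still gives a negative value unless p =
   0. *)
have := H (- p / (q + 1)).
have -> : - p / (q + 1) * (2 * p) + (- p / (q + 1)) ^+ 2 * q
  = - (p / (q + 1)) ^+ 2 * (q + 2) by field; rewrite gt_eqF.
rewrite mulNr oppr_ge0 pmulr_lle0; last by rewrite ltr_wpDl.
move=> p0; have : (p / (q + 1)) ^+ 2 == 0 by rewrite eq_le p0 sqr_ge0.
by rewrite sqrf_eq0 mulf_eq0 invr_eq0 (gt_eqF q1) orbF => /eqP.
Qed.

(** Induction by Schur complement: S is a positive rank-one matrix s^-1 c^T c plus a matrix [S']
    supported on the lower block and positive definite there; the rank-one part contributes s^-1
    H(c, c). *)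
Lemma trace_psd m (S H : 'M[R]_m) : S^T = S -> pdf S -> psd H -> 0 <= \tr (S *m H).
Proof.
elim: m S H => [|n IH] S H Ssym Sp Hp; first by rewrite /mxtrace big_ord0.
rewrite -[n.+1]/(1 + n)%N in S H Ssym Sp Hp *.
pose s := S 0 0.
pose e : 'rV[R]_(1 + n) := delta_mx 0 0.
have e00 : bf S e e = s by rewrite /bf -rowE trmx_delta -colE !mxE.
have s0 : 0 < s.
  rewrite -e00 Sp //; apply/eqP => /matrixP/(_ 0 0)/eqP.
  by rewrite !mxE /= oner_eq0.
pose c : 'rV[R]_(1 + n) := row 0 S.
pose S' := S - s^-1 *: (c^T *m c).
have cE a : c 0 a = S a 0 by rewrite mxE -[in LHS]Ssym mxE.
have S'E : S' = block_mx 0 0 0 (drsubmx S').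
  rewrite -[LHS]submxK; congr block_mx; apply/matrixP => i j;
    rewrite !mxE big_ord1 !mxE !ord1.
  - rewrite (_ : lshift n 0 = 0); last exact: val_inj.
    by rewrite -/s mulrA mulVf ?gt_eqF // mul1r subrr.
  - rewrite (_ : lshift n 0 = 0); last exact: val_inj.
    by rewrite -/s mulrA mulVf ?gt_eqF // mul1r subrr.
  - rewrite (_ : lshift n 0 = 0); last exact: val_inj.
    rewrite -/s mulrCA mulVf ?gt_eqF // mulr1.
    by rewrite -[X in S X 0]/(rshift 1 i) -{2}Ssym mxE subrr.
have D'p : pdf (drsubmx S').
  move=> u u0.
  (* The vector (0, u), corrected along e so as to be S-orthogonal to e; on it S takes the value of
     the Schur complement at u. *)
  pose v : 'rV[R]_(1 + n) := row_mx 0 u - (s^-1 * bf 1%:M (row_mx 0 u) c) *: e.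
  have v0 : v != 0.
    apply: contraNneq u0 => v0; apply/eqP/rowP => j.
    have vj : v 0 (rshift 1 j) = u 0 j.
      rewrite /v mxE row_mxEr; by rewrite !mxE /= mulr0 oppr0 addr0.
    by rewrite -vj v0 !mxE.
  have := Sp v v0.
  suff -> : bf S v v = bf (drsubmx S') u u by [].
  have -> : bf (drsubmx S') u u = bf S' (row_mx 0 u) (row_mx 0 u).
    rewrite S'E /bf tr_row_mx mul_row_block mul_row_col !mul0mx !mulmx0 !addr0 !add0r.
    by rewrite block_mxKdr mul0mx add0r.
  have e0 w : bf S e w = bf 1%:M w c.
    by rewrite /bf -rowE -/c mulmx1 -tr11 trmx_mul trmxK.
  have e1 w : bf S w e = bf 1%:M w c by rewrite bf_tr Ssym e0.
  have e3 : bf (c^T *m c) (row_mx 0 u) (row_mx 0 u) = bf 1%:M (row_mx 0 u) c ^+ 2.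
    rewrite /bf mulmxA mulmx1 -mulmxA mxE big_ord1 expr2; congr (_ * _).
    by rewrite -tr11 trmx_mul trmxK.
  rewrite /S' bf_add bf_opp bf_scale e3 /v !(bfDl, bfDr, bfNl, bfNr, bfZl, bfZr) e1 e0 e00.
  by field; rewrite gt_eqF.
have Hdp : psd (drsubmx H).
  move=> u; have := Hp (row_mx 0 u).
  rewrite /bf -{1}[H]submxK tr_row_mx mul_row_block mul_row_col.
  by rewrite !mul0mx !trmx0 !mulmx0 !add0r.
have S'sym : (drsubmx S')^T = drsubmx S'.
  rewrite trmx_drsub; congr drsubmx.
  by rewrite /S' linearB linearZ /= trmx_mul trmxK Ssym.
have -> : S = S' + s^-1 *: (c^T *m c) by rewrite /S' subrK.
rewrite mulmxDl mxtraceD addr_ge0 //.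
  rewrite S'E -[H]submxK mulmx_block !mul0mx !addr0 !add0r mxtrace_block mxtrace0 add0r.
  exact: IH.
rewrite -scalemxAl mxtraceZ mulr_ge0 //; first by rewrite invr_ge0 ltW.
rewrite -mulmxA mxtrace_mulC; have := Hp c; rewrite /bf /mxtrace big_ord1.
by [].
Qed.

End QuadraticForms.

(** * Real bilinear forms on complexified vectors *)

Section ComplexRows.
Context {R : realType} {m : nat}.
Local Notation C := R[i].
Local Notation toC := (map_mx (real_complex R)).
Local Notation mRe := (map_mx (@complex.Re R)).
Local Notation mIm := (map_mx (@complex.Im R)).

Lemma ReD (x y : C) : complex.Re (x + y) = complex.Re x + complex.Re y.
Proof. by case: x; case: y. Qed.

Lemma ImD (x y : C) : complex.Im (x + y) = complex.Im x + complex.Im y.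
Proof. by case: x; case: y. Qed.

Lemma ReMr (x : C) (r : R) : complex.Re (x * r%:C) = complex.Re x * r.
Proof. by case: x => a b; simpc. Qed.

Lemma ImMr (x : C) (r : R) : complex.Im (x * r%:C) = complex.Im x * r.
Proof. by case: x => a b; simpc. Qed.

Lemma Re_sum (I : finType) (F : I -> C) :
  complex.Re (\sum_i F i) = \sum_i complex.Re (F i).
Proof. exact: (big_morph _ ReD erefl). Qed.

Lemma Im_sum (I : finType) (F : I -> C) :
  complex.Im (\sum_i F i) = \sum_i complex.Im (F i).
Proof. exact: (big_morph _ ImD erefl). Qed.

Lemma mRe_mul p q (z : 'M[C]_(p, m)) (N : 'M[R]_(m, q)) :
  mRe (z *m toC N) = mRe z *m N.
Proof.
apply/matrixP => i j; rewrite !mxE Re_sum; apply: eq_bigr => a _.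
by rewrite !mxE ReMr.
Qed.

Lemma mIm_mul p q (z : 'M[C]_(p, m)) (N : 'M[R]_(m, q)) :
  mIm (z *m toC N) = mIm z *m N.
Proof.
apply/matrixP => i j; rewrite !mxE Im_sum; apply: eq_bigr => a _.
by rewrite !mxE ImMr.
Qed.

Lemma abs_real (z : C) : (complex.Re `|z|)%:C = `|z|.
Proof. by rewrite normc_def. Qed.

(** Independent of the base point, so that pointwise algebra takes place in a single tangent
    space. *)
Definition form_mx (N : 'M[R]_m) : @Defs.form R m 2 := fun _ w =>
  (w ord0 *m toC N *m (w ord_max)^T) 0 0.

(** The l^1 norm. The modulus of a complex number is itself a complex number here, and the real part
    brings it to R. *)
Definition nu (w : 'rV[C]_m) : R := \sum_a complex.Re `|w 0 a|.

Lemma nu_ge0 w : 0 <= nu w.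
Proof. by apply: sumr_ge0 => a _; rewrite -ler0c abs_real. Qed.

Lemma nuE w : (nu w)%:C = \sum_a `|w 0 a|.
Proof. by rewrite rmorph_sum /=; apply: eq_bigr => a _; rewrite abs_real. Qed.

Lemma nu_real (v : 'rV[R]_m) : nu (toC v) <= m%:R * `|v|.
Proof.
have -> : m%:R * `|v| = \sum_(a < m) `|v| by rewrite sumr_const card_ord mulr_natl.
apply: ler_sum => a _; rewrite mxE normc_def /= expr0n /= addr0 sqrtr_sqr.
exact: coord_le_norm.
Qed.

Lemma form_mx_le (N : 'M[R]_m) (A : R) x w : (forall a b, `|N a b| <= A) ->
  `|form_mx N x w| <= (A * nu (w ord0) * nu (w ord_max))%:C.
Proof.
move=> NA; rewrite /form_mx mxE -mulrA mulrCA !rmorphM /= !nuE mulr_suml mulr_sumr.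
have -> : \sum_j (w ord0 *m toC N) 0 j * (w ord_max)^T j 0 =
   \sum_a \sum_b w ord0 0 a * ((N a b)%:C * w ord_max 0 b).
  rewrite exchange_big /=; apply: eq_bigr => b _.
  by rewrite !mxE mulr_suml; apply: eq_bigr => a _; rewrite !mxE mulrA.
apply: le_trans (ler_norm_sum _ _ _) _.
apply: ler_sum => a _; apply: le_trans (ler_norm_sum _ _ _) _.
rewrite !mulr_sumr; apply: ler_sum => b _.
rewrite !normrM ler_wpM2l // ler_wpM2r //.
by rewrite normc_def /= expr0n /= addr0 sqrtr_sqr lecR.
Qed.

Definition pair_form (N : 'M[R]_m) (u v : 'rV[C]_m) : C := (u *m toC N *m v^T) 0 0.

Lemma pair_form_real N u v : pair_form N (toC u) (toC v) = (bf N u v)%:C.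
Proof. by rewrite /pair_form /bf map_trmx -!map_mxM mxE. Qed.

Lemma pair_form_anti N : N^T = - N -> forall u v, pair_form N u v = - pair_form N v u.
Proof.
move=> Na u v; rewrite /pair_form -[RHS]mulN1r.
have -> : (u *m toC N *m v^T) 0 0 = (u *m toC N *m v^T)^T 0 0 by rewrite [RHS]mxE.
by rewrite !trmx_mul trmxK map_trmx Na map_mxN mulNmx mulmxN mulmxA mxE mulN1r.
Qed.

End ComplexRows.

(** * Hermitian frames of an eigenspace of Pi *)

Section Frames.
Context {R : realType} {m : nat}.
Local Notation C := R[i].
Local Notation toC := (map_mx (real_complex R)).
Local Notation mRe := (map_mx (@complex.Re R)).
Local Notation mIm := (map_mx (@complex.Im R)).

Variables (J Pi : 'M[R]_m) (eps : R) (k : nat).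
Hypothesis JJ : J *m J = - 1%:M.
Hypothesis JPi : J *m Pi = Pi *m J.

Definition eigen (v : 'rV[R]_m) := v *m Pi = eps *: v.

Let T10 : 'M[C]_m :=
  (kermx (toC Pi - (eps%:C)%:M) :&: kermx (toC J - 'i%C%:M))%MS.
Hypothesis rank_k : \rank T10 = k.

Lemma eigenJ v : eigen v -> eigen (v *m J).
Proof. by rewrite /eigen => Ev; rewrite -mulmxA JPi mulmxA Ev scalemxAl. Qed.

Lemma mulJJ (v : 'rV[R]_m) : v *m J *m J = - v.
Proof. by rewrite -mulmxA JJ mulmxN mulmx1. Qed.

(** The vector v - i J v lies in T^{1,0} and has real part v. *)
Lemma eigen_rank v : eigen v -> v != 0 -> (0 < k)%N.
Proof.
move=> Ev v0; pose z := toC v - 'i%C *: toC (v *m J).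
have zT : (z <= T10)%MS.
  rewrite sub_capmx; apply/andP; split; apply/sub_kermxP.
    rewrite mulmxBr mulmxBl -scalemxAl -!map_mxM Ev (eigenJ Ev) !map_mxZ /=.
    by rewrite mul_mx_scalar /z scalerBr scalerA mulrC -scalerA subrr.
  have zJ : z *m toC J = 'i%C *: z.
    rewrite mulmxBl -scalemxAl -!map_mxM mulJJ map_mxN scalerN opprK.
    by rewrite scalerBr scalerA -expr2 sqr_i scaleN1r opprK addrC.
  by rewrite mulmxBr zJ mul_mx_scalar subrr.
rewrite -rank_k lt0n mxrank_eq0; apply: contraNneq v0 => T0.
move: zT; rewrite T0 submx0 => /eqP z0.
have := congr1 mRe z0; rewrite /z.
have -> : mRe (toC v - 'i%C *: toC (v *m J)) = v.
  by apply/matrixP => i j; rewrite !mxE; simpc.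
by move=> ->; apply/eqP/matrixP => i j; rewrite !mxE.
Qed.

(** For a J-invariant [alpha] the two vanishing conditions are orthogonality for the Hermitian form
    with components alpha(u, v) and alpha(u, J v). *)
Definition frame (alpha : 'M[R]_m) (e : nat -> 'rV[R]_m) (j : nat) :=
  (forall a, (a < j)%N -> e a != 0 /\ eigen (e a)) /\
  (forall a b, (a < j)%N -> (b < j)%N -> a != b ->
     bf alpha (e a) (e b) = 0 /\ bf alpha (e a) (e b *m J) = 0).

(* The vectors orthogonal to [e a] and [e a *m J] for all [a < j] are cut out of
   T^{1,0}, of complex dimension [k], by [j] complex linear equations. *)
Lemma frame_step (alpha : 'M[R]_m) (e : nat -> 'rV[R]_m) j : (j < k)%N ->
  exists v, [/\ v != 0, eigen v & forall a, (a < j)%N ->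
    bf alpha v (e a) = 0 /\ bf alpha (v *m J) (e a) = 0].
Proof.
move=> jk.
pose W : 'M[C]_(m, j) := \matrix_(b, a) toC (alpha *m (e a)^T) b 0.
pose B := row_base T10.
have : kermx (B *m W) != 0.
  rewrite -mxrank_eq0 mxrank_ker subn_eq0 -ltnNge.
  by apply: leq_ltn_trans (rank_leq_col _) _; rewrite rank_k.
move=> /rowV0Pn[c /sub_kermxP cK c0].
pose z := c *m B.
have z0 : z != 0.
  apply: contraNneq c0 => z0.
  by rewrite -[c]mulmx1 -(mulmxVp (row_base_free T10)) mulmxA -/B -/z z0 mul0mx.
have zT : (z <= T10)%MS.
  by apply: submx_trans (submxMl _ _) _; rewrite eq_row_base.
move: zT; rewrite sub_capmx => /andP[/sub_kermxP zPi /sub_kermxP zJ].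
have zW : z *m W = 0 by rewrite /z -mulmxA.
have zPi' : z *m toC Pi = eps%:C *: z.
  by apply/eqP; rewrite -subr_eq0 -mul_mx_scalar -mulmxBr zPi.
have zJ' : z *m toC J = 'i%C *: z.
  by apply/eqP; rewrite -subr_eq0 -mul_mx_scalar -mulmxBr zJ.
clearbody z.
have xJ : mRe z *m J = - mIm z.
  rewrite -mRe_mul zJ'; apply/matrixP => i b; rewrite !mxE.
  by case: (z i b) => p q; rewrite /= mul0r mul1r sub0r.
exists (mRe z); split.
- apply: contraNneq z0 => x0.
  have y0 : mIm z = 0 by rewrite -[mIm z]opprK -xJ x0 mul0mx oppr0.
  apply/eqP/matrixP => i b.
  have := congr1 (fun M : 'rV[R]_m => M i b) x0.
  have := congr1 (fun M : 'rV[R]_m => M i b) y0.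
  by rewrite !mxE; case: (z i b) => p q /= -> ->.
- rewrite /eigen -mRe_mul zPi'; apply/matrixP => i b; rewrite !mxE.
  by case: (z i b) => p q; rewrite /= mul0r subr0.
move=> a aj.
have za : z *m toC (alpha *m (e a)^T) = 0.
  apply/matrixP => i b; rewrite !ord1.
  rewrite [RHS]mxE; transitivity ((z *m W) 0 (Ordinal aj)); last by rewrite zW mxE.
  rewrite [LHS]mxE [RHS]mxE; apply: eq_bigr => d _; congr (_ * _).
  by rewrite [RHS]mxE.
split.
  rewrite /bf -mulmxA -mRe_mul za; by rewrite !mxE.
by rewrite /bf -mulmxA xJ mulNmx -mIm_mul za !mxE oppr0.
Qed.

Variable alpha : 'M[R]_m.
Hypothesis alpha_anti : alpha^T = - alpha.
Hypothesis alphaJ : J *m alpha *m J^T = alpha.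

Lemma alpha_swap u v : bf alpha u v = - bf alpha v u.
Proof. by rewrite bf_tr alpha_anti bf_opp. Qed.

Lemma alpha_JJ u v : bf alpha (u *m J) (v *m J) = bf alpha u v.
Proof. by rewrite -bf_mul alphaJ. Qed.

Lemma alpha_Jl u v : bf alpha (u *m J) v = - bf alpha u (v *m J).
Proof. by rewrite -alpha_JJ mulJJ bfNl. Qed.

(** Used with j = 0 to obtain some frame and with j = 1 to complete a prescribed vector to a
    frame. *)
Lemma frame_ext d e j : (j + d = k)%N -> frame alpha e j ->
  exists2 e', frame alpha e' k & forall a, (a < j)%N -> e' a = e a.
Proof.
elim: d e j => [|d IH] e j; first by rewrite addn0 => ->; exists e.
move=> jd [f0 f1].
have jk : (j < k)%N by rewrite -jd addnS ltnS leq_addr.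
have [v [v0 vE va]] := frame_step alpha e jk.
pose e1 a := if (a < j)%N then e a else v.
have [||e' e'f e'e] := IH e1 j.+1; first by rewrite addSnnS.
  split=> [a aj1|a b aj1 bj1 ab]; rewrite /e1.
    by case: (ltnP a j) => aj //; exact: f0.
  case: (ltnP a j) => aj; case: (ltnP b j) => bj.
  - exact: f1.
  - have [h1 h2] := va a aj.
    by rewrite alpha_swap h1 oppr0 alpha_swap h2 oppr0.
  - have [h1 h2] := va b bj; split => //.
    by rewrite -[RHS]oppr0 -h2 alpha_Jl opprK.
  - by exfalso; lia.
exists e' => // a aj; rewrite e'e; first by rewrite /e1 aj.
exact: ltnW.
Qed.

Definition frame_tuple (e : nat -> 'rV[R]_m) (i : nat) : 'rV[C]_m :=
  toC (if odd i then e i./2 *m J else e i./2).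

Lemma frame_wedge x e : frame alpha e k ->
  (forall a, (a < k)%N -> 0 < bf alpha (e a) (e a *m J)) ->
  (@wedge_const R k * \prod_(a < k) bf alpha (e a) (e a *m J))%:C
    <= wedge_pow (form_mx alpha) k x (fun i => frame_tuple e i).
Proof.
move=> [f0 f1] fp.
have hk i : (i < k * 2)%N -> (i./2 < k)%N by lia.
have bp : block_positive (pair_form alpha) (fun i : 'I_(k * 2) => frame_tuple e i).
  split=> i j ij.
    have iN : i./2 != j./2 by apply/eqP.
    have [h1 h2] := f1 _ _ (hk _ (ltn_ord i)) (hk _ (ltn_ord j)) iN.
    rewrite eq_sym in iN.
    have [h3 h4] := f1 _ _ (hk _ (ltn_ord j)) (hk _ (ltn_ord i)) iN.
    rewrite /frame_tuple pair_form_real.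
    case: (odd i); case: (odd j); rewrite ?alpha_JJ ?h1 ?h2 //.
    by rewrite alpha_Jl h2 oppr0.
  move=> lij; rewrite /frame_tuple pair_form_real ler0c.
  have [oi oj] : odd i = false /\ odd j = true by lia.
  by rewrite oi oj -ij; apply: ltW; apply: fp; exact: hk.
have := @wedge_pow_block _ _ (form_mx alpha) x (pair_form alpha) _
  (pair_form_anti alpha_anti) k (frame_tuple e) bp.
rewrite rmorphM rmorph_prod /=.
under eq_bigr => a _.
  rewrite /frame_tuple odd_double /= odd_double doubleK uphalf_double pair_form_real.
  over.
by apply.
Qed.

End Frames.

(** * Pointwise estimates for the volume ratio *)

Section PointwiseEstimates.
Context {R : realType} {m : nat}.
Local Notation C := R[i].
Local Notation toC := (map_mx (real_complex R)).

Lemma mulmx_norm_le (v : 'rV[R]_m) (N : 'M[R]_m) (A : R) : 0 <= A ->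
  (forall a b, `|N a b| <= A) -> `|v *m N| <= m%:R * A * `|v|.
Proof.
move=> A0 NA; apply: norm_le_coord => [|b]; first by rewrite !mulr_ge0.
rewrite mxE; apply: le_trans (ler_norm_sum _ _ _) _.
have -> : m%:R * A * `|v| = \sum_(a < m) A * `|v|.
  by rewrite sumr_const card_ord mulr_natl mulrnAl.
apply: ler_sum => a _; rewrite normrM mulrC.
by apply: ler_pM => //; exact: coord_le_norm.
Qed.

Lemma prod_pairs k (f : nat -> R) :
  \prod_(i < k * 2) f i = \prod_(a < k) (f a.*2 * f a.*2.+1).
Proof.
elim: k => [|k IH]; first by rewrite !big_ord0.
rewrite mulSn addnC addn2 !big_ord_recr /= IH -mulrA muln2.
by [].
Qed.

Lemma prod_recl n (f : nat -> R) : (0 < n)%N ->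
  \prod_(a < n) f a = f 0%N * \prod_(a < n.-1) f a.+1.
Proof. by case: n => // n _; rewrite big_ord_recl. Qed.

Variables (g J Pi : 'M[R]_m) (eps : R) (k : nat).
Hypothesis gsym : g^T = g.
Hypothesis gpos : pdf g.
Hypothesis JJ : J *m J = - 1%:M.
Hypothesis Jg : J *m g *m J^T = g.
Hypothesis JPi : J *m Pi = Pi *m J.
Hypothesis PiPi : Pi *m Pi = 1%:M.
Hypothesis eps2 : eps * eps = 1.
Hypothesis rank_k :
  \rank (kermx (toC Pi - (eps%:C)%:M) :&: kermx (toC J - 'i%C%:M))%MS = k.

Definition proj_pm : 'M[R]_m := 2^-1 *: (1%:M + eps *: Pi).
Definition omega_mx : 'M[R]_m := proj_pm *m (J *m g) *m proj_pm^T.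

Lemma proj_pm_eigen v : eigen Pi eps (v *m proj_pm).
Proof.
rewrite /eigen /proj_pm -mulmxA -scalemxAl mulmxDl mul1mx -scalemxAl PiPi.
rewrite -!scalemxAr !mulmxDr -!scalemxAr mulmx1 scalerA [eps * _]mulrC -scalerA.
by rewrite [eps *: (v + _)]scalerDr [eps *: (eps *: _)]scalerA eps2 scale1r addrC.
Qed.

Lemma proj_pm_id v : eigen Pi eps v -> v *m proj_pm = v.
Proof.
move=> Ev; rewrite /proj_pm -scalemxAr mulmxDr mulmx1 -scalemxAr Ev scalerA eps2.
rewrite scale1r (_ : v + v = 2 *: v); last by rewrite scaler_nat mulr2n.
by rewrite scalerA mulVf ?scale1r // pnatr_eq0.
Qed.

Lemma proj_pmJ : J *m proj_pm = proj_pm *m J.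
Proof.
by rewrite /proj_pm -scalemxAr -scalemxAl mulmxDr mulmxDl mulmx1 mul1mx
  -scalemxAr -scalemxAl JPi.
Qed.

Lemma Jg_anti : (J *m g)^T = - (J *m g).
Proof.
rewrite trmx_mul gsym -{2}Jg !mulmxA JJ -!mulmxA mulNmx opprK mul1mx.
by [].
Qed.

Lemma conj_proj_anti (N : 'M[R]_m) : N^T = - N ->
  (proj_pm *m N *m proj_pm^T)^T = - (proj_pm *m N *m proj_pm^T).
Proof. by move=> Na; rewrite !trmx_mul trmxK Na mulNmx mulmxN mulmxA. Qed.

Lemma conj_projJ (N : 'M[R]_m) : J *m N *m J^T = N ->
  J *m (proj_pm *m N *m proj_pm^T) *m J^T = proj_pm *m N *m proj_pm^T.
Proof.
move=> NJ; rewrite -{2}NJ !mulmxA proj_pmJ -!mulmxA -!trmx_mul proj_pmJ.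
by [].
Qed.

Lemma JgJ : J *m (J *m g) *m J^T = J *m g.
Proof. by rewrite -mulmxA Jg. Qed.

Lemma omega_anti : omega_mx^T = - omega_mx.
Proof. exact: conj_proj_anti Jg_anti. Qed.

Lemma omegaJ : J *m omega_mx *m J^T = omega_mx.
Proof. exact: conj_projJ JgJ. Qed.

Lemma bf_conj_proj (N : 'M[R]_m) u v : eigen Pi eps u -> eigen Pi eps v ->
  bf (proj_pm *m N *m proj_pm^T) u v = bf N u v.
Proof. by move=> Eu Ev; rewrite bf_mul !proj_pm_id. Qed.

Lemma bf_Jg u v : bf (J *m g) u (v *m J) = bf g u v.
Proof.
by rewrite -[in RHS]Jg bf_mul /bf mulmxA.
Qed.

Lemma omega_pos v : eigen Pi eps v -> bf omega_mx v (v *m J) = bf g v v.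
Proof. by move=> Ev; rewrite bf_conj_proj ?bf_Jg //; exact: eigenJ. Qed.

Variables (Kw : R).
Hypothesis Kw0 : 0 <= Kw.
Hypothesis Kw_le : forall (a : @Defs.form R m 2) x (A : R) (nu : 'rV[C]_m -> R),
    0 <= A -> (forall w, 0 <= nu w) ->
    (forall w, `|a x w| <= (A * nu (w ord0) * nu (w ord_max))%:C) ->
    forall v, `|wedge_pow a k x v| <= (Kw * A ^+ k * \prod_i nu (v i))%:C.

Variables (A c1 : R).
Hypothesis A0 : 0 <= A.
Hypothesis c10 : 0 < c1.
Hypothesis JA : forall a b, `|J a b| <= A.
Hypothesis gc1 : forall v, c1 * `|v| ^+ 2 <= bf g v v.

(** For the pair e, e J: two factors m from comparing [nu] with the sup norm, and m A from
    multiplication by J. *)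
Let D : R := m%:R * (m%:R * (m%:R * A)).

Lemma frame_nu e : \prod_(i < k * 2) nu (frame_tuple J e i)
  <= \prod_(a < k) (D * `|e a| ^+ 2).
Proof.
rewrite (prod_pairs k (fun i => nu (frame_tuple J e i))); apply: ler_prod => a _.
rewrite mulr_ge0 ?nu_ge0 //= /frame_tuple odd_double /= odd_double doubleK uphalf_double.
apply: le_trans (ler_pM (nu_ge0 _) (nu_ge0 _) (nu_real _) (nu_real _)) _.
rewrite /D [leRHS](_ : _ = (m%:R * `|e a|) * (m%:R * (m%:R * A * `|e a|))); last by ring.
apply: ler_wpM2l; first by rewrite mulr_ge0.
by apply: ler_wpM2l => //; exact: mulmx_norm_le.
Qed.

Lemma frame_upper (N : 'M[R]_m) x e : (forall a b, `|N a b| <= A) ->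
  `|wedge_pow (form_mx N) k x (fun i => frame_tuple J e i)|
    <= (Kw * A ^+ k * \prod_(a < k) (D * `|e a| ^+ 2))%:C.
Proof.
move=> NA; apply: le_trans (Kw_le A0 (@nu_ge0 R m) (fun w => form_mx_le x w NA) _) _.
rewrite lecR; apply: ler_wpM2l; first by rewrite mulr_ge0 // exprn_ge0.
exact: frame_nu.
Qed.

Variables (alpha : 'M[R]_m) (x : 'rV[R]_m) (F : R).
Hypothesis alpha_anti : alpha^T = - alpha.
Hypothesis alphaJ : J *m alpha *m J^T = alpha.
Hypothesis F0 : 0 < F.
Hypothesis wedgeE : forall v, wedge_pow (form_mx alpha) k x v =
  F%:C * wedge_pow (form_mx omega_mx) k x v.

Lemma omega_frame_pos e : frame J Pi eps omega_mx e k -> forall a, (a < k)%N ->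
  0 < bf omega_mx (e a) (e a *m J).
Proof.
move=> [ef _] a ak; have [ea0 eaE] := ef a ak.
by rewrite omega_pos //; exact: gpos.
Qed.

(** Complete v to a frame for omega. On its tuple the power of alpha vanishes because v is in the
    kernel, whereas F times the power of omega is positive. *)
Lemma wedge_nondeg v : v != 0 -> eigen Pi eps v -> v *m alpha = 0 -> False.
Proof.
move=> v0 vE va; have k0 := eigen_rank JJ JPi rank_k vE v0.
have [||e ef e0] := frame_ext JJ rank_k omega_anti omegaJ
  (d := k.-1) (e := fun=> v) (j := 1).
- by rewrite add1n prednK.
- by split=> [a _|[|a] [|b]].
have := frame_wedge JJ rank_k omega_anti omegaJ x ef (omega_frame_pos ef).
have : wedge_pow (form_mx alpha) k x (fun i => frame_tuple J e i) = 0.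
  have z0 : (0 < k * 2)%N by rewrite muln_gt0 k0.
  apply: (@wedge_pow_null _ _ (form_mx alpha) x (pair_form alpha) _
           (pair_form_anti alpha_anti) k _ (Ordinal z0)) => // w.
  rewrite /frame_tuple /= e0 // /pair_form -map_mxM va map_mx0 mul0mx.
  by rewrite mxE.
rewrite wedgeE => /eqP; rewrite mulf_eq0 (_ : (F%:C == 0) = false); last first.
  by rewrite eq_complex /= eqxx andbT gt_eqF.
move=> /= /eqP ->; rewrite lecR leNgt => /negP; apply.
rewrite mulr_gt0 ?wedge_const_gt0 //; apply: prodr_gt0 => a _.
exact: omega_frame_pos.
Qed.

(** Evaluate the equation on a frame for omega; the lengths of the frame vectors occur to the same
    power on both sides and cancel. *)
Lemma ratio_bound : (forall a b, `|alpha a b| <= A) ->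
  @wedge_const R k * c1 ^+ k * F <= Kw * A ^+ k * D ^+ k.
Proof.
move=> alA.
have [||e ef _] := frame_ext JJ rank_k omega_anti omegaJ
  (d := k) (e := fun=> 0) (j := 0%N).
- by rewrite add0n.
- by split.
have H1 := frame_wedge JJ rank_k omega_anti omegaJ x ef (omega_frame_pos ef).
have H2 := @frame_upper alpha x e alA.
rewrite wedgeE normrM in H2.
set W := wedge_pow _ _ _ _ in H1 H2.
have W0 : 0 <= W.
  apply: le_trans H1; rewrite ler0c mulr_ge0 ?(ltW (wedge_const_gt0 _)) //.
  by apply: prodr_ge0 => a _; apply: ltW; exact: omega_frame_pos.
have FC : 0 <= F%:C :> C by rewrite ler0c ltW.
rewrite (ger0_norm W0) (ger0_norm FC) in H2.
have : (F * (@wedge_const R k * \prod_(a < k) bf omega_mx (e a) (e a *m J)))%:C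
    <= (Kw * A ^+ k * \prod_(a < k) (D * `|e a| ^+ 2))%:C.
  by apply: le_trans H2; rewrite rmorphM; apply: ler_wpM2l.
rewrite lecR => H3.
pose Q := \prod_(a < k) `|e a| ^+ 2.
have Q0 : 0 < Q.
  apply: prodr_gt0 => a _; rewrite exprn_gt0 // normr_gt0.
  by have [] := (proj1 ef) a (ltn_ord a).
rewrite -(ler_pM2r Q0).
have DQ : \prod_(a < k) (D * `|e a| ^+ 2) = D ^+ k * Q.
  by rewrite big_split /= prodr_const card_ord.
rewrite DQ in H3; rewrite -[leRHS]mulrA; apply: le_trans H3.
rewrite (_ : _ * Q = F * (@wedge_const R k * (c1 ^+ k * Q))); last by ring.
apply: ler_wpM2l; first exact: ltW.
apply: ler_wpM2l; first exact: ltW (wedge_const_gt0 _).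
have -> : c1 ^+ k * Q = \prod_(a < k) (c1 * `|e a| ^+ 2).
  by rewrite big_split /= prodr_const card_ord.
apply: ler_prod => a _; rewrite mulr_ge0 ?(ltW c10) ?exprn_ge0 //=.
rewrite omega_pos //; by have [] := (proj1 ef) a (ltn_ord a).
Qed.

(** Complete v to a frame for alpha. The product of the diagonal values of alpha is bounded above
    through F omega^k, and the k - 1 values other than the one at v are bounded below by g / 2,
    which bounds the value at v. *)
Lemma eigen_upper : (forall a b, `|omega_mx a b| <= A) ->
  (forall v, eigen Pi eps v -> 2^-1 * bf g v v <= bf alpha v (v *m J)) ->
  forall v, eigen Pi eps v ->
    @wedge_const R k * (2^-1 * c1) ^+ k.-1 * bf alpha v (v *m J)
      <= F * (Kw * A ^+ k * D ^+ k) * `|v| ^+ 2.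
Proof.
move=> omA al_low v vE.
have [->|v0] := eqVneq v 0.
  by rewrite mul0mx /bf mul0mx mul0mx mxE mulr0 normr0 expr0n mulr0.
have k0 := eigen_rank JJ JPi rank_k vE v0.
have [||e ef e0] := frame_ext JJ rank_k alpha_anti alphaJ
  (d := k.-1) (e := fun=> v) (j := 1).
- by rewrite add1n prednK.
- by split=> [a _|[|a] [|b]].
have pos a : (a < k)%N -> 0 < bf alpha (e a) (e a *m J).
  move=> ak; have [ea0 eaE] := (proj1 ef) a ak.
  apply: lt_le_trans (al_low _ eaE); rewrite mulr_gt0 ?invr_gt0 //.
  exact: gpos.
have H1 := frame_wedge JJ rank_k alpha_anti alphaJ x ef pos.
have H2 := @frame_upper omega_mx x e omA.
have H3 : (@wedge_const R k * \prod_(a < k) bf alpha (e a) (e a *m J))%:C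
   <= (F * (Kw * A ^+ k * \prod_(a < k) (D * `|e a| ^+ 2)))%:C.
  have W0 : 0 <= wedge_pow (form_mx alpha) k x (fun i => frame_tuple J e i).
    apply: le_trans H1; rewrite ler0c mulr_ge0 ?(ltW (wedge_const_gt0 _)) //.
    by apply: prodr_ge0 => a _; apply: ltW; exact: pos.
  apply: le_trans H1 _; rewrite -(ger0_norm W0) wedgeE normrM rmorphM.
  have FC : 0 <= F%:C :> C by rewrite ler0c ltW.
  by rewrite (ger0_norm FC); apply: ler_wpM2l.
rewrite lecR in H3.
have kS : k = k.-1.+1 by rewrite prednK.
pose Q := \prod_(a < k.-1) `|e a.+1| ^+ 2.
have split_prod (f : nat -> R) : \prod_(a < k) f a = f 0%N * \prod_(a < k.-1) f a.+1.
  exact: prod_recl.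
have Q0 : 0 < Q.
  apply: prodr_gt0 => a _; rewrite exprn_gt0 // normr_gt0.
  have ak : (a.+1 < k)%N by rewrite -ltn_predRL.
  by have [] := (proj1 ef) _ ak.
rewrite (split_prod (fun a => bf alpha (e a) (e a *m J))) e0 // in H3.
rewrite -(ler_pM2r Q0).
have DQ : \prod_(a < k) (D * `|e a| ^+ 2) = D ^+ k * (`|v| ^+ 2 * Q).
  rewrite big_split /= prodr_const card_ord; congr (_ * _).
  by rewrite (split_prod (fun a => `|e a| ^+ 2)) e0.
rewrite DQ in H3.
rewrite (_ : F * (Kw * A ^+ k * D ^+ k) * `|v| ^+ 2 * Q =
   F * (Kw * A ^+ k * (D ^+ k * (`|v| ^+ 2 * Q)))); last by ring.
apply: le_trans H3.
rewrite (_ : _ * Q = @wedge_const R k * (bf alpha v (v *m J) * ((2^-1 * c1) ^+ k.-1 * Q))); last by ring.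
apply: ler_wpM2l; first exact: ltW (wedge_const_gt0 _).
apply: ler_wpM2l; first by have := pos 0%N k0; rewrite e0 // => /ltW.
have -> : (2^-1 * c1) ^+ k.-1 * Q = \prod_(a < k.-1) (2^-1 * c1 * `|e a.+1| ^+ 2).
  by rewrite big_split /= prodr_const card_ord.
have c12 : 0 <= 2^-1 * c1 by rewrite mulr_ge0 ?invr_ge0 // ltW.
apply: ler_prod => a _; rewrite mulr_ge0 ?exprn_ge0 //=.
have ak : (a.+1 < k)%N by rewrite -ltn_predRL.
have [_ eE] := (proj1 ef) _ ak.
apply: le_trans (al_low _ eE); rewrite -mulrA.
by apply: ler_wpM2l; rewrite ?invr_ge0.
Qed.

End PointwiseEstimates.

(** * The matrix of i del delbar f *)

Section DdbarMatrix.
Context {R : realType} {m : nat}.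
Local Notation C := R[i].
Local Notation toC := (map_mx (real_complex R)).
Local Notation rV := 'rV[R]_m.
Local Notation e_ a := (delta_mx 0 a : 'rV[R]_m).

Lemma is_derive_bigsum (I : finType) (h : I -> rV -> R) (x v : rV) (dh : I -> R) :
  (forall i, is_derive x v (h i) (dh i)) ->
  is_derive x v (fun y => \sum_i h i y) (\sum_i dh i).
Proof.
move=> hd; rewrite unlock /=; elim: (index_enum I) => [|i s IH] /=.
  exact: is_derive_cst.
exact: is_deriveD.
Qed.

Lemma is_derive_mull (h : rV -> R) (x v : rV) (k dh : R) :
  is_derive x v h dh -> is_derive x v (fun y => k * h y) (k * dh).
Proof. by move=> hd; exact: is_deriveZ. Qed.

Lemma ReM (a b : C) : complex.Re (a * b) =
  complex.Re a * complex.Re b - complex.Im a * complex.Im b.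
Proof. by case: a; case: b. Qed.

Lemma ImM (a b : C) : complex.Im (a * b) =
  complex.Re a * complex.Im b + complex.Im a * complex.Re b.
Proof. by case: a => a1 a2; case: b => b1 b2 /=. Qed.

Lemma partial_sum (I : finType) (c : I -> C) (p q : I -> rV -> R) (dp dq : I -> R) x a :
  (forall b, is_derive x (e_ a) (p b) (dp b)) ->
  (forall b, is_derive x (e_ a) (q b) (dq b)) ->
  partial (fun y => \sum_b c b * (p b y +i* q b y)) a x =
  \sum_b c b * (dp b +i* dq b).
Proof.
move=> hp hq; apply/eqP; rewrite eq_complex /partial /=; apply/andP; split; apply/eqP.
  rewrite Re_sum.
  have -> : (fun y => complex.Re (\sum_b c b * (p b y +i* q b y))) =
    (fun y => \sum_b (complex.Re (c b) * p b y - complex.Im (c b) * q b y)).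
    by apply: boolp.funext => y; rewrite Re_sum; apply: eq_bigr => b _; rewrite ReM.
  rewrite (_ : \sum_i _ = \sum_b (complex.Re (c b) * dp b - complex.Im (c b) * dq b)).
    apply: derive_val; apply: is_derive_bigsum => b.
  by apply: eq_bigr => b _; rewrite ReM.
rewrite Im_sum.
have -> : (fun y => complex.Im (\sum_b c b * (p b y +i* q b y))) =
  (fun y => \sum_b (complex.Re (c b) * q b y + complex.Im (c b) * p b y)).
  by apply: boolp.funext => y; rewrite Im_sum; apply: eq_bigr => b _; rewrite ImM.
rewrite (_ : \sum_i _ = \sum_b (complex.Re (c b) * dq b + complex.Im (c b) * dp b)).
  apply: derive_val; apply: is_derive_bigsum => b.
by apply: eq_bigr => b _; rewrite ImM.
Qed.

Lemma partial_near (f g : rV -> C) a x : (\forall y \near x, f y = g y) ->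
  partial f a x = partial g a x.
Proof.
move=> fg; congr (_ +i* _); apply: near_eq_derive;
  by apply: nearS fg => y ->.
Qed.

Lemma ext_d_near p (a a' : @Defs.form R m p) x v :
  (\forall y \near x, forall w, a y w = a' y w) -> ext_d a x v = ext_d a' x v.
Proof.
move=> aa'; apply: eq_bigr => s _; congr (_ * _); apply: eq_bigr => j _; congr (_ * _).
by apply: partial_near; apply: nearS aa' => y ->.
Qed.

Lemma ext_d_zero p x v : ext_d ((fun _ _ => 0) : @Defs.form R m p) x v = 0 :> C.
Proof.
apply: big1 => s _; rewrite big1 ?mulr0 // => j _.
rewrite /partial /= (_ : (fun=> 0) = cst (0 : R)) // derive_cst.
by rewrite mulr0.
Qed.

Lemma ext_d_1form (a : @Defs.form R m 1) x v :
  ext_d a x v = \sum_j v ord0 0 j * partial (fun y => a y (fun=> v ord_max)) j x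
              - \sum_j v ord_max 0 j * partial (fun y => a y (fun=> v ord0)) j x.
Proof.
rewrite /ext_d big_ord_recl big_ord1 expr0 mul1r expr1 mulN1r.
have l0 (t : 'I_1) : lift ord0 t = ord_max :> 'I_2 by apply: val_inj; rewrite /= ord1.
have l1 (t : 'I_1) : lift (lift ord0 ord0) t = ord0 :> 'I_2 by apply: val_inj; rewrite /= ord1.
have E0 : (fun t : 'I_1 => v (lift ord0 t)) = (fun=> v ord_max).
  by apply: boolp.funext => t; rewrite l0.
have E1 : (fun t : 'I_1 => v (lift (lift ord0 ord0) t)) = (fun=> v ord0).
  by apply: boolp.funext => t; rewrite l1.
rewrite E0 E1; congr (_ - _).
by apply: eq_bigr => j _; rewrite (_ : lift ord0 ord0 = ord_max) //; apply: val_inj.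
Qed.

Lemma pair_formDl (N : 'M[R]_m) u1 u2 v :
  pair_form N (u1 + u2) v = pair_form N u1 v + pair_form N u2 v.
Proof. by rewrite /pair_form !mulmxDl mxE. Qed.

Lemma pair_formDr (N : 'M[R]_m) u v1 v2 :
  pair_form N u (v1 + v2) = pair_form N u v1 + pair_form N u v2.
Proof. by rewrite /pair_form linearD mulmxDr mxE. Qed.

Lemma pair_formZl (N : 'M[R]_m) c u v : pair_form N (c *: u) v = c * pair_form N u v.
Proof. by rewrite /pair_form -!scalemxAl mxE. Qed.

Lemma pair_formZr (N : 'M[R]_m) c u v : pair_form N u (c *: v) = c * pair_form N u v.
Proof. by rewrite /pair_form linearZ -scalemxAr mxE. Qed.

Lemma pair_form_add (N M : 'M[R]_m) u v :
  pair_form (N + M) u v = pair_form N u v + pair_form M u v.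
Proof. by rewrite /pair_form map_mxD mulmxDr mulmxDl mxE. Qed.

Lemma pair_form_scale (c : R) (N : 'M[R]_m) u v :
  pair_form (c *: N) u v = c%:C * pair_form N u v.
Proof. by rewrite /pair_form map_mxZ -scalemxAr -scalemxAl mxE. Qed.

Lemma pair_form_conj (N K : 'M[R]_m) u v :
  pair_form (K *m N *m K^T) u v = pair_form N (u *m toC K) (v *m toC K).
Proof. by rewrite /pair_form trmx_mul !map_mxM map_trmx !mulmxA. Qed.

Lemma form_mx_pair (N : 'M[R]_m) x w :
  form_mx N x w = pair_form N (w ord0) (w ord_max).
Proof. by []. Qed.

Section Bidegree.
Variable J : rV -> 'M[R]_m.

Lemma bideg0 r (a : @Defs.form R m r) x v :
  bideg J 0 a x v = a x (fun t => v t *m proj01 J x).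
Proof.
rewrite /bideg (big_pred1 (finset.set0 : {set 'I_r})); last by move=> S; rewrite /= cards_eq0.
by congr (a x _); apply: boolp.funext => t; rewrite inE.
Qed.

Lemma bideg_top r (a : @Defs.form R m r) x v :
  bideg J r a x v = a x (fun t => v t *m proj10 J x).
Proof.
rewrite /bideg (big_pred1 (finset.setTfor 'I_r)); last first.
  move=> S; rewrite /= finset.eqEcard finset.subsetT cardsT card_ord eqn_leq.
  by have := max_card (mem S); rewrite card_ord => ->.
by congr (a x _); apply: boolp.funext => t; rewrite inE.
Qed.

Lemma bideg1_2form (a : @Defs.form R m 2) (b : 'rV[C]_m -> 'rV[C]_m -> C) x v :
  (forall w, a x w = b (w ord0) (w ord_max)) ->
  bideg J 1 a x v = b (v ord0 *m proj10 J x) (v ord_max *m proj01 J x)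
                  + b (v ord0 *m proj01 J x) (v ord_max *m proj10 J x).
Proof.
move=> ab.
have d01 : (finset.set1 (ord_max : 'I_2)) != finset.set1 (ord0 : 'I_2).
  by apply/eqP => /setP/(_ ord0); rewrite !inE.
rewrite /bideg (bigD1 (finset.set1 (ord0 : 'I_2))) ?cards1 //=.
rewrite (bigD1 (finset.set1 (ord_max : 'I_2))) ?cards1 //= big1; last first.
  move=> S /andP[/andP[/cards1P[i ->]]].
  by case: i => [[|[|]]] //= ilt h1 h2; [case/eqP: h1|case/eqP: h2];
     congr finset.set1; apply: val_inj.
by rewrite addr0 !ab !inE.
Qed.

Let X x : 'M[C]_m := 'i%C *: toC (J x).

Lemma halfC : (2^-1 : C) = (2^-1 : R)%:C.
Proof. by rewrite fmorphV rmorph_nat. Qed.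

Lemma pair_form_comb N (c d : C) (u u' v v' : 'rV[C]_m) :
  pair_form N (2^-1 *: (u + c *: u')) (2^-1 *: (v + d *: v')) =
  2^-1 * 2^-1 * (pair_form N u v + d * pair_form N u v' + c * pair_form N u' v
                 + c * d * pair_form N u' v').
Proof.
rewrite pair_formZl pair_formZr [pair_form N (u + _) _]pair_formDl.
rewrite [pair_form N u _]pair_formDr [pair_form N u (d *: _)]pair_formZr.
rewrite [pair_form N (c *: _) _]pair_formZl [pair_form N u' _]pair_formDr.
rewrite [pair_form N u' (d *: _)]pair_formZr; ring.
Qed.

(** The terms linear in i cancel between the two summands and i^2 = - 1 makes the rest add up: the
    (1,1)-part of a form is its average with its J-transform. *)
Lemma proj_mix N x u v :
  pair_form N (u *m proj10 J x) (v *m proj01 J x)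
  + pair_form N (u *m proj01 J x) (v *m proj10 J x)
  = pair_form (2^-1 *: (N + J x *m N *m (J x)^T)) u v.
Proof.
have [j jE] : exists j : C, j = - 'i%C by eexists.
have p10 w : w *m proj10 J x = 2^-1 *: (w + j *: (w *m toC (J x))).
  by rewrite /proj10 -scalemxAr mulmxBr mulmx1 -scalemxAr jE scaleNr.
have p01 w : w *m proj01 J x = 2^-1 *: (w + 'i%C *: (w *m toC (J x))).
  by rewrite /proj01 -scalemxAr mulmxDr mulmx1 -scalemxAr.
rewrite !p10 !p01 pair_form_scale pair_form_add pair_form_conj.
move: (u *m toC (J x)) (v *m toC (J x)) => u' v'.
have i2 := sqr_i R.
rewrite (pair_form_comb N j 'i%C) (pair_form_comb N 'i%C j) jE -halfC.
set a := pair_form N u v; set d := pair_form N u' v'.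
set b := pair_form N u _; set c := pair_form N _ v.
transitivity (2^-1 * 2^-1 * 2 * (a - 'i%C ^+ 2 * d)); first by ring.
by rewrite i2 mulN1r opprK -[_ * _ * 2]mulrA mulVf ?mulr1 // pnatr_eq0.
Qed.

Variables (U : set rV) (dJ : 'I_m -> 'I_m -> 'I_m -> rV -> R).
Hypothesis Uo : open U.
Hypothesis JC : forall b c, C1on U (fun y => J y b c) (fun a => dJ a b c).
Hypothesis JJ : forall x, U x -> J x *m J x = - 1%:M.

Let XX x : U x -> X x *m X x = 1%:M.
Proof.
move=> Ux; rewrite /X -scalemxAl -scalemxAr -map_mxM JJ // map_mxN map_mx1.
by rewrite scalerA -expr2 sqr_i scaleN1r opprK.
Qed.

Lemma proj01K x : U x -> proj01 J x *m proj01 J x = proj01 J x.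
Proof.
move=> Ux; rewrite /proj01 -/(X x) -scalemxAl -scalemxAr mulmxDl mul1mx.
rewrite mulmxDr mulmx1 (XX Ux) [X x + _]addrC.
have -> : 1%:M + X x + (1%:M + X x) = 2 *: (1%:M + X x) by rewrite scaler_nat mulr2n.
by rewrite [2^-1 *: (2 *: _)]scalerA mulVf ?scale1r // pnatr_eq0.
Qed.

Lemma proj10_01 x : U x -> proj10 J x *m proj01 J x = 0.
Proof.
move=> Ux; rewrite /proj01 /proj10 -/(X x) -scalemxAl -scalemxAr mulmxBl mul1mx.
by rewrite mulmxDr mulmx1 (XX Ux) [X x + _]addrC subrr !scaler0.
Qed.

Variables (f : rV -> R) (df : 'I_m -> rV -> R) (hf : 'I_m -> 'I_m -> rV -> R).
Hypothesis fC : C2on U f df hf.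

(* [dJdf] is the 1-form J df, [curl_mx] its exterior derivative, and [beta_mx] is
   the (1,1)-part of that up to the factor - 1/2. *)
Definition dJdf (b : 'I_m) (x : rV) : R := \sum_c J x b c * df c x.
Definition ddJdf (a b : 'I_m) (x : rV) : R :=
  \sum_c (dJ a b c x * df c x + J x b c * hf a c x).
Definition curl_mx (x : rV) : 'M[R]_m := \matrix_(a, b) (ddJdf a b x - ddJdf b a x).
Definition beta_mx (x : rV) : 'M[R]_m :=
  - 4^-1 *: (curl_mx x + J x *m curl_mx x *m (J x)^T).

Lemma is_derive_dJdf a b x : U x -> is_derive x (e_ a) (dJdf b) (ddJdf a b x).
Proof.
move=> Ux; apply: is_derive_bigsum => c.
have [Jd _] := JC b c Ux a; have [dfd _] := proj2 fC c x Ux a.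
have := is_deriveM Jd dfd; rewrite /GRing.scale /= addrC.
by rewrite [df c x * _]mulrC.
Qed.

Let theta : @Defs.form R m 1 := fun y v => \sum_b (v ord0 *m proj01 J y) 0 b * (df b y)%:C.

Lemma delbar0E y v : U y -> delbar J (form0 f) y v = theta y v.
Proof.
move=> Uy; rewrite /delbar big_ord1 bideg0 /ext_d big_ord1 expr0 mul1r.
apply: eq_bigr => b _; congr (_ * _).
have -> : (fun y0 => bideg J 0 (form0 f) y0 (fun t => v (lift ord0 t) *m proj01 J y)) =
   (fun y => (f y)%:C) by apply: boolp.funext => z; rewrite bideg0.
have [fd _] := proj1 fC y Uy b.
rewrite /partial /= derive_val (_ : (fun=> 0) = cst (0 : R)) // derive_cst.
by [].
Qed.

Lemma thetaE y v : theta y v = \sum_b v ord0 0 b * (2^-1 * df b y +i* (2^-1 * dJdf b y)).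
Proof.
rewrite /theta /proj01.
have -> : v ord0 *m (2^-1 *: (1%:M + 'i%C *: toC (J y))) =
  2^-1 *: (v ord0 + 'i%C *: (v ord0 *m toC (J y))).
  by rewrite -scalemxAr mulmxDr mulmx1 -scalemxAr.
have -> : \sum_b v ord0 0 b * (2^-1 * df b y +i* (2^-1 * dJdf b y)) =
  \sum_b 2^-1 * (v ord0 0 b * (df b y)%:C)
  + \sum_b \sum_c 2^-1 * ('i%C * (v ord0 0 b * (J y b c)%:C * (df c y)%:C)).
  rewrite -big_split; apply: eq_bigr => b _ /=.
  rewrite -!mulr_sumr.
  under eq_bigr do rewrite -mulrA -rmorphM.
  rewrite -mulr_sumr -rmorph_sum -/(dJdf b y) /=.
  have -> : (2^-1 * df b y +i* (2^-1 * dJdf b y)) =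
     2^-1 * ((df b y)%:C + 'i%C * (dJdf b y)%:C).
    rewrite halfC; by apply/eqP; rewrite eq_complex /=; apply/andP; split; apply/eqP; ring.
  ring.
rewrite exchange_big /= -big_split; apply: eq_bigr => c _ /=.
rewrite !mxE mulrDr mulrDl -mulrA; congr (_ + _).
rewrite mulr_sumr mulr_sumr mulr_suml; apply: eq_bigr => b _.
by rewrite mxE; ring.
Qed.

(** [del] sums over the bidegree components of delbar f. The (0,1)-component is [theta] itself,
    since [proj01] is idempotent, and the (1,0)-component vanishes. Both facts hold on the open set
    U and so may be differentiated. *)
Lemma del_theta x v : U x -> del J (delbar J (form0 f)) x v =
  bideg J 1 (ext_d theta) x v.
Proof.
move=> Ux; rewrite /del big_ord_recl big_ord1 /=.
have nU : \forall y \near x, U y by exact: open_nbhs_nbhs.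
have -> : bideg J 1 (ext_d (bideg J 0 (delbar J (form0 f)))) x v =
          bideg J 1 (ext_d theta) x v.
  apply: eq_bigr => S _; apply: ext_d_near; apply: nearS nU => y Uy w.
  rewrite bideg0 delbar0E //; apply: eq_bigr => b _.
  by rewrite -mulmxA proj01K.
rewrite -[RHS]addr0; congr (_ + _).
apply: big1 => S _; rewrite -[RHS](ext_d_zero x (fun t => v t *m
   (if t \in S then proj10 J x else proj01 J x))).
apply: ext_d_near; apply: nearS nU => y Uy w.
rewrite (bideg_top (r := 1)) delbar0E //; apply: big1 => b _.
by rewrite -mulmxA proj10_01 // mulmx0 mxE mul0r.
Qed.

(** By [thetaE], theta = (df + i J df) / 2. The exact part df drops out by symmetry of second
    derivatives, leaving the derivative of i J df / 2. *)
Lemma ext_theta x w : U x ->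
  ext_d theta x w = 2^-1 * 'i%C * pair_form (curl_mx x) (w ord0) (w ord_max).
Proof.
move=> Ux; rewrite ext_d_1form.
have dtheta j u : partial (fun y => theta y (fun=> u)) j x =
   \sum_b u 0 b * (2^-1 * hf j b x +i* (2^-1 * ddJdf j b x)).
  have -> : (fun y => theta y (fun=> u)) =
     (fun y => \sum_b u 0 b * (2^-1 * df b y +i* (2^-1 * dJdf b y))).
    by apply: boolp.funext => y; rewrite thetaE.
  apply: partial_sum => b; apply: is_derive_mull.
    by have [] := proj2 fC b x Ux j.
  exact: is_derive_dJdf.
have E (u u' : 'rV[C]_m) : \sum_j u 0 j * partial (fun y => theta y (fun=> u')) j x =
   \sum_j \sum_b u 0 j * (u' 0 b * (2^-1 * hf j b x +i* (2^-1 * ddJdf j b x))).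
  by apply: eq_bigr => j _; rewrite dtheta mulr_sumr.
transitivity (\sum_j \sum_b w ord0 0 j * (w ord_max 0 b * (2^-1 * hf j b x +i* (2^-1 * ddJdf j b x)))
  - \sum_j \sum_b w ord_max 0 j * (w ord0 0 b * (2^-1 * hf j b x +i* (2^-1 * ddJdf j b x)))).
  congr (_ - _).
    exact: E.
  exact: E.
have -> : \sum_j \sum_b w ord_max 0 j * (w ord0 0 b * (2^-1 * hf j b x +i* (2^-1 * ddJdf j b x))) =
  \sum_b \sum_j w ord_max 0 j * (w ord0 0 b * (2^-1 * hf j b x +i* (2^-1 * ddJdf j b x))).
  exact: exchange_big.
rewrite -sumrB /pair_form [in RHS]mxE mulr_sumr.
rewrite [RHS](_ : _ = \sum_a \sum_b 2^-1 * 'i%C * (w ord0 0 a * (curl_mx x a b)%:C * w ord_max 0 b)).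
  apply: eq_bigr => a _; rewrite -sumrB; apply: eq_bigr => b _.
  rewrite mxE (schwarz b a Uo fC Ux).
  rewrite mulrCA [w ord_max 0 b * (_ * _)]mulrCA [w ord_max 0 b * _]mulrA [w ord_max 0 b * w ord0 0 a]mulrC.
  rewrite mulrA -mulrBr.
  rewrite (_ : (_ +i* _) - _ = 2^-1 * 'i%C * (ddJdf a b x - ddJdf b a x)%:C); last first.
    rewrite halfC; by apply/eqP; rewrite eq_complex /=; apply/andP; split; apply/eqP; ring.
  ring.
rewrite exchange_big /=; apply: eq_bigr => b _.
rewrite !mxE mulr_suml mulr_sumr; apply: eq_bigr => a _.
by rewrite !mxE.
Qed.

(** The factor - 1/4 in [beta_mx] is i from [ddbar], times i / 2 from [ext_theta], times 1 / 2 from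
    [proj_mix]. *)
Lemma ddbarE x w : U x -> ddbar J f x w = form_mx (beta_mx x) x w.
Proof.
move=> Ux; rewrite /ddbar del_theta //.
rewrite (bideg1_2form (b := fun u v => (2^-1 * 'i%C) * pair_form (curl_mx x) u v)); last first.
  by move=> w'; exact: ext_theta.
rewrite -mulrDr proj_mix form_mx_pair /beta_mx !pair_form_scale.
set Z := pair_form _ _ _.
transitivity ('i%C ^+ 2 * (2^-1 * (2^-1)%:C) * Z); first by ring.
rewrite sqr_i mulN1r; congr (_ * _).
by rewrite halfC -rmorphM -rmorphN -invfM -natrM.
Qed.

Lemma beta_anti x : (beta_mx x)^T = - beta_mx x.
Proof.
have ca : (curl_mx x)^T = - curl_mx x.
  by apply/matrixP => a b; rewrite !mxE opprB.
rewrite /beta_mx linearZ /= linearD /= !trmx_mul trmxK ca mulNmx mulmxN mulmxA.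
by rewrite -opprD scalerN.
Qed.

Lemma beta_J x : U x -> J x *m beta_mx x *m (J x)^T = beta_mx x.
Proof.
move=> Ux; rewrite /beta_mx -scalemxAr -scalemxAl mulmxDr mulmxDl; congr (_ *: _).
rewrite addrC; congr (_ + _).
rewrite !mulmxA JJ // -(mulmxA _ (J x)^T (J x)^T) -trmx_mul JJ // linearN /= trmx1.
by rewrite mulNmx mul1mx mulmxN mulmx1 opprK.
Qed.

End Bidegree.
End DdbarMatrix.

(** * The comparison principle *)

Section Continuity.
Context {R : realType} {m : nat}.
Local Notation rV := 'rV[R]_m.

Lemma ctsD (f g : rV -> R) x : {for x, continuous f} -> {for x, continuous g} ->
  {for x, continuous (fun y => f y + g y)}.
Proof.
move=> /cts_atP fc /cts_atP gc; apply/cts_atP => e e0.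
have e2 : 0 < e / 2 by rewrite divr_gt0.
apply: nearS (nearI (fc _ e2) (gc _ e2)) => y [h1 h2].
rewrite opprD addrACA; apply: le_trans (ler_normD _ _) _.
by rewrite (splitr e) lerD.
Qed.

Lemma ctsM (f g : rV -> R) x : {for x, continuous f} -> {for x, continuous g} ->
  {for x, continuous (fun y => f y * g y)}.
Proof.
move=> fc gc.
have : f @ x --> (f x : R^o) by [].
have : g @ x --> (g x : R^o) by [].
move=> h1 h2.
have F : Filter (nbhs x) by exact: nbhs_filter.
exact: (cvgM h2 h1).
Qed.

Lemma cts_cst (c : R) (x : rV) : {for x, continuous (fun=> c)}.
Proof.
apply/cts_atP => e e0; apply/nearVP; exists 1 => // y _.
by rewrite subrr normr0 ltW.
Qed.

Lemma ctsN (f : rV -> R) x : {for x, continuous f} -> {for x, continuous (fun y => - f y)}.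
Proof.
move=> fc; rewrite (_ : (fun y => - f y) = (fun y => (-1) * f y)).
  by apply: ctsM => //; exact: cts_cst.
by apply: boolp.funext => y; rewrite mulN1r.
Qed.

Lemma cts_sum (I : finType) (f : I -> rV -> R) x :
  (forall i, {for x, continuous (f i)}) -> {for x, continuous (fun y => \sum_i f i y)}.
Proof.
move=> fc; rewrite unlock /=; elim: (index_enum I) => [|i s IH] /=.
  exact: cts_cst.
by apply: ctsD.
Qed.

Lemma cts_coord a (x : rV) : {for x, continuous (fun y : rV => y 0 a)}.
Proof. exact: coord_continuous. Qed.

Lemma cts_comp (F : R -> R) (f : rV -> R) x : {for x, continuous f} ->
  {for f x, continuous F} -> {for x, continuous (fun y => F (f y))}.
Proof. by move=> fc Fc; exact: (continuous_comp fc Fc). Qed.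

Lemma C1on_cst (U : set rV) (c : R) : C1on U (fun=> c) (fun _ _ => 0).
Proof. by move=> x Ux a; split; [exact: is_derive_cst|exact: cts_cst]. Qed.

Lemma C1on_add (U : set rV) (f g : rV -> R) df dg : C1on U f df -> C1on U g dg ->
  C1on U (fun y => f y + g y) (fun a y => df a y + dg a y).
Proof.
move=> fC gC x Ux a; have [f1 f2] := fC x Ux a; have [g1 g2] := gC x Ux a.
by split; [exact: is_deriveD|exact: ctsD].
Qed.

Lemma C1on_scale (U : set rV) (f : rV -> R) df c : C1on U f df ->
  C1on U (fun y => c * f y) (fun a y => c * df a y).
Proof.
move=> fC x Ux a; have [f1 f2] := fC x Ux a.
split; first exact: is_derive_mull.
by apply: ctsM => //; exact: cts_cst.
Qed.

Lemma C1on_sum (I : finType) (U : set rV) (f : I -> rV -> R) df :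
  (forall i, C1on U (f i) (df i)) ->
  C1on U (fun y => \sum_i f i y) (fun a y => \sum_i df i a y).
Proof.
move=> fC x Ux a; split.
  by apply: is_derive_bigsum => i; have [] := fC i x Ux a.
by apply: cts_sum => i; have [] := fC i x Ux a.
Qed.

Lemma C1on_mul (U : set rV) (f g : rV -> R) df dg : open U -> C1on U f df -> C1on U g dg ->
  C1on U (fun y => f y * g y) (fun a y => f y * dg a y + g y * df a y).
Proof.
move=> Uo fC gC x Ux a; have [f1 f2] := fC x Ux a; have [g1 g2] := gC x Ux a.
split; first exact: is_deriveM.
by apply: ctsD; apply: ctsM => //; [exact: C1_cts fC Ux|exact: C1_cts gC Ux].
Qed.

Lemma C1on_comp (U : set rV) (f : rV -> R) df (F dF : R -> R) : open U -> C1on U f df ->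
  (forall x, U x -> is_derive (f x) (1 : R) F (dF (f x))) ->
  (forall x, U x -> {for f x, continuous dF}) ->
  C1on U (fun y => F (f y)) (fun a y => dF (f y) * df a y).
Proof.
move=> Uo fC Fd Fc x Ux a; have [f1 f2] := fC x Ux a; split; last first.
  apply: ctsM => //; apply: cts_comp; last exact: Fc.
  exact: C1_cts fC Ux.
have E h : (F \o f \o shift x) (h *: delta_mx 0 a) =
   (F \o (fun t : R => f (x + t *: delta_mx 0 a)) \o shift 0) (h *: (1 : R)).
  by rewrite /= addr0 [h *: 1]mulr1 addrC.
have f1' : is_derive (x + 0 *: delta_mx 0 a) (delta_mx 0 a) f (df a x).
  by rewrite scale0r addr0.
have g1 := is_derive_line f1'.
have Fd' : is_derive (f (x + 0 *: delta_mx 0 a)) (1 : R) F (dF (f x)).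
  by rewrite scale0r addr0; exact: Fd.
have := is_derive1_comp Fd' g1.
move=> [d1 d2].
have EE : (fun h : R => h^-1 *: ((F \o (fun t : R => f (x + t *: delta_mx 0 a)) \o shift 0) (h *: (1 : R))
        - (F \o (fun t : R => f (x + t *: delta_mx 0 a))) 0)) =
      (fun h : R => h^-1 *: (((fun y => F (f y)) \o shift x) (h *: delta_mx 0 a) - F (f x))).
  by apply: boolp.funext => h; rewrite -E /= scale0r addr0.
split; first by rewrite /derivable -EE.
by rewrite /derive -EE; exact: d2.
Qed.

Lemma C1on_sub (U V : set rV) (f : rV -> R) df : V `<=` U -> C1on U f df -> C1on V f df.
Proof. by move=> VU fC x /VU Ux; exact: fC. Qed.

Lemma C1on_coord (U : set rV) b : C1on U (fun y => y 0 b) (fun a _ => (a == b)%:R).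
Proof.
move=> x Ux a; split; last exact: cts_cst.
have E : (fun h : R => h^-1 *: (((fun y : rV => y 0 b) \o shift x) (h *: delta_mx 0 a) - x 0 b)) @ 0^' --> ((a == b)%:R : R).
  apply: (@cvg_near_cst _ _ _ _ _ _); near=> h.
  have h0 : h != 0 by near: h; exact: nbhs_dnbhs_neq.
  by rewrite /= !mxE /= addrK /GRing.scale /= mulrA mulVf // mul1r eq_sym.
split; first by apply/cvg_ex; exists (a == b)%:R.
exact: cvg_lim E.
Unshelve. all: by end_near. Qed.

End Continuity.

(** * Second-order operators and powers of a quadratic form *)

Section Operator.
Context {R : realType} {m : nat}.
Local Notation rV := 'rV[R]_m.

Definition hess (hf : 'I_m -> 'I_m -> rV -> R) (x : rV) : 'M[R]_m := \matrix_(a, b) hf a b x.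

Definition Lop (A : 'M[R]_m) (B : 'I_m -> R) (H : 'M[R]_m) (d : 'I_m -> R) : R :=
  \tr (A *m H) + \sum_c d c * B c.

Lemma LopD A B H1 H2 d1 d2 :
  Lop A B (H1 + H2) (fun c => d1 c + d2 c) = Lop A B H1 d1 + Lop A B H2 d2.
Proof.
rewrite /Lop mulmxDr mxtraceD addrACA; congr (_ + _).
by rewrite -big_split; apply: eq_bigr => c _; rewrite mulrDl.
Qed.

Lemma LopZ A B k H d : Lop A B (k *: H) (fun c => k * d c) = k * Lop A B H d.
Proof.
rewrite /Lop -scalemxAr mxtraceZ mulrDr; congr (_ + _).
by rewrite mulr_sumr; apply: eq_bigr => c _; rewrite mulrA.
Qed.

Lemma Lop_sum (I : finType) A B (H : I -> 'M[R]_m) d :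
  Lop A B (\sum_i H i) (fun c => \sum_i d i c) = \sum_i Lop A B (H i) (d i).
Proof.
rewrite /Lop mulmx_sumr raddf_sum big_split /=; congr (_ + _).
by rewrite exchange_big; apply: eq_bigr => c _; rewrite mulr_suml.
Qed.

Lemma C2_min_psd U f df hf x : open U -> C2on U f df hf -> U x ->
  (\forall y \near x, f x <= f y) -> psd (hess hf x).
Proof.
move=> Uo fC Ux fmin v; have := C2_min Uo fC Ux fmin v.
rewrite bfE exchange_big /=.
suff -> : \sum_b v 0 b * lform (fun a => hf a b x) v =
  \sum_j \sum_i v 0 i * hess hf x i j * v 0 j by [].
apply: eq_bigr => b _; rewrite mulr_sumr; apply: eq_bigr => a _.
by rewrite mxE; ring.
Qed.

Lemma Lop_min U f df hf x A B : open U -> C2on U f df hf -> U x ->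
  (\forall y \near x, f x <= f y) -> A^T = A -> pdf A ->
  0 <= Lop A B (hess hf x) (df^~ x).
Proof.
move=> Uo fC Ux fmin As Ap; rewrite /Lop big1 ?addr0.
  by apply: trace_psd => //; exact: (C2_min_psd Uo fC Ux fmin).
by move=> c _; rewrite (C1_min Uo (proj1 fC) Ux fmin) mul0r.
Qed.

Lemma closed_min (K : set rV) (f : rV -> R) (M : R) : K !=set0 -> closed K ->
  (forall x, K x -> `|x| <= M) -> (forall x, K x -> {for x, continuous f}) ->
  exists2 x, K x & forall y, K y -> f x <= f y.
Proof.
move=> K0 Kc KM fc.
have Kco : compact K.
  apply: bounded_closed_compact => //; exists M; split; first exact: num_real.
  by move=> N MN x Kx /=; apply: le_trans (KM x Kx) (ltW MN).
have fK : {within K, continuous f}.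
  by apply: continuous_in_subspaceT => x /set_mem Kx; exact: fc.
have [x xK xmin] := EVT_min_rV K0 Kco fK.
exists x; first exact: set_mem.
by move=> y Ky; apply: xmin; exact: mem_set.
Qed.

Variable Q : 'M[R]_m.
Hypothesis Qsym : Q^T = Q.

Definition qd (y x : rV) : R := bf Q (x - y) (x - y).
Definition dqd (y : rV) (a : 'I_m) (x : rV) : R := 2 * ((x - y) *m Q) 0 a.
Definition hqd (a b : 'I_m) (x : rV) : R := 2 * Q a b.

Lemma C1on_lin U (y : rV) b : C1on U (fun x => 2 * ((x - y) *m Q) 0 b) (fun a x => hqd a b x).
Proof.
have -> : (fun x => 2 * ((x - y) *m Q) 0 b) =
  (fun x => 2 * (\sum_c Q c b * x 0 c + (- \sum_c Q c b * y 0 c))).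
  apply: boolp.funext => x; congr (_ * _); rewrite mulmxBl !mxE.
  by congr (_ - _); apply: eq_bigr => c _; rewrite mulrC.
have -> : (fun a x => hqd a b x) =
  (fun (a : 'I_m) (x : rV) => 2 * (\sum_c Q c b * (a == c)%:R + 0)).
  apply: boolp.funext => a; apply: boolp.funext => x; rewrite /hqd; congr (_ * _).
  rewrite (bigD1 a) //= eqxx mulr1 big1 ?addr0 // => c ca.
  by rewrite eq_sym (negbTE ca) mulr0.
apply: C1on_scale; apply: C1on_add; last exact: C1on_cst.
by apply: C1on_sum => c; apply: C1on_scale; exact: C1on_coord.
Qed.

Lemma C2on_qd U y : open U -> C2on U (qd y) (dqd y) hqd.
Proof.
move=> Uo; split; last by move=> b; exact: C1on_lin.
have -> : qd y = (fun x => \sum_b 2^-1 * (2 * ((x - y) *m Q) 0 b) * (x 0 b + (- y 0 b))).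
  apply: boolp.funext => x; rewrite /qd /bf mxE; apply: eq_bigr => b _.
  by rewrite mulKf ?pnatr_eq0 // !mxE.
have -> : dqd y = (fun a x => \sum_b
   (2^-1 * (2 * ((x - y) *m Q) 0 b) * ((a == b)%:R + 0)
    + (x 0 b + (- y 0 b)) * (2^-1 * hqd a b x))).
  apply: boolp.funext => a; apply: boolp.funext => x; rewrite big_split /=.
  rewrite (bigD1 a) //= eqxx addr0 mulr1 big1 ?addr0; last first.
    by move=> b ba; rewrite eq_sym (negbTE ba) addr0 mulr0.
  rewrite mulKf ?pnatr_eq0 // /dqd mulr2n mulrDl mul1r; congr (_ + _).
  rewrite mxE; apply: eq_bigr => b _.
  by rewrite /hqd mulKf ?pnatr_eq0 // -{1}Qsym !mxE.
apply: C1on_sum => b; apply: C1on_mul => //.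
  by apply: C1on_scale; exact: C1on_lin.
by apply: C1on_add; [exact: C1on_coord|exact: C1on_cst].
Qed.

Variable s : R.
Definition psi (y x : rV) : R := qd y x `^ (- s).
Definition dpsi (y : rV) (a : 'I_m) (x : rV) : R :=
  (- s) * qd y x `^ (- s - 1) * dqd y a x.
Definition hpsi (y : rV) (a b : 'I_m) (x : rV) : R :=
  (- s) * qd y x `^ (- s - 1) * hqd a b x +
  dqd y b x * ((- s) * ((- s - 1) * qd y x `^ (- s - 1 - 1) * dqd y a x)).

Lemma powR_cts (p t : R) : 0 < t -> {for t, continuous (fun u : R => u `^ p)}.
Proof.
move=> t0; have [d _] := is_derive1_powR p t0.
by apply: differentiable_continuous; apply/derivable1_diffP.
Qed.

Lemma C2on_psi U y : open U -> (forall x, U x -> 0 < qd y x) ->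
  C2on U (psi y) (dpsi y) (hpsi y).
Proof.
move=> Uo q0; have [qC dqC] := C2on_qd y Uo; split.
  rewrite /psi /dpsi.
  apply: (@C1on_comp _ _ U (qd y) (dqd y) (fun t => t `^ (- s)) (fun t => (- s) * t `^ (- s - 1))) => //.
    by move=> x Ux; exact: is_derive1_powR (q0 x Ux).
  move=> x Ux; apply: (@continuousM _ R); first exact: cvg_cst.
  exact: powR_cts (q0 x Ux).
move=> b; apply: C1on_mul => //.
apply: C1on_scale.
apply: (@C1on_comp _ _ U (qd y) (dqd y) (fun t => t `^ (- s - 1)) (fun t => (- s - 1) * t `^ (- s - 1 - 1))) => //.
  by move=> x Ux; exact: is_derive1_powR (q0 x Ux).
move=> x Ux; apply: (@continuousM _ R); first exact: cvg_cst.
exact: powR_cts (q0 x Ux).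
Qed.

Lemma Lop_qd A B y x : Lop A B (hess hqd x) (dqd y ^~ x) =
  2 * (\tr (A *m Q) + \sum_c ((x - y) *m Q) 0 c * B c).
Proof.
rewrite /Lop mulrDr; congr (_ + _).
  rewrite (_ : hess hqd x = 2 *: Q) ?linearZ /= ?mxtraceZ //.
  by apply/matrixP => a b; rewrite !mxE.
by rewrite mulr_sumr; apply: eq_bigr => c _; rewrite /dqd mulrA.
Qed.

(** With w = (x - y) Q, half the gradient of q, one has L(q^-s) = s q^(-s-2) (4 (s + 1) A(w, w) - q
    L q), and the hypothesis says that the bracket is nonnegative. *)
Lemma Lop_psi_ge0 A B y x : 0 <= s -> 0 < qd y x ->
  qd y x * (2 * (\tr (A *m Q) + \sum_c ((x - y) *m Q) 0 c * B c))
    <= 4 * (s + 1) * bf A ((x - y) *m Q) ((x - y) *m Q) ->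
  0 <= Lop A B (hess (hpsi y) x) (dpsi y ^~ x).
Proof.
move=> s0 q0 H.
have [w wE] : exists w, (x - y) *m Q = w by eexists.
rewrite wE in H.
pose P := qd y x `^ (- s - 1 - 1).
have P0 : 0 <= P by rewrite powR_ge0.
have PE : qd y x `^ (- s - 1) = qd y x * P.
  rewrite /P -{2}[qd y x]powRr1 ?(ltW q0) // -powRD.
    by congr (_ `^ _); ring.
  by apply/implyP => _; rewrite gt_eqF.
have hE : hess (hpsi y) x = (- s * (qd y x * P)) *: hess hqd x
   + (4 * s * (s + 1) * P) *: (w^T *m w).
  apply/matrixP => a b; rewrite !mxE big_ord1 !mxE /hpsi PE -/P /dqd wE; ring.
have dE : (fun c => dpsi y c x) =
  (fun c => (- s * (qd y x * P)) * dqd y c x + (4 * s * (s + 1) * P) * 0).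
  by apply: boolp.funext => c; rewrite mulr0 addr0 /dpsi PE.
rewrite hE dE LopD !LopZ Lop_qd.
have -> : Lop A B (w^T *m w) (fun=> 0) = bf A w w.
  rewrite /Lop big1 ?addr0 => [|c _]; last by rewrite mul0r.
  by rewrite mulmxA mxtrace_mulC mulmxA /mxtrace big_ord1.
rewrite wE; set X := 2 * _ in H *.
rewrite (_ : _ + _ = s * P * (4 * (s + 1) * bf A w w - qd y x * X)); last by ring.
by rewrite mulr_ge0 ?subr_ge0 // mulr_ge0.
Qed.

End Operator.

(** * Comparison with a sum of barriers *)

Section Comparison.
Context {R : realType} {m : nat}.
Local Notation rV := 'rV[R]_m.

Variables (U : set rV) (xc : rV) (r0 c2 : R) (Q : 'M[R]_m) (A : rV -> 'M[R]_m)
  (B : rV -> 'I_m -> R) (s : R).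
Hypothesis Uo : open U.
Hypothesis cubeU : forall x, `|x - xc| <= r0 -> U x.
Hypothesis Qsym : Q^T = Q.
Hypothesis c20 : 0 <= c2.
Hypothesis Qc2 : forall v, bf Q v v <= c2 * `|v| ^+ 2.
Hypothesis Asym : forall x, `|x - xc| <= r0 -> (A x)^T = A x.
Hypothesis Apos : forall x, `|x - xc| <= r0 -> pdf (A x).
Hypothesis s0 : 0 <= s.
Hypothesis r00 : 0 < r0.
Hypothesis AQ1 : forall x z : rV, `|x - xc| <= r0 -> `|z| <= 2 * r0 ->
  1 <= 2 * (\tr (A x *m Q) + \sum_c (z *m Q) 0 c * B x c).
Hypothesis AQ2 : forall x z : rV, `|x - xc| <= r0 -> `|z| <= 2 * r0 ->
  bf Q z z * (2 * (\tr (A x *m Q) + \sum_c (z *m Q) 0 c * B x c))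
    <= 4 * (s + 1) * bf (A x) (z *m Q) (z *m Q).

Variables (f : rV -> R) (df : 'I_m -> rV -> R) (hf : 'I_m -> 'I_m -> rV -> R).
Hypothesis fC : C2on U f df hf.

(* The sum of the [psi] is a subsolution off the poles, and the quadratic term
   absorbs the defect [lam] of the supersolution [S - f]. *)
Lemma comparison (I : finType) (y : I -> rV) (rho lam t tau S : R) :
  0 <= t -> 0 <= lam -> 0 < rho ->
  (forall i, `|y i - xc| <= r0) ->
  (forall x, `|x - xc| <= r0 -> - lam < Lop (A x) (B x) (hess hf x) (df^~ x)) ->
  (forall x, `|x - xc| <= r0 -> f x <= S) ->
  (forall x i, `|x - xc| = r0 -> psi Q s (y i) x <= tau) ->
  (forall x i, `|x - xc| <= r0 -> qd Q (y i) x = rho ->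
     (forall j, rho <= qd Q (y j) x) ->
     t * \sum_j (psi Q s (y j) x - tau) <= S - f x) ->
  forall x, `|x - xc| <= r0 -> (forall j, rho <= qd Q (y j) x) ->
    t * \sum_j (psi Q s (y j) x - tau)
      <= S - f x + lam * (c2 * r0 ^+ 2 - qd Q xc x).
Proof.
move=> t0 lam0 rho0 yc Lf fS psi_out psi_in x1 x1c x1q.
pose h x := S + (-1) * f x + lam * (c2 * r0 ^+ 2 + (-1) * qd Q xc x)
   + (- t) * (\sum_j (psi Q s (y j) x + - tau)).
pose dh a x := 0 + (-1) * df a x + lam * (0 + (-1) * dqd Q xc a x)
   + (- t) * (\sum_j (dpsi Q s (y j) a x + 0)).
pose hh a b x := 0 + (-1) * hf a b x + lam * (0 + (-1) * hqd Q a b x)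
   + (- t) * (\sum_j (hpsi Q s (y j) a b x + 0)).
(* The poles are removed, since [psi] is C^2 only where q > 0. *)
pose V : set rV := [set x | U x /\ forall j, 0 < qd Q (y j) x].
have qcts j x : {for x, continuous (qd Q (y j))}.
  exact: (C1_cts openT (proj1 (C2on_qd Qsym (y j) openT))).
have Vo : open V.
  rewrite openE => x [Ux qx]; apply/nearVP.
  have [r1 r10 rU] := open_ballV Uo Ux.
  have : \forall z \near x, forall j, 0 < qd Q (y j) z.
    apply: near_forallV => j.
    have := proj1 (cts_atP _ _) (qcts j x) _ (divr_gt0 (qx j) (ltr0Sn _ 1)).
    apply: nearS => z; rewrite ler_norml => /andP[_ h1].
    have := qx j; lra.
  move=> /nearVP[r2 r20 hq]; exists (Num.min r1 r2); first by rewrite lt_min r10.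
  by move=> z; rewrite lt_min => /andP[z1 z2]; split; [exact: rU|exact: hq].
have VU : V `<=` U by move=> x [].
have hC : C2on V h dh hh.
  have psC j : C2on V (psi Q s (y j)) (dpsi Q s (y j)) (hpsi Q s (y j)).
    by apply: C2on_psi => // x [_]; apply.
  have qC := C2on_qd Qsym xc Vo.
  split.
    apply: C1on_add; last first.
      apply: C1on_scale; apply: C1on_sum => j; apply: C1on_add; last exact: C1on_cst.
      exact: (proj1 (psC j)).
    apply: C1on_add.
      apply: C1on_add; first exact: C1on_cst.
      apply: C1on_scale; exact: C1on_sub VU (proj1 fC).
    apply: C1on_scale; apply: C1on_add; first exact: C1on_cst.
    by apply: C1on_scale; exact: (proj1 qC).
  move=> b; apply: C1on_add; last first.
    apply: C1on_scale; apply: C1on_sum => j; apply: C1on_add; last exact: C1on_cst.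
    exact: (proj2 (psC j)).
  apply: C1on_add.
    apply: C1on_add; first exact: C1on_cst.
    by apply: C1on_scale; apply: C1on_sub VU _; exact: (proj2 fC).
  apply: C1on_scale; apply: C1on_add; first exact: C1on_cst.
  by apply: C1on_scale; exact: (proj2 qC).
pose K : set rV := [set x | `|x - xc| <= r0 /\ forall j, rho <= qd Q (y j) x].
have KV x : K x -> V x.
  by move=> [xr xq]; split; [exact: cubeU|move=> j; exact: lt_le_trans (xq j)].
have Kc : closed K.
  move=> x clx; split.
    rewrite leNgt; apply/negP => xr.
    have e0 : 0 < `|x - xc| - r0 by rewrite subr_gt0.
    have nb : \forall z \near x, `|z - x| < `|x - xc| - r0.
      by apply/nearVP; exists (`|x - xc| - r0).
    have [z [[zr _] zx]] := clx _ nb.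
    have := ler_distD z x xc; rewrite (distrC x z); lra.
  move=> j; rewrite leNgt; apply/negP => xq.
  have e0 : 0 < (rho - qd Q (y j) x) / 2 by rewrite divr_gt0 // subr_gt0.
  have := proj1 (cts_atP _ _) (qcts j x) _ e0 => nz.
  have [z [[_ zq] zx]] := clx _ nz.
  have := zq j; move: zx; rewrite ler_norml => /andP[h1 _]; lra.
have Kb x : K x -> `|x| <= r0 + `|xc|.
  move=> [xr _]; rewrite -(subrK xc x); apply: le_trans (ler_normD _ _) _.
  by rewrite lerD2r.
have [x Kx xmin] := @closed_min _ _ K h (r0 + `|xc|) (ex_intro _ x1 (conj x1c x1q)) Kc
  Kb
  (fun x Kx => C1_cts Vo (proj1 hC) (KV x Kx)).
have qle z : `|z - xc| <= r0 -> 0 <= lam * (c2 * r0 ^+ 2 - qd Q xc z).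
  move=> zr; rewrite mulr_ge0 // subr_ge0; apply: le_trans (Qc2 _) _.
  by apply: ler_wpM2l => //; rewrite lerXn2r ?nnegrE // ltW.
suff hx : 0 <= h x.
  have := le_trans hx (xmin x1 (conj x1c x1q)).
  rewrite /h; lra.
(* A negative minimum is impossible on the boundary of the cube, where the barrier is at most 0, and
   where some q equals rho, by the last hypothesis. In the interior L h >= 0, while L f > - lam, L q
   >= 1 and L psi >= 0 give L h < 0. *)
have [//|hx] := leP 0 (h x); exfalso.
have hE z : h z = S - f z + lam * (c2 * r0 ^+ 2 - qd Q xc z)
   - t * (\sum_j (psi Q s (y j) z - tau)) by rewrite /h; ring.
have [xr xq] := Kx.
have xr' : `|x - xc| < r0.
  rewrite lt_neqAle xr andbT; apply/eqP => xe; move: hx.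
  rewrite hE ltNge => /negP; apply.
  have p1 : t * (\sum_j (psi Q s (y j) x - tau)) <= 0.
    rewrite mulr_ge0_le0 // sumr_le0 // => j _; rewrite subr_le0; exact: psi_out.
  have := qle x xr; have := fS x xr; lra.
have xq' j : rho < qd Q (y j) x.
  rewrite lt_neqAle xq andbT; apply/eqP => xe; move: hx.
  rewrite hE ltNge => /negP; apply.
  have := psi_in x j xr (esym xe) xq; have := qle x xr; lra.
have nearmin : \forall z \near x, h x <= h z.
  have n1 : \forall z \near x, forall j, rho <= qd Q (y j) z.
    apply: near_forallV => j.
    have e0 : 0 < qd Q (y j) x - rho by rewrite subr_gt0.
    have := proj1 (cts_atP _ _) (qcts j x) _ e0.
    by apply: nearS => z; rewrite ler_norml => /andP[_]; lra.
  have n2 : \forall z \near x, `|z - xc| <= r0.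
    apply/nearVP; exists (r0 - `|x - xc|); first by rewrite subr_gt0.
    by move=> z zx; have := ler_distD x z xc; lra.
  by apply: nearS (nearI n1 n2) => z [z1 z2]; apply: xmin.
have := Lop_min (B x) Vo hC (KV x Kx) nearmin (Asym xr) (Apos xr).
have -> : hess hh x = (-1) *: hess hf x + (lam *: ((-1) *: hess (hqd Q) x)
    + (- t) *: (\sum_j hess (hpsi Q s (y j)) x)).
  apply/matrixP => a b; rewrite !mxE summxE /hh !add0r -addrA; congr (_ + (_ + _ * _)).
  by apply: eq_bigr => j _; rewrite addr0 mxE.
have -> : dh^~ x = (fun c => (-1) * df c x + (lam * ((-1) * dqd Q xc c x)
    + (- t) * (\sum_j dpsi Q s (y j) c x))).
  apply: boolp.funext => c; rewrite /dh !add0r -addrA; congr (_ + (_ + _ * _)).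
  by apply: eq_bigr => j _; rewrite addr0.
rewrite !LopD !LopZ Lop_sum Lop_qd.
have l1 := Lf x xr.
have l2 : 1 <= 2 * (\tr (A x *m Q) + \sum_c ((x - xc) *m Q) 0 c * B x c).
  by apply: AQ1 => //; apply: le_trans xr _; rewrite ler_peMl ?ler1n // ltW.
have l3 : 0 <= \sum_j Lop (A x) (B x) (hess (hpsi Q s (y j)) x) (fun c => dpsi Q s (y j) c x).
  apply: sumr_ge0 => j _; apply: Lop_psi_ge0 => //; first exact: lt_trans (xq' j).
  apply: AQ2 => //; have := ler_distD xc x (y j).
  by have := yc j; rewrite (distrC xc); lra.
have l4 : lam * 1 <= lam * (2 * (\tr (A x *m Q) + \sum_c ((x - xc) *m Q) 0 c * B x c)).
  exact: ler_wpM2l.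
have l5 := mulr_ge0 t0 l3.
lra.
Qed.

End Comparison.

(** * Sums over separated points *)

Section Packing.
Context {R : realType}.

(** Sign and magnitude, [Negz n] standing for - (n + 1): then the magnitude of floor u is at most
    |u| for either sign, and cells of bounded magnitude form a finite type. *)
Definition cell_ix (t : int) : bool * nat := match t with Posz n => (false, n) | Negz n => (true, n) end.

Lemma cell_ix_inj : injective cell_ix.
Proof. by move=> [n|n] [k|k] //= [->]. Qed.

Lemma cell_ix_le (u : R) : ((cell_ix (Num.floor u)).2)%:R <= `|u|.
Proof.
have := floor_le u; have := floorD1_gt u.
case: (Num.floor u) => n /=.
  by move=> _ h; apply: le_trans h _; exact: ler_norm.
rewrite NegzE => h1 _; rewrite -normrN; apply: le_trans (ler_norm _).
have -> : n%:R = - ((- n.+1%:Z + 1)%:~R) :> R.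
  by rewrite -addn1 PoszD opprD addrNK mulrNz opprK.
by rewrite lerN2 ltW.
Qed.

Lemma sum_inj_le (I J : finType) (c : I -> J) (F : J -> R) : injective c ->
  (forall j, 0 <= F j) -> \sum_i F (c i) <= \sum_j F j.
Proof.
move=> cinj F0.
rewrite [leRHS](bigID (fun j => j \in c @: finset.setTfor I)) /=.
rewrite -[leLHS]addr0 lerD ?sumr_ge0 // big_imset /=; last by move=> i j _ _; exact: cinj.
by rewrite le_eqVlt; apply/orP; left; apply/eqP; apply: eq_bigl => i; rewrite inE.
Qed.

Lemma sum_leq_le T k : (\sum_(n < T) (n <= k)%N <= k.+1)%N.
Proof.
suff: (\sum_(n < T) (n <= k)%N <= minn T k.+1)%N by move/leq_trans; apply; exact: geq_minr.
elim: T => [|T IH]; rewrite ?big_ord0 // big_ord_recr /=.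
by move: (\sum_(n < T) (n <= k))%N IH => S IH; case: (leqP T k) => Tk /=; lia.
Qed.

Variable m : nat.
Local Notation rV := 'rV[R]_m.

(** Sort the cells by a coordinate j attaining the maximum and by its value d0. The other m - 1
    coordinates have at most 2 (d0 + 1) choices each, which the weight cancels up to 2^(m-1); there
    are m choices of j and 2 T of d0. *)
Lemma lattice_sum T : (0 < m)%N ->
  \sum_(c : {ffun 'I_m -> bool * 'I_T}) ((\max_a (c a).2).+1%:R : R) ^- m.-1
    <= (m * 2 ^ m * T)%:R.
Proof.
move=> m0.
pose D : finType := (bool * 'I_T)%type.
(* The condition that coordinate j equals d0 and dominates the others, as a product over
   coordinates, so that the sum over all cells factors. *)
pose F (j : 'I_m) (d0 : D) (a : 'I_m) (d : D) : R :=
  if a == j then (d == d0)%:R else (d.2 <= d0.2)%:R.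
pose G (j : 'I_m) (d0 : D) (c : {ffun 'I_m -> D}) : R :=
  (d0.2.+1%:R) ^- m.-1 * \prod_a F j d0 a (c a).
have F0 j d0 a d : 0 <= F j d0 a d by rewrite /F; case: ifP.
have G0 j d0 c : 0 <= G j d0 c.
  by rewrite mulr_ge0 ?invr_ge0 ?exprn_ge0 //; apply: prodr_ge0.
apply: (@le_trans _ _ (\sum_c \sum_j \sum_d0 G j d0 c)).
  apply: ler_sum => c _.
  have [j jE] : exists j : 'I_m, \max_a (c a).2 = (c j).2.
    have m0' : (0 < #|'I_m|)%N by rewrite card_ord.
    by have [j ->] := bigop.eq_bigmax (fun a => (c a).2 : nat) m0'; exists j.
  apply: (@le_trans _ _ (G j (c j) c)); last first.
    rewrite (bigD1 j) //= -[leLHS]addr0 lerD //; last first.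
      by apply: sumr_ge0 => i _; exact: sumr_ge0.
    by rewrite (bigD1 (c j : D)) //= lerDl sumr_ge0.
  rewrite /G jE big1 ?mulr1 // => a _; rewrite /F.
  have [->|aj] := eqVneq a j; first by rewrite eqxx.
  by rewrite -jE (leq_bigmax (F := fun a => (c a).2 : nat)).
rewrite exchange_big /=.
apply: (@le_trans _ _ (\sum_(j < m) (2 ^ m * T)%:R)); last first.
  by rewrite sumr_const card_ord -mulrnA ler_nat [leqLHS]mulnC mulnA.
apply: ler_sum => j _; rewrite exchange_big /=.
apply: (@le_trans _ _ (\sum_(d0 : D) (2 ^ m.-1)%:R)); last first.
  rewrite sumr_const card_prod card_bool card_ord -mulrnA ler_nat.
  by rewrite mulnA [(_ * 2)%N]mulnC -expnS prednK.
apply: ler_sum => d0 _; rewrite /G -mulr_sumr -(bigA_distr_bigA (fun a d => F j d0 a d)).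
rewrite (bigD1 j) //= {1}/F eqxx (bigD1 d0) //= eqxx big1 ?addr0 ?mul1r; last first.
  by move=> d /negbTE ->.
rewrite ler_pdivrMl ?exprn_gt0 //.
have cnt : \sum_(d : D) ((d.2 <= d0.2)%N%:R : R) <= (2 * d0.2.+1)%:R.
  rewrite (eq_bigr (fun d : D => (fun b (n : 'I_T) => (n <= d0.2)%N%:R) d.1 d.2)) //.
  rewrite -(pair_bigA _ (fun b (n : 'I_T) => (n <= d0.2)%N%:R : R)) /=.
  rewrite sumr_const card_bool -[leLHS]mulr_natl natrM ler_wpM2l // -natr_sum ler_nat.
  exact: sum_leq_le.
apply: (@le_trans _ _ (\prod_(a < m | a != j) (2 * d0.2.+1)%:R)).
  apply: ler_prod => a aj; rewrite /F (negbTE aj) sumr_ge0 //=.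
rewrite prodr_const cardC1 card_ord -natrX -natrX -natrM ler_nat.
by rewrite expnMn mulnC.
Qed.

Lemma norm_lt_coord (x : rV) c : 0 < c -> (forall a, `|x 0 a| < c) -> `|x| < c.
Proof.
move=> c0 xc; rewrite [ltLHS]/Num.norm /= mx_normrE.
by apply/bigmax_ltP; split => // -[i a] _ /=; rewrite ord1.
Qed.

(* With radius [r] fixed the sum is O(h^-m), as for the integral of |z|^-(m-1)
   over a ball divided by the volume h^m of a cell. *)
Lemma packing_sum (I : finType) (y : I -> rV) (x : rV) (h r : R) :
  (0 < m)%N -> 0 < h -> 0 <= r -> (forall i, `|y i - x| <= r) ->
  (forall i j, i != j -> h <= `|y i - y j|) ->
  \sum_i (Num.max `|y i - x| h) ^- m.-1
    <= (m * 2 ^ m)%:R * (r / h + 1) * (2 / h) ^+ m.-1.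
Proof.
move=> m0 h0 r0 yr ysep.
pose T := (Num.trunc (r / h)).+1.
have rh0 : 0 <= r / h by rewrite divr_ge0 // ltW.
pose u i a : R := (y i - x) 0 a / h.
pose N i a := (cell_ix (Num.floor (u i a))).2.
have Nu i a : (N i a)%:R <= `|(y i - x) 0 a| / h.
  by apply: le_trans (cell_ix_le _) _; rewrite normrM normfV (gtr0_norm h0).
have NT i a : (N i a < T)%N.
  rewrite ltnS truncn_ge_nat //; apply: le_trans (Nu i a) _.
  by rewrite ler_pM2r ?invr_gt0 // (le_trans (coord_le_norm _ _)).
pose c i : {ffun 'I_m -> bool * 'I_T} :=
  [ffun a => ((cell_ix (Num.floor (u i a))).1, inord (N i a))].
have cN i a : (c i a).2 = N i a :> nat by rewrite ffunE inordK.
(* Two points in one cell differ by less than h in every coordinate, hence in the sup norm. *)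
have cinj : injective c.
  move=> i j cij; apply/eqP; apply: contraT => ij.
  have := ysep i j ij; rewrite leNgt => /negP[].
  apply: norm_lt_coord => // a.
  have fij : Num.floor (u i a) = Num.floor (u j a).
    apply: cell_ix_inj; rewrite [LHS]surjective_pairing [RHS]surjective_pairing.
    have := congr1 (fun f : {ffun _} => f a) cij; rewrite !ffunE => -[-> _].
    by rewrite -/(N i a) -/(N j a) -!cN cij.
  have /andP[i1 i2] := floor_itv (u i a); have /andP[j1 j2] := floor_itv (u j a).
  rewrite fij in i1 i2; rewrite intrD in i2 j2.
  have : `|u i a - u j a| < 1 by rewrite ltr_norml; lra.
  rewrite /u -mulrBl normrM normfV (gtr0_norm h0) ltr_pdivrMr // mul1r.
  by rewrite !mxE opprB addrA subrK.
pose w (f : {ffun 'I_m -> bool * 'I_T}) : R := ((\max_a (f a).2).+1%:R) ^- m.-1.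
have w0 f : 0 <= w f by rewrite invr_ge0 exprn_ge0.
apply: (@le_trans _ _ (\sum_i w (c i) * (2 / h) ^+ m.-1)).
  apply: ler_sum => i _; rewrite /w.
  set M := Num.max _ _; set n := (\max_a _)%N.
  (* From M >= h and M >= n h follows (n + 1) h <= 2 M; this is where 2 / h comes from. *)
  have hM : h <= M by rewrite le_max lexx orbT.
  have dM : `|y i - x| <= M by rewrite le_max lexx.
  have nM : n%:R * h <= M.
    have m0' : (0 < #|'I_m|)%N by rewrite card_ord.
    have [a aE] := bigop.eq_bigmax (fun a => (c i a).2 : nat) m0'.
    rewrite /n aE cN -ler_pdivlMr //; apply: le_trans (Nu i a) _.
    by rewrite ler_pM2r ?invr_gt0 // (le_trans (coord_le_norm _ _)).
  have M0 : 0 < M by exact: lt_le_trans hM.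
  have n0 : 0 < n.+1%:R :> R by [].
  rewrite -exprVn -exprVn -exprMn; apply: lerXn2r; rewrite ?nnegrE.
  - by rewrite invr_ge0 ltW.
  - by rewrite mulr_ge0 ?invr_ge0 // divr_ge0 // ltW.
  rewrite mulrA -[_ * 2]mulrC -mulrA -invfM -[leLHS]mul1r ler_pdivrMr //.
  rewrite mulrAC ler_pdivlMr ?mulr_gt0 // mul1r.
  by rewrite -natr1; lra.
rewrite -mulr_suml; apply: ler_wpM2r; first by rewrite exprn_ge0 // divr_ge0 // ltW.
apply: le_trans (sum_inj_le cinj w0) _; apply: le_trans (lattice_sum T m0) _.
rewrite natrM; apply: ler_wpM2l => //.
by rewrite /T -natr1 lerD2r truncn_le.
Qed.

End Packing.

Section PowR.
Context {R : realType}.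

Lemma powR_anti (a b p : R) : 0 < a -> a <= b -> 0 <= p -> b `^ (- p) <= a `^ (- p).
Proof.
move=> a0 ab p0; have b0 := lt_le_trans a0 ab.
rewrite !powRN lef_pV2 ?posrE ?powR_gt0 //.
by apply: ge0_ler_powR; rewrite ?nnegrE ?(ltW a0) ?(ltW b0).
Qed.

Lemma powR_anti_lt (a b p : R) : 0 < a -> a < b -> 0 < p -> b `^ (- p) < a `^ (- p).
Proof.
move=> a0 ab p0; have b0 := lt_trans a0 ab.
rewrite !powRN ltf_pV2 ?posrE ?powR_gt0 //.
by apply: gt0_ltr_powR; rewrite ?nnegrE ?(ltW a0) ?(ltW b0).
Qed.

Lemma powR_sqr_half (x p : R) k : 0 <= x -> 2 * p = k%:R -> (x ^+ 2) `^ (- p) = x ^- k.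
Proof.
by move=> x0 pk; rewrite powRN -powR_mulrn // -powRrM pk powR_mulrn.
Qed.

End PowR.

(** * Growth of supersolutions *)

Section Slopes.
Context {R : realType} {m : nat}.
Local Notation rV := 'rV[R]_m.

Lemma compact_cube (xc : rV) (r : R) : compact [set x | `|x - xc| <= r].
Proof.
apply: bounded_closed_compact.
  exists (r + `|xc|); split; first exact: num_real.
  move=> N MN x /= xr; apply: le_trans (ltW MN); rewrite -(subrK xc x).
  by apply: le_trans (ler_normD _ _) _; rewrite lerD2r.
move=> x clx /=; rewrite leNgt; apply/negP => xr.
have e0 : 0 < `|x - xc| - r by rewrite subr_gt0.
have nb : \forall z \near x, `|z - x| < `|x - xc| - r.
  by apply/nearVP; exists (`|x - xc| - r).
have [z [/= zr zx]] := clx _ nb.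
have := ler_distD z x xc; rewrite (distrC x z); lra.
Qed.

(** Uniform continuity of finitely many functions along K, through the near-covering form of
    compactness with the radius d tending to 0 from the right. *)
Lemma uniform_on_compact (K U : set rV) (I : finType) (F : I -> rV -> R) (e : R) :
  compact K -> open U -> K `<=` U -> (forall i x, U x -> {for x, continuous (F i)}) ->
  0 < e -> exists2 d : R, 0 < d & forall x y, K x -> `|y - x| <= d ->
    U y /\ forall i, `|F i y - F i x| <= e.
Proof.
move=> /compact_near_coveringP Kc Uo KU Fc e0.
pose P (d : R) (x : rV) := forall y, `|y - x| <= d -> U y /\ forall i, `|F i y - F i x| <= e.
have e2 : 0 < e / 2 by rewrite divr_gt0.
have PR : ProperFilter ((0 : R)^'+) by exact: at_right_proper_filter.
have Hcov x : K x -> \forall z \near x & d \near ((0 : R)^'+), P d z.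
  move=> Kx.
  have nx : \forall y \near x, forall i, `|F i x - F i y| <= e / 2.
    by apply: near_forallV => i; apply/(proj1 (cts_atP _ _)) => //; apply: Fc; exact: KU.
  have [r1 r10 h1] := proj1 (nearVP _ _) nx.
  have [r2 r20 h2] := open_ballV Uo (KU _ Kx).
  pose r := Num.min r1 r2.
  have r0 : 0 < r by rewrite lt_min r10.
  exists ([set z | `|z - x| < r / 2], [set d | d < r / 2]); first split.
  - by apply/nearVP; exists (r / 2); rewrite ?divr_gt0.
  - by apply: nbhs_right_lt; rewrite divr_gt0.
  - move=> [z d] [/= zx dr] y yz.
    have yx : `|y - x| < r by have := ler_distD z y x; lra.
    have zr : `|z - x| < r by lra.
    move: yx zr; rewrite !lt_min => /andP[y1 y2] /andP[z1 z2].
    split=> [|i]; first exact: h2.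
    have := h1 y y1 i; have := h1 z z1 i; have := ler_distD (F i x) (F i y) (F i z).
    rewrite (distrC (F i y) (F i x)); lra.
have H := Kc R _ P _ Hcov.
have Hpos : \forall d \near ((0 : R)^'+), 0 < d by exact: nbhs_right_gt.
have [d [/= dP d0]] := @filter_ex _ _ PR _ (filterI (H _) Hpos).
by exists d => // x y Kx; exact: dP.
Qed.

Lemma bf1 (v : rV) : bf 1%:M v v = \sum_a v 0 a ^+ 2.
Proof. by rewrite /bf mulmx1 mxE; apply: eq_bigr => a _; rewrite mxE expr2. Qed.

Lemma bf1_ge (v : rV) : `|v| ^+ 2 <= bf 1%:M v v.
Proof.
have b0 : 0 <= bf 1%:M v v by rewrite bf1 sumr_ge0 // => a _; exact: sqr_ge0.
rewrite -(sqr_sqrtr b0) ler_pXn2r ?nnegrE ?sqrtr_ge0 //.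
apply: norm_le_coord => [|a]; first exact: sqrtr_ge0.
rewrite -sqrtr_sqr; apply: ler_wsqrtr; rewrite bf1 (bigD1 a) //= lerDl.
by apply: sumr_ge0 => b _; exact: sqr_ge0.
Qed.

(* Alexandrov-Bakelman-Pucci without measure theory: the slopes in a grid of
   step [eta] are attained at points of the contact set, where the Hessian is
   bounded, so that these points are [h]-separated for [h] comparable to [eta]. *)
Lemma contact_points (U : set rV) (f : rV -> R) df hf (x0 : rV) (r eps C1 hmax : R) :
  (0 < m)%N -> open U -> C2on U f df hf -> 0 < r -> (forall x, `|x - x0| <= r -> U x) ->
  (forall x, `|x - x0| <= r -> f x0 <= f x) -> 0 < eps -> eps * r ^+ 2 <= 1 -> 0 <= C1 ->
  0 < hmax ->
  (forall x, `|x - x0| <= r -> (forall a, `|df a x| <= 3 * eps * r) ->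
     psd (hess hf x + (2 * eps) *: 1%:M) -> forall a b, `|hf a b x| <= C1) ->
  exists (I : finType) (y : I -> rV) (h : R),
    [/\ 0 < h <= hmax, forall i, `|y i - x0| <= r,
        forall i j, i != j -> h <= `|y i - y j|,
        (eps * r / (m%:R * (m%:R * (C1 + 1) + 2 * eps))) ^+ m <= #|I|%:R * h ^+ m &
        forall i x, `|x - y i| <= h -> f x <= f x0 + 2].
Proof.
move=> m0 Uo fC r0 cubeU x0min eps0 epsr C10 hmax0 contact.
pose Kc : set rV := [set x | `|x - x0| <= r].
have KU : Kc `<=` U by move=> x; exact: cubeU.
(* [None] stands for f itself, whose modulus gives the last conclusion; the second derivatives serve
   to control the Hessian between nearby contact points. *)
pose F (i : option ('I_m * 'I_m)) := if i is Some p then hf p.1 p.2 else f.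
have Fcts i x : U x -> {for x, continuous (F i)}.
  case: i => [[a b]|] Ux; last exact: C1_cts Uo (proj1 fC) Ux.
  by have [_ ] := proj2 fC b x Ux a.
have [d d0 unif] := @uniform_on_compact Kc U _ F 1 (@compact_cube x0 r) Uo KU Fcts ltr01.
have mR : 0 < m%:R :> R by rewrite ltr0n.
pose L := m%:R * (C1 + 1) + 2 * eps.
have L0 : 0 < L by rewrite ltr_wpDl ?mulr_ge0 ?addr_ge0 ?mulr_gt0.
pose q := eps * r / (m%:R * L).
have q0 : 0 < q by rewrite divr_gt0 ?mulr_gt0.
pose e := Num.min d hmax.
have e0 : 0 < e by rewrite lt_min d0.
(* T is large enough that h = q / T is below both d and hmax. Since T h = q exactly, the T^m slopes
   give N h^m = q^m however small d is. *)
pose T := (Num.trunc (q / e)).+1.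
pose h := q / T%:R.
have T0 : 0 < T%:R :> R by rewrite ltr0n.
have h0 : 0 < h by rewrite divr_gt0.
have he : h <= e.
  rewrite ler_pdivrMr // mulrC -ler_pdivrMr //; apply: ltW.
  by rewrite /T; exact: truncnS_gt.
move: (he); rewrite le_min => /andP[hd hh].
(* L bounds the Lipschitz constant of the map from contact points to slopes, so slopes eta apart
   belong to points at least h apart. *)
pose eta := h * L.
have eta0 : 0 < eta by rewrite mulr_gt0.
pose p (z : {ffun 'I_m -> 'I_T}) : rV := \row_a (eta * (z a)%:R).
(* The left side bounds the l^1 norm of every slope; keeping it at eps r lets the paraboloid win on
   the boundary of the cube. *)
have etaT : m%:R * (eta * T%:R) = eps * r.
  by rewrite /eta /h /q; field; rewrite !gt_eqF.
have pT z a : `|p z 0 a| <= eta * T%:R.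
  rewrite mxE normrM (gtr0_norm eta0) normr_nat ler_pM2l // ler_nat.
  exact: ltnW.
have pTs z a : `|p z 0 a| < eta * T%:R.
  rewrite mxE normrM (gtr0_norm eta0) normr_nat ltr_pM2l // ltr_nat.
  exact: ltn_ord.
have etaT1 : eta * T%:R <= eps * r.
  rewrite -etaT; apply: ler_peMl; last by rewrite ler1n.
  exact: ltW (mulr_gt0 eta0 T0).
pose lin z (x : rV) := \sum_a p z 0 a * (x 0 a + - x0 0 a).
have lin_lt z x : x != x0 -> `|lin z x| < eps * r * `|x - x0|.
  move=> xx0; have nx : 0 < `|x - x0| by rewrite normr_gt0 subr_eq0.
  apply: le_lt_trans (ler_norm_sum _ _ _) _.
  apply: (@lt_le_trans _ _ (\sum_(a < m) (eta * T%:R * `|x - x0|))); last first.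
    by rewrite sumr_const card_ord -[leLHS]mulr_natl mulrA etaT.
  apply: ltr_sum => [|a _]; first by apply/hasP; exists (Ordinal m0); rewrite ?mem_index_enum.
  rewrite normrM; apply: le_lt_trans (_ : `|p z 0 a| * `|x - x0| < _).
    apply: ler_wpM2l => //; have := coord_le_norm (x - x0) a; by rewrite !mxE.
  by rewrite ltr_pM2r.
have lin_le z x : `|x - x0| <= r -> `|lin z x| <= eps * r * r.
  move=> xr; have [->|xx0] := eqVneq x x0.
    rewrite /lin big1 => [|a _]; last by rewrite subrr mulr0.
    by rewrite normr0 !mulr_ge0 // ltW.
  apply: le_trans (ltW (lin_lt z x xx0)) _; apply: ler_wpM2l => //.
  by rewrite mulr_ge0 // ltW.
(* At a minimum of [G z], a hyperplane of slope [p z] touches f + eps |x - x0|^2 from below. *)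
pose G z x := f x + eps * qd 1%:M x0 x + (-1) * lin z x.
pose dG z a x := df a x + eps * dqd 1%:M x0 a x + (-1) * (p z 0 a).
pose hG a b x := hf a b x + eps * hqd 1%:M a b x + (-1) * 0.
have GC z : C2on U (G z) (dG z) hG.
  have [qC1 qC2] := C2on_qd (trmx1 R m) x0 Uo; split.
    apply: C1on_add; first by apply: C1on_add; [exact: (proj1 fC)|exact: C1on_scale].
    apply: C1on_scale; rewrite /lin.
    have -> : (fun a (_ : rV) => p z 0 a) =
       (fun a (_ : rV) => \sum_b p z 0 b * ((a == b)%:R + 0)).
      apply: boolp.funext => a; apply: boolp.funext => x.
      rewrite (bigD1 a) //= eqxx addr0 mulr1 big1 ?addr0 // => b ba.
      by rewrite eq_sym (negbTE ba) addr0 mulr0.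
    apply: C1on_sum => b; apply: C1on_scale; apply: C1on_add; last exact: C1on_cst.
    exact: C1on_coord.
  move=> b; apply: C1on_add; last by apply: C1on_scale; exact: C1on_cst.
  by apply: C1on_add; [exact: (proj2 fC)|apply: C1on_scale; exact: qC2].
have ex z : exists x, [/\ `|x - x0| <= r, forall a, dG z a x = 0, psd (hess hG x) &
    f x <= f x0 + 1].
  have Kclosed : closed Kc by apply: compact_closed; [exact: norm_hausdorff|exact: compact_cube].
  have Kx0 : Kc x0 by rewrite /Kc /= subrr normr0 ltW.
  have Kb x : Kc x -> `|x| <= r + `|x0|.
    rewrite /Kc /= => xr; rewrite -{1}(subrK x0 x).
    by apply: le_trans (ler_normD _ _) _; rewrite lerD2r.
  have [x Kx xmin] := @closed_min _ _ Kc (G z) (r + `|x0|) (ex_intro _ x0 Kx0) Kclosed Kb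
    (fun x Kx => C1_cts Uo (proj1 (GC z)) (KU x Kx)).
  have Gx0 : G z x0 = f x0.
    rewrite /G /qd subrr /bf !mul0mx mxE mulr0 addr0 /lin big1 ?mulr0 ?addr0 //.
    by move=> a _; rewrite subrr mulr0.
  have Gx := xmin x0 Kx0; rewrite Gx0 in Gx.
  (* On the boundary the paraboloid is at least eps r^2, as the Euclidean norm dominates the sup
     norm, while the linear term is strictly smaller and f >= f(x0). *)
  have xlt : `|x - x0| < r.
    rewrite lt_neqAle Kx andbT; apply/eqP => xr.
    have xx0 : x != x0 by rewrite -subr_eq0 -normr_eq0 xr gt_eqF.
    have := lin_lt z x xx0; rewrite xr; have := bf1_ge (x - x0); rewrite xr => q1.
    have := x0min x Kx; have := ler_norm (lin z x); move: Gx; rewrite /G /qd.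
    have : eps * r * r <= eps * bf 1%:M (x - x0) (x - x0).
      by rewrite -mulrA ler_pM2l // -expr2.
    lra.
  have nmin : \forall y \near x, G z x <= G z y.
    apply/nearVP; exists (r - `|x - x0|); first by rewrite subr_gt0.
    by move=> y yx; apply: xmin; rewrite /Kc /=; have := ler_distD x y x0; lra.
  exists x; split.
  - exact: Kx.
  - exact: C1_min Uo (proj1 (GC z)) (KU _ Kx) nmin.
  - exact: C2_min_psd Uo (GC z) (KU _ Kx) nmin.
  - have q1 : 0 <= qd 1%:M x0 x by apply: le_trans (bf1_ge _); exact: sqr_ge0.
    have := mulr_ge0 (ltW eps0) q1.
    have := lin_le z x Kx; have := ler_norm (lin z x); move: Gx epsr; rewrite /G expr2; lra.
have [y yP] := boolp.choice ex.
have dfy z a : df a (y z) = p z 0 a - 2 * eps * (y z - x0) 0 a.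
  have [_ /(_ a) + _ _] := yP z; rewrite /dG /dqd mulmx1; lra.
have hy z a b : `|hf a b (y z)| <= C1.
  have [yr _ yh _] := yP z; apply: contact => // [c|].
    rewrite dfy; apply: le_trans (ler_normB _ _) _; rewrite normrM.
    have := coord_le_norm (y z - x0) c; have := pT z c.
    rewrite (@ger0_norm _ (2 * eps)) ?mulr_ge0 ?(ltW eps0) //.
    set nc := `|(y z - x0) 0 c| => h1 h2.
    have : 2 * eps * nc <= 2 * eps * r.
      by apply: ler_wpM2l; [rewrite mulr_ge0 // ltW|exact: le_trans h2 yr].
    lra.
  have -> : hess hf (y z) + (2 * eps) *: 1%:M = hess hG (y z) => //.
  by apply/matrixP => a' b'; rewrite !mxE /hG /hqd mxE; ring.
exists {ffun 'I_m -> 'I_T}, y, h; split.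
- by rewrite h0.
- by move=> z; have [] := yP z.
- move=> z z' zz'; rewrite leNgt; apply/negP => yy.
  have [a za] : exists a, z a != z' a.
    apply/existsP; rewrite -negb_forall; apply: contraNN zz' => /forallP zz.
    by apply/eqP/ffunP => a; apply/eqP.
  have [yr _ _ _] := yP z; have [yr' _ _ _] := yP z'.
  have pp : eta <= `|p z 0 a - p z' 0 a|.
    rewrite !mxE -mulrBr normrM (gtr0_norm eta0) ler_peMr ?(ltW eta0) //.
    case: (ltngtP (z a) (z' a)) za => [zlt _|zlt _|/val_inj -> /eqP//].
      by rewrite distrC -natrB ?(ltnW zlt) // normr_nat ler1n subn_gt0.
    by rewrite -natrB ?(ltnW zlt) // normr_nat ler1n subn_gt0.
  have seg (t : R) : `|t| <= 1 -> `|y z + t *: (y z' - y z) - y z| <= d.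
    move=> t1; rewrite addrC addKr normrZ distrC.
    by apply: le_trans (_ : `|y z - y z'| <= _); [rewrite ler_piMl|lra].
  have lip := @C1_lipschitz R m U (df a) (fun b => hf b a) (y z) (y z') (C1 + 1) Uo
     (proj2 fC a).
  have {}lip : `|df a (y z') - df a (y z)| <= m%:R * (C1 + 1) * `|y z' - y z|.
    apply: lip => t => [|b] t1; first by have [] := unif _ _ yr (seg t t1).
    have [_ /(_ (Some (b, a)))/= u1] := unif _ _ yr (seg t t1).
    have := hy z b a; have := ler_distD (hf b a (y z)) (hf b a (y z + t *: (y z' - y z))) 0.
    rewrite !subr0; lra.
  have pE : p z 0 a - p z' 0 a =
     - (df a (y z') - df a (y z)) + 2 * eps * (y z - y z') 0 a.
    by rewrite !dfy !mxE; ring.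
  have : eta <= (m%:R * (C1 + 1) + 2 * eps) * `|y z - y z'|.
    apply: le_trans pp _; rewrite pE; apply: le_trans (ler_normD _ _) _.
    rewrite normrN [leRHS]mulrDl; apply: lerD; first by rewrite (distrC (y z)).
    rewrite normrM ger0_norm ?mulr_ge0 ?(ltW eps0) //.
    apply: ler_wpM2l; first by rewrite mulr_ge0 // ltW.
    exact: coord_le_norm.
  rewrite -/L /eta [h * L]mulrC ler_pM2l //; lra.
- rewrite card_ffun !card_ord natrX -exprMn.
  by rewrite -/L -/q /h mulrC divfK ?gt_eqF.
- move=> z x xy; have [yr _ _ fy] := yP z.
  have [_ /(_ None)/= u1] := unif _ _ yr (le_trans xy hd).
  have := ler_norm (f x - f (y z)); lra.
Qed.

End Slopes.

(** * Spreading a lower bound from many points over a cube *)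

Section Spread.
Context {R : realType} {m : nat}.
Local Notation rV := 'rV[R]_m.

(* The numerator compares the values of q^-s at distance at most 2 r1 from a pole
   and on the boundary of the cube of radius r0. *)
Definition spread_const (c1 c2 r0 r1 s : R) : R :=
  ((4 * c2 * r1 ^+ 2) `^ (- s) - (c1 * (r0 - r1) ^+ 2) `^ (- s)) /
  (c1 `^ (- s) * ((m * 2 ^ m)%:R * 3 * 2 ^+ m.-1) * r0).

Lemma spread_const_gt0 (c1 c2 r0 r1 s : R) : (0 < m)%N -> 0 < c1 -> 0 < c2 -> 0 < r1 ->
  r1 < r0 -> 0 < s -> 4 * c2 * r1 ^+ 2 < c1 * (r0 - r1) ^+ 2 ->
  0 < spread_const c1 c2 r0 r1 s.
Proof.
move=> m0 c10 c20 r10 r1r0 s0 H; apply: divr_gt0.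
  by rewrite subr_gt0; apply: powR_anti_lt => //; rewrite !mulr_gt0 ?exprn_gt0.
have r00 := lt_trans r10 r1r0.
rewrite !mulr_gt0 ?powR_gt0 ?exprn_gt0 //.
by rewrite ltr0n muln_gt0 m0 expn_gt0.
Qed.

Variables (U : set rV) (xc : rV) (r0 r1 c1 c2 : R) (Q : 'M[R]_m) (A : rV -> 'M[R]_m)
  (B : rV -> 'I_m -> R) (s : R).
Hypothesis Uo : open U.
Hypothesis cubeU : forall x, `|x - xc| <= r0 -> U x.
Hypothesis Qsym : Q^T = Q.
Hypothesis c10 : 0 < c1.
Hypothesis c20 : 0 < c2.
Hypothesis Qc1 : forall v, c1 * `|v| ^+ 2 <= bf Q v v.
Hypothesis Qc2 : forall v, bf Q v v <= c2 * `|v| ^+ 2.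
Hypothesis Asym : forall x, `|x - xc| <= r0 -> (A x)^T = A x.
Hypothesis Apos : forall x, `|x - xc| <= r0 -> pdf (A x).
Hypothesis m0 : (0 < m)%N.
Hypothesis s0 : 0 < s.
Hypothesis sE : 2 * s = m.-1%:R.
Hypothesis r10 : 0 < r1.
Hypothesis r1r0 : r1 < r0.
Hypothesis r1_small : 4 * c2 * r1 ^+ 2 < c1 * (r0 - r1) ^+ 2.
Hypothesis AQ1 : forall x z : rV, `|x - xc| <= r0 -> `|z| <= 2 * r0 ->
  1 <= 2 * (\tr (A x *m Q) + \sum_c (z *m Q) 0 c * B x c).
Hypothesis AQ2 : forall x z : rV, `|x - xc| <= r0 -> `|z| <= 2 * r0 ->
  bf Q z z * (2 * (\tr (A x *m Q) + \sum_c (z *m Q) 0 c * B x c))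
    <= 4 * (s + 1) * bf (A x) (z *m Q) (z *m Q).

Variables (f : rV -> R) (df : 'I_m -> rV -> R) (hf : 'I_m -> 'I_m -> rV -> R).
Hypothesis fC : C2on U f df hf.
Variables (lam S : R).
Hypothesis lam0 : 0 <= lam.
Hypothesis Lf : forall x, `|x - xc| <= r0 -> - lam < Lop (A x) (B x) (hess hf x) (df^~ x).
Hypothesis fS : forall x, `|x - xc| <= r0 -> f x <= S.

(** If some q at x is below rho = c1 h^2, then x is within h of that pole and the hypothesis
    applies. Otherwise the barrier with poles at the y i bounds S - f from below, and each pole
    contributes at least the numerator of [spread_const]. *)
Lemma spread (I : finType) (y : I -> rV) (h K : R) :
  0 <= K -> 0 < h -> h <= r0 -> (forall i, `|y i - xc| <= r1) ->
  (forall i j, i != j -> h <= `|y i - y j|) ->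
  (forall i x, `|x - y i| <= h -> `|x - xc| <= r0 -> K <= S - f x) ->
  forall x, `|x - xc| <= r1 ->
    Num.min 1 (spread_const c1 c2 r0 r1 s * (#|I|%:R * h ^+ m)) * K
      <= S - f x + lam * (c2 * r0 ^+ 2).
Proof.
move=> K0 h0 hr0 yc ysep fK x xr1.
have r00 : 0 < r0 := lt_trans r10 r1r0.
have xr0 : `|x - xc| <= r0 := le_trans xr1 (ltW r1r0).
set th := spread_const _ _ _ _ _.
have th0 : 0 < th := spread_const_gt0 m0 c10 c20 r10 r1r0 s0 r1_small.
have lc : 0 <= lam * (c2 * r0 ^+ 2).
  by apply: mulr_ge0 => //; apply: mulr_ge0; [exact: ltW|exact: sqr_ge0].
have min0 : 0 <= Num.min 1 (th * (#|I|%:R * h ^+ m)).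
  rewrite le_min ler01 mulr_ge0 ?(ltW th0) // mulr_ge0 //.
  by rewrite exprn_ge0 // ltW.
pose rho := c1 * h ^+ 2.
have rho0 : 0 < rho by rewrite mulr_gt0 // exprn_gt0.
have qh i z : qd Q (y i) z <= rho -> `|z - y i| <= h.
  move=> /(le_trans (Qc1 _)); rewrite ler_pM2l //.
  by rewrite ler_pXn2r ?nnegrE // (ltW h0).
have [/existsP[i qi]|/existsPn q_rho] := boolP [exists j, qd Q (y j) x < rho].
  have KS : K <= S - f x by apply: (fK i) => //; exact: qh (ltW qi).
  apply: (@le_trans _ _ (1 * K)); last by rewrite mul1r -[leLHS]addr0 lerD.
  by apply: ler_wpM2r => //; rewrite ge_min lexx.
pose tau := (c1 * (r0 - r1) ^+ 2) `^ (- s).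
pose P := c1 `^ (- s) * ((m * 2 ^ m)%:R * 3 * 2 ^+ m.-1) * r0.
have P0 : 0 < P.
  rewrite !mulr_gt0 ?powR_gt0 ?exprn_gt0 //.
  by rewrite ltr0n muln_gt0 m0 expn_gt0.
(* The largest amplitude for which [packing_sum] keeps the barrier below K where it meets an excised
   neighbourhood of a pole. *)
pose t := K * h ^+ m / P.
have t0 : 0 <= t by rewrite divr_ge0 ?(ltW P0) // mulr_ge0 // exprn_ge0 // ltW.
have psi_far z i : (forall j, rho <= qd Q (y j) z) ->
    psi Q s (y i) z <= c1 `^ (- s) * (Num.max `|y i - z| h) ^- m.-1.
  move=> qz; have mh0 : 0 < Num.max `|y i - z| h by rewrite lt_max h0 orbT.
  have -> : c1 `^ (- s) * (Num.max `|y i - z| h) ^- m.-1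
     = (c1 * (Num.max `|y i - z| h) ^+ 2) `^ (- s).
    by rewrite powRM ?(ltW c10) ?sqr_ge0 // (powR_sqr_half _ sE) // ltW.
  apply: powR_anti; rewrite ?(ltW s0) //; first by rewrite mulr_gt0 // exprn_gt0.
  rewrite maxEle; case: ifP => _; first exact: qz.
  by rewrite distrC; exact: Qc1.
have q_rho' j : rho <= qd Q (y j) x by rewrite leNgt; exact: q_rho.
have main : t * \sum_j (psi Q s (y j) x - tau)
      <= S - f x + lam * (c2 * r0 ^+ 2 - qd Q xc x).
  apply: (@comparison R m U xc r0 c2 Q A B s Uo cubeU Qsym (ltW c20) Qc2 Asym Apos
    (ltW s0) r00 AQ1 AQ2 f df hf fC I y rho) => //.
  - by move=> i; apply: le_trans (yc i) (ltW r1r0).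
  - move=> z i zr; apply: powR_anti; rewrite ?(ltW s0) //.
      by rewrite mulr_gt0 // exprn_gt0 // subr_gt0.
    apply: le_trans (Qc1 _); rewrite ler_pM2l //.
    apply: lerXn2r; rewrite ?nnegrE ?subr_ge0 ?(ltW r1r0) //.
    have := ler_distD (y i) z xc; have := yc i; rewrite zr; lra.
  - move=> z i zr0 zi zq; apply: le_trans (_ : K <= _); last first.
      by apply: (fK i) => //; apply: qh; rewrite zi.
    have tau0 : 0 <= tau by exact: powR_ge0.
    apply: (@le_trans _ _ (t * \sum_j (c1 `^ (- s) * (Num.max `|y j - z| h) ^- m.-1))).
      apply: ler_wpM2l => //; apply: ler_sum => j _.
      by rewrite lerBlDr; apply: le_trans (psi_far z j zq) _; rewrite lerDl.
    rewrite -mulr_sumr.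
    (* All poles lie within 2 r0 of z, and 2 r0 / h + 1 <= 3 r0 / h since h <= r0; this is the
       factor 3 in [spread_const]. *)
    have pk := @packing_sum R m I y z h (2 * r0) m0 h0 (mulr_ge0 (ler0n _ _) (ltW r00)).
    have {}pk := pk _ ysep.
    apply: (@le_trans _ _ (t * (c1 `^ (- s) *
       ((m * 2 ^ m)%:R * (3 * r0 / h) * (2 / h) ^+ m.-1)))).
      apply: ler_wpM2l => //; apply: ler_wpM2l; first exact: powR_ge0.
      apply: le_trans (pk _) _.
        move=> j; have := ler_distD xc (y j) z; have := yc j; move: r1r0 zr0; rewrite (distrC xc); lra.
      apply: ler_wpM2r; first by rewrite exprn_ge0 // divr_ge0 // ltW.
      apply: ler_wpM2l => //; rewrite -[leRHS]mulrA.
      have : 1 <= r0 / h by rewrite ler_pdivlMr // mul1r.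
      rewrite -mulrA; lra.
    rewrite le_eqVlt; apply/orP; left; apply/eqP.
    rewrite /t /P expr_div_n -{1}(prednK m0) exprS; field.
    rewrite !gt_eqF ?powR_gt0 ?exprn_gt0 //.
    by rewrite ltr0n.
have tN : t * (#|I|%:R * ((4 * c2 * r1 ^+ 2) `^ (- s) - tau)) <=
    t * \sum_j (psi Q s (y j) x - tau).
  apply: ler_wpM2l => //; rewrite mulr_natl -sumr_const; apply: ler_sum => j _.
  apply: lerB => //; apply: powR_anti; rewrite ?(ltW s0) //.
    by apply: lt_le_trans rho0 _; exact: q_rho'.
  apply: le_trans (Qc2 _) _; rewrite (_ : 4 * c2 * _ = c2 * (2 * r1) ^+ 2); last by ring.
  rewrite ler_pM2l //; apply: lerXn2r; rewrite ?nnegrE ?mulr_ge0 ?(ltW r10) //.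
  have := ler_distD xc x (y j); have := yc j; move: xr1; rewrite (distrC xc); lra.
have qc : 0 <= qd Q xc x by apply: le_trans (Qc1 _); rewrite mulr_ge0 ?(ltW c10) ?sqr_ge0.
have lq := mulr_ge0 lam0 qc.
apply: (@le_trans _ _ (th * (#|I|%:R * h ^+ m) * K)).
  by apply: ler_wpM2r => //; rewrite ge_min lexx orbT.
have -> : th * (#|I|%:R * h ^+ m) * K
   = t * (#|I|%:R * ((4 * c2 * r1 ^+ 2) `^ (- s) - tau)).
  by rewrite /th /spread_const -/tau -/P /t; ring.
apply: le_trans tN _; apply: le_trans main _; lra.
Qed.

(** The contact points are sought within r1 / 2 of x0, hence lie within r1 of xc. The 2 subtracted
    is the rise of f over f(x0) allowed near them. *)
Lemma spread_from_min (x0 : rV) (eps C1 : R) :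
  `|x0 - xc| <= r1 / 2 -> (forall x, `|x - x0| <= r1 / 2 -> f x0 <= f x) ->
  0 < eps -> eps * (r1 / 2) ^+ 2 <= 1 -> 0 <= C1 ->
  (forall x, `|x - x0| <= r1 / 2 -> (forall a, `|df a x| <= 3 * eps * (r1 / 2)) ->
     psd (hess hf x + (2 * eps) *: 1%:M) -> forall a b, `|hf a b x| <= C1) ->
  forall x, `|x - xc| <= r1 ->
    Num.min 1 (spread_const c1 c2 r0 r1 s *
        (eps * (r1 / 2) / (m%:R * (m%:R * (C1 + 1) + 2 * eps))) ^+ m) * (S - f x0 - 2)
      <= S - f x + lam * (c2 * r0 ^+ 2).
Proof.
move=> x0c x0min eps0 epsr C10 contact x xr.
have r00 : 0 < r0 := lt_trans r10 r1r0.
have th0 : 0 < spread_const c1 c2 r0 r1 s := spread_const_gt0 m0 c10 c20 r10 r1r0 s0 r1_small.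
have lc : 0 <= lam * (c2 * r0 ^+ 2).
  by apply: mulr_ge0 => //; apply: mulr_ge0; [exact: ltW|exact: sqr_ge0].
set nu := _ ^+ m.
have nu0 : 0 <= nu.
  rewrite exprn_ge0 // divr_ge0 ?mulr_ge0 ?addr_ge0 ?mulr_ge0 ?divr_ge0 ?addr_ge0 //; exact: ltW.
have min0 k : 0 <= k -> 0 <= Num.min 1 (spread_const c1 c2 r0 r1 s * k).
  by move=> k0; rewrite le_min ler01 mulr_ge0 // ltW.
have [K0|K0] := ltP (S - f x0 - 2) 0.
  apply: (@le_trans _ _ 0); first by rewrite mulr_ge0_le0 ?min0 // ltW.
  by rewrite addr_ge0 // subr_ge0; apply: fS; apply: le_trans xr (ltW r1r0).
have cubeU' z : `|z - x0| <= r1 / 2 -> U z.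
  move=> zr; apply: cubeU; have := ler_distD x0 z xc; move: r1r0 r10; lra.
have r12 : 0 < r1 / 2 by rewrite divr_gt0.
have [I [y [h [/andP[h0 hr0] yr ysep nuh fy]]]] :=
  contact_points m0 Uo fC r12 cubeU' x0min eps0 epsr C10 r00 contact.
have := @spread I y h (S - f x0 - 2) K0 h0 hr0 _ ysep _ x xr.
set M := Num.min 1 _ => H; apply: le_trans (H _ _).
- apply: ler_wpM2r => //; rewrite /M le_min !ge_min lexx /=; apply/orP; right.
  by rewrite ler_pM2l.
- move=> i; have := ler_distD x0 (y i) xc; have := yr i; lra.
- move=> i z zy _; have := fy i z zy; lra.
Qed.

End Spread.

(** * Hessian bounds at contact points *)

Section HessianForm.
Context {R : realType} {m : nat}.
Local Notation rV := 'rV[R]_m.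
Local Notation toC := (map_mx (real_complex R)).

Lemma pdf_unit (g : 'M[R]_m) : pdf g -> g \in unitmx.
Proof.
move=> gp; rewrite -row_free_unit -kermx_eq0; apply/negPn/negP => k0.
case/rowV0Pn: k0 => v /sub_kermxP vg v0.
by have := gp v v0; rewrite /bf vg mul0mx mxE ltxx.
Qed.

Lemma unit_JJ (J : 'M[R]_m) : J *m J = - 1%:M -> J \in unitmx.
Proof.
move=> JJ; have : J *m - J = 1%:M by rewrite mulmxN JJ opprK.
by case/mulmx1_unit.
Qed.

Lemma invmx_JJ (J : 'M[R]_m) : J *m J = - 1%:M -> invmx J = - J.
Proof.
move=> JJ; have Ju := unit_JJ JJ.
by rewrite -[LHS]mulmx1 -[1%:M]opprK -JJ mulmxN mulmxA mulVmx // mul1mx.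
Qed.

Lemma invmx_mul (A B : 'M[R]_m) : A \in unitmx -> B \in unitmx ->
  invmx (A *m B) = invmx B *m invmx A.
Proof.
move=> Au Bu; have ABu : A *m B \in unitmx by rewrite unitmx_mul Au.
rewrite -[RHS]mulmx1 -(mulmxV ABu) !mulmxA -(mulmxA (invmx B)) mulVmx // mulmx1.
by rewrite mulVmx // mul1mx.
Qed.

Section HermitianInverse.
Variables (g J : 'M[R]_m).
Hypothesis gp : pdf g.
Hypothesis JJ : J *m J = - 1%:M.
Hypothesis Jg : J *m g *m J^T = g.

Lemma ginv_J : J^T *m invmx g = - (invmx g *m J).
Proof.
have gu := pdf_unit gp.
have E : J *m g = - (g *m J^T).
  by rewrite -{2}Jg -!mulmxA -trmx_mul JJ linearN /= trmx1 !mulmxN mulmx1 opprK.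
rewrite -[LHS]mul1mx -(mulVmx gu) -!mulmxA [g *m _]mulmxA.
rewrite -[g *m J^T]opprK -E mulNmx -[J *m g *m _]mulmxA mulmxV // mulmx1.
by rewrite mulmxN.
Qed.

End HermitianInverse.

Variables (J : rV -> 'M[R]_m) (dJ : 'I_m -> 'I_m -> 'I_m -> rV -> R)
  (df : 'I_m -> rV -> R) (hf : 'I_m -> 'I_m -> rV -> R) (x : rV).

(* [torsion_mx] is the first-order part of the exterior derivative of J df. *)
Definition dJ_mx (c : 'I_m) (y : rV) : 'M[R]_m := \matrix_(a, b) (dJ a b c y - dJ b a c y).
Definition torsion_mx : 'M[R]_m := \sum_c df c x *: dJ_mx c x.

Lemma torsion_anti : torsion_mx^T = - torsion_mx.
Proof.
rewrite /torsion_mx raddf_sum -sumrN; apply: eq_bigr => c _ /=.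
by apply/matrixP => a b; rewrite !mxE -mulrN opprB.
Qed.

Local Notation H := (hess hf x).
Local Notation Z := torsion_mx.
Local Notation beta := (beta_mx J dJ df hf x).

Hypothesis Hsym : H^T = H.
Hypothesis JJ : J x *m J x = - 1%:M.

Lemma curl_hess : curl_mx J dJ df hf x = Z + H *m (J x)^T - J x *m H.
Proof.
apply/matrixP => a b; rewrite !mxE /ddJdf summxE.
have -> : \sum_c (H a c * (J x)^T c b) = \sum_c J x b c * hf a c x.
  by apply: eq_bigr => c _; rewrite !mxE mulrC.
have -> : \sum_c (J x a c * H c b) = \sum_c J x a c * hf b c x.
  by apply: eq_bigr => c _; rewrite -Hsym !mxE.
rewrite !big_split /= opprD addrACA addrA; congr (_ + _ - _).
rewrite -sumrB; apply: eq_bigr => c _; rewrite !mxE; ring.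
Qed.

Lemma beta_hess : beta = 2^-1 *: (J x *m H - H *m (J x)^T) - 4^-1 *: (Z + J x *m Z *m (J x)^T).
Proof.
rewrite /beta_mx curl_hess; set j := J x.
have jjT : j^T *m j^T = - 1%:M by rewrite -trmx_mul JJ linearN /= trmx1.
have -> : j *m (Z + H *m j^T - j *m H) *m j^T =
  j *m Z *m j^T + (H *m j^T - j *m H).
  rewrite mulmxBr mulmxDr mulmxBl mulmxDl -addrA; congr (_ + _).
  rewrite [j *m (H *m _)]mulmxA -[j *m H *m j^T *m j^T]mulmxA jjT mulmxN mulmx1.
  by rewrite [j *m (j *m H)]mulmxA JJ mulNmx mul1mx mulNmx opprK addrC.
move: (j *m H) (H *m j^T) (j *m Z *m j^T) Z => p q y z.
apply/matrixP => a b; rewrite !mxE.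
by field.
Qed.

(** The complex Hessian in the direction v is the average of the real Hessian over v and J v, up to
    a torsion term of first order in f. *)
Lemma beta_form v : bf beta v (v *m J x) =
  2^-1 * (bf H v v + bf H (v *m J x) (v *m J x)) - 2^-1 * bf Z v (v *m J x).
Proof.
rewrite beta_hess !(bf_add, bf_opp, bf_scale).
set j := J x; set w := v *m j.
have e1 u1 u2 : bf (j *m H) u1 u2 = bf H (u1 *m j) u2 by rewrite /bf !mulmxA.
have e2 u1 u2 : bf (H *m j^T) u1 u2 = bf H u1 (u2 *m j).
  by rewrite /bf trmx_mul !mulmxA.
have wj : w *m j = - v by rewrite /w -mulmxA JJ mulmxN mulmx1.
rewrite e1 e2 -/w bf_mul -/w wj !bfNr (bf_tr Z w v) torsion_anti bf_opp.
by field.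
Qed.

Variable g : 'M[R]_m.
Hypothesis gp : pdf g.
Hypothesis Jg : J x *m g *m (J x)^T = g.

(** The trace is thus a real linear elliptic operator with leading coefficients half the inverse
    metric; J^T g^-1 = - g^-1 J makes the two Hessian terms of [beta_hess] add up instead of
    cancelling. *)
Lemma trace_hess : 2^-1 * \tr (invmx (J x *m g) *m beta) =
  Lop (2^-1 *: invmx g) (fun c => 4^-1 * \tr (invmx g *m J x *m dJ_mx c x)) H (df^~ x).
Proof.
rewrite /Lop -scalemxAl mxtraceZ.
have -> : \sum_c df c x * (4^-1 * \tr (invmx g *m J x *m dJ_mx c x)) =
  4^-1 * \tr (invmx g *m J x *m Z).
  rewrite /torsion_mx mulmx_sumr raddf_sum mulr_sumr /=; apply: eq_bigr => c _.
  by rewrite -scalemxAr mxtraceZ mulrCA.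
have gu := pdf_unit gp; have Ju := unit_JJ JJ.
rewrite (invmx_mul Ju gu) (invmx_JJ JJ) beta_hess.
set j := J x; set G := invmx g.
have Gj : j^T *m G = - (G *m j) by exact: ginv_J.
rewrite mulmxBr raddfB /= -!scalemxAr !mxtraceZ mulmxBr raddfB /= mulmxDr mxtraceD.
have Gjj : G *m - j *m j = G by rewrite -mulmxA mulNmx JJ opprK mulmx1.
have -> : \tr (G *m - j *m (j *m H)) = \tr (G *m H) by rewrite mulmxA Gjj.
have -> : \tr (G *m - j *m (H *m j^T)) = - \tr (G *m H).
  rewrite mulmxA mxtrace_mulC !mulmxA Gj mulmxN !mulNmx opprK -(mulmxA G) JJ.
  by rewrite mulmxN mulmx1 mulNmx raddfN.
have -> : \tr (G *m - j *m (j *m Z *m j^T)) = - \tr (G *m j *m Z).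
  by rewrite !mulmxA Gjj mxtrace_mulC mulmxA Gj mulNmx raddfN.
have -> : \tr (G *m - j *m Z) = - \tr (G *m j *m Z) by rewrite mulmxN mulNmx raddfN.
by field.
Qed.

End HessianForm.

(** * From the two Monge-Ampere conditions to a bound on the real Hessian *)

Section ContactHessian.
Context {R : realType} {m : nat}.
Local Notation rV := 'rV[R]_m.
Local Notation toC := (map_mx (real_complex R)).

Lemma part_pm_mx (J Pi : rV -> 'M[R]_m) (eps : R) (a : @Defs.form R m 2) N x w :
  (forall w, a x w = form_mx N x w) -> J x *m N *m (J x)^T = N ->
  part_pm J Pi eps a x w =
    form_mx (proj_pm (Pi x) eps *m N *m (proj_pm (Pi x) eps)^T) x w.
Proof.
move=> aN NJ; rewrite /part_pm (@bideg1_2form _ _ J _ (pair_form N)); last exact: aN.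
rewrite proj_mix NJ form_mx_pair pair_form_conj.
rewrite (_ : 2^-1 *: (N + N) = N) //.
by apply/matrixP => i j; rewrite !mxE; field.
Qed.

Lemma bf1_le (v : rV) : bf 1%:M v v <= m%:R * `|v| ^+ 2.
Proof.
have -> : m%:R * `|v| ^+ 2 = \sum_(a < m) `|v| ^+ 2.
  by rewrite sumr_const card_ord mulr_natl.
rewrite bf1; apply: ler_sum => a _; rewrite -real_normK ?num_real //.
by apply: lerXn2r; rewrite ?nnegrE // coord_le_norm.
Qed.

Lemma bf_sq_le (B : 'M[R]_m) (K : R) v : (forall a b, `|B a b| <= K) ->
  bf B v v <= m%:R * m%:R * K * `|v| ^+ 2.
Proof. by move=> BK; apply: le_trans (ler_norm _) _; rewrite expr2; exact: bf_le. Qed.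

Lemma proj_sum (Pi : 'M[R]_m) : proj_pm Pi 1 + proj_pm Pi (-1) = 1%:M.
Proof. by apply/matrixP => a b; rewrite !mxE; field. Qed.

(** Diagonal entries are values of the form; off-diagonal ones are controlled by its nonnegativity
    on e_a + e_b and e_a - e_b. *)
Lemma psd_entry (B : 'M[R]_m) (K : R) : B^T = B -> psd B ->
  (forall v, bf B v v <= K * `|v| ^+ 2) -> forall a b, `|B a b| <= K.
Proof.
move=> Bs Bp BK a b.
have E c d : bf B (delta_mx 0 c) (delta_mx 0 d) = B c d.
  by rewrite /bf -rowE trmx_delta -colE !mxE.
have K0 c : B c c <= K.
  rewrite -E; apply: le_trans (BK _) _.
  have Bc : 0 <= K.
    have := le_trans (Bp (delta_mx 0 c)) (BK _).
    rewrite pmulr_lge0 // exprn_gt0 // normr_gt0.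
    by apply/eqP => /matrixP/(_ 0 c)/eqP; rewrite !mxE !eqxx oner_eq0.
  by apply: ler_piMr => //; rewrite expr_le1 ?norm_delta_le1.
have sy : B b a = B a b by rewrite -[in LHS]Bs mxE.
have := Bp (delta_mx 0 a + delta_mx 0 b); have := Bp (delta_mx 0 a - delta_mx 0 b).
rewrite !(bfDl, bfDr, bfNl, bfNr) !E sy; have := K0 a; have := K0 b.
rewrite ler_norml; lra.
Qed.

(* On T_+ the eigenvalues of omega_+ + i del delbar u are at least 1/2 and their
   product is at most [Fs]; on T_- the upper bound is the positivity of
   omega_- - i del delbar u. *)
Lemma contact_hess k (A c1 eps zeta Fs : R) :
  0 <= A -> 0 < c1 -> 0 <= eps -> 0 <= zeta -> 0 <= Fs ->
  eps * m%:R * (1 + (m%:R * A) ^+ 2) + 2^-1 * (m%:R * m%:R * zeta * (m%:R * A)) <= 2^-1 * c1 ->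
  exists2 C1 : R, 0 <= C1 &
  forall (J g Pi Z H beta : 'M[R]_m) (x : rV) (F : R),
    g^T = g -> pdf g -> J *m J = - 1%:M -> J *m g *m J^T = g -> J *m Pi = Pi *m J ->
    Pi *m Pi = 1%:M ->
    \rank (kermx (toC Pi - ((1 : R)%:C)%:M) :&: kermx (toC J - 'i%C%:M))%MS = k ->
    (forall a b, `|J a b| <= A) -> (forall a b, `|g a b| <= A) ->
    (forall a b, `|Pi a b| <= A) -> (forall a b, `|omega_mx g J Pi 1 a b| <= A) ->
    (forall v, c1 * `|v| ^+ 2 <= bf g v v) ->
    beta^T = - beta -> J *m beta *m J^T = beta ->
    (forall v, bf beta v (v *m J) =
       2^-1 * (bf H v v + bf H (v *m J) (v *m J)) - 2^-1 * bf Z v (v *m J)) ->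
    (forall a b, `|Z a b| <= zeta) -> 0 < F -> F <= Fs ->
    (forall v, wedge_pow (form_mx (proj_pm Pi 1 *m (J *m g + beta) *m (proj_pm Pi 1)^T)) k x v =
       F%:C * wedge_pow (form_mx (omega_mx g J Pi 1)) k x v) ->
    (forall v, eigen Pi (-1) v -> bf beta v (v *m J) <= bf g v v) ->
    H^T = H -> psd (H + (2 * eps) *: 1%:M) -> forall a b, `|H a b| <= C1.
Proof.
move=> A0 c10 eps0 zeta0 Fs0 small.
have [Kw Kw0 Kw_le] := @wedge_pow_le R m k.
pose D : R := m%:R * (m%:R * (m%:R * A)).
have mA0 : 0 <= m%:R * A by rewrite mulr_ge0.
have D0 : 0 <= D by rewrite !mulr_ge0.
pose W := @wedge_const R k * (2^-1 * c1) ^+ k.-1.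
have W0 : 0 < W by rewrite mulr_gt0 ?wedge_const_gt0 // exprn_gt0 // mulr_gt0.
pose X := Kw * A ^+ k * D ^+ k.
have X0 : 0 <= X by rewrite !mulr_ge0 ?exprn_ge0.
pose C3 := Fs * X / W + m%:R * m%:R * A.
have FXW0 : 0 <= Fs * X / W by apply: divr_ge0; [exact: mulr_ge0|exact: ltW].
have C30 : 0 <= C3 by apply: addr_ge0 => //; apply: mulr_ge0 => //; exact: mulr_ge0.
pose zz := m%:R * m%:R * zeta * (m%:R * A).
have zz0 : 0 <= zz by rewrite !mulr_ge0.
pose C4 := 2 * C3 + zz + 2 * eps * m%:R * (m%:R * A) ^+ 2 + 2 * eps * m%:R.
have C40 : 0 <= C4 by rewrite !addr_ge0 ?mulr_ge0 ?exprn_ge0.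
pose C5 := 4 * C4 * (m%:R * (1 + A)) ^+ 2.
have C50 : 0 <= C5 by apply: mulr_ge0; [exact: mulr_ge0|exact: sqr_ge0].
exists (C5 + 2 * eps); first by apply: addr_ge0 => //; exact: mulr_ge0.
move=> J g Pi Z H beta x F gs gp JJ Jg JPi PiPi rk JA gA PiA oA gc1 ba bJ bE ZA F0 FFs wE
  neg Hs Hp.
have vJ (v : rV) : `|v *m J| <= m%:R * A * `|v| by apply: mulmx_norm_le.
have Hlow (v : rV) : - (2 * eps * m%:R * `|v| ^+ 2) <= bf H v v.
  have := Hp v; rewrite bf_add bf_scale; have := bf1_le v => h1 h2.
  have : 2 * eps * bf 1%:M v v <= 2 * eps * (m%:R * `|v| ^+ 2).
    by apply: ler_wpM2l => //; rewrite mulr_ge0.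
  lra.
have vJ2 (v : rV) : `|v *m J| ^+ 2 <= (m%:R * A) ^+ 2 * `|v| ^+ 2.
  by rewrite -exprMn; apply: lerXn2r; rewrite ?nnegrE ?mulr_ge0.
have HlowJ (v : rV) : - (2 * eps * m%:R * (m%:R * A) ^+ 2 * `|v| ^+ 2) <= bf H (v *m J) (v *m J).
  apply: le_trans (Hlow _); rewrite lerN2 -[leRHS]mulrA; apply: ler_wpM2l => //.
  by rewrite !mulr_ge0.
have Zle (v : rV) : `|bf Z v (v *m J)| <= zz * `|v| ^+ 2.
  apply: le_trans (bf_le _ _ ZA) _; rewrite /zz -[leRHS]mulrA; apply: ler_wpM2l.
    by rewrite !mulr_ge0.
  by rewrite expr2 mulrCA ler_wpM2l.
(* Here the smallness of eps and zeta enters: the negative part of the Hessian and the torsion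
   together cost at most g / 2. *)
have Slow (v : rV) : - (2^-1 * bf g v v) <= bf beta v (v *m J).
  rewrite bE; have := Hlow v; have := HlowJ v; have := Zle v; have := gc1 v.
  rewrite ler_norml => h1 /andP[h2 h3] h4 h5.
  have : (eps * m%:R * (1 + (m%:R * A) ^+ 2) + 2^-1 * zz) * `|v| ^+ 2
    <= 2^-1 * c1 * `|v| ^+ 2 by apply: ler_wpM2r => //; exact: sqr_ge0.
  lra.
have Sup eps' (v : rV) : (eps' = 1) \/ (eps' = -1) -> eigen Pi eps' v ->
    bf beta v (v *m J) <= C3 * `|v| ^+ 2.
  have v2 : 0 <= `|v| ^+ 2 by exact: sqr_ge0.
  have FX : 0 <= Fs * X / W * `|v| ^+ 2.
    exact: mulr_ge0.
  have AX : 0 <= m%:R * m%:R * A * `|v| ^+ 2 by rewrite !mulr_ge0.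
  rewrite /C3 mulrDl; case=> -> vE; last first.
    have := neg v vE; have := bf_sq_le v gA; lra.
  have P1 : (1 : R) * 1 = 1 by rewrite mulr1.
  pose al := proj_pm Pi 1 *m (J *m g + beta) *m (proj_pm Pi 1)^T.
  have sumJ : J *m (J *m g + beta) *m J^T = J *m g + beta.
    by rewrite mulmxDr mulmxDl bJ (JgJ Jg).
  have suma : (J *m g + beta)^T = - (J *m g + beta).
    by rewrite linearD /= ba (Jg_anti gs JJ Jg) opprD.
  have alE u : eigen Pi 1 u -> bf al u (u *m J) = bf g u u + bf beta u (u *m J).
    move=> Eu; rewrite /al (bf_conj_proj P1) ?bf_add ?(bf_Jg Jg) //.
    exact: eigenJ.
  have al2 u : eigen Pi 1 u -> 2^-1 * bf g u u <= bf al u (u *m J).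
    by move=> Eu; rewrite alE //; have := Slow u; lra.
  have := @eigen_upper R m g J Pi 1 k gp JJ JPi rk Kw Kw0 Kw_le A c1 A0 c10 JA gc1 al x F
    (conj_proj_anti _ _ suma) (conj_projJ _ JPi sumJ) F0 wE oA al2 v vE.
  rewrite -/W -/D -/X alE // => h1.
  have h2 : W * (bf g v v + bf beta v (v *m J)) <= Fs * X * `|v| ^+ 2.
    apply: le_trans h1 _; apply: ler_wpM2r => //; apply: ler_wpM2r => //.
  have h3 : bf g v v + bf beta v (v *m J) <= Fs * X / W * `|v| ^+ 2.
    by rewrite mulrAC ler_pdivlMr // mulrC.
  have h4 : 0 <= bf g v v by apply: le_trans (gc1 v); rewrite mulr_ge0 // ltW.
  lra.
(* What is bounded above so far is the sum of the values of H at v and J v; the value at J v is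
   bounded below, so the one at v is bounded above. *)
have Hup eps' (v : rV) : (eps' = 1) \/ (eps' = -1) -> eigen Pi eps' v ->
    bf (H + (2 * eps) *: 1%:M) v v <= C4 * `|v| ^+ 2.
  move=> e1 vE; have := Sup _ _ e1 vE; rewrite bE bf_add bf_scale => h1.
  have := HlowJ v; have := Zle v; rewrite ler_norml => /andP[h2 h3] h4.
  have h5 := bf1_le v.
  have : 2 * eps * bf 1%:M v v <= 2 * eps * (m%:R * `|v| ^+ 2).
    by apply: ler_wpM2l => //; rewrite mulr_ge0.
  rewrite /C4; lra.
have Pn eps' (v : rV) : (eps' = 1) \/ (eps' = -1) ->
    `|v *m proj_pm Pi eps'| ^+ 2 <= (m%:R * (1 + A)) ^+ 2 * `|v| ^+ 2.
  move=> e1; rewrite -exprMn; apply: lerXn2r; rewrite ?nnegrE ?mulr_ge0 ?addr_ge0 //.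
  apply: mulmx_norm_le => [|a b]; first by rewrite addr_ge0.
  have h1 := PiA a b; rewrite !mxE.
  have h2 : `|(a == b)%:R : R| <= 1 by case: (a == b); rewrite ?normr1 ?normr0.
  have h3 : `|eps' * Pi a b| <= A by case: e1 => ->; rewrite ?mul1r // mulN1r normrN.
  rewrite normrM ger0_norm ?invr_ge0 //.
  have := ler_normD ((a == b)%:R : R) (eps' * Pi a b); lra.
have Hall (v : rV) : bf (H + (2 * eps) *: 1%:M) v v <= C5 * `|v| ^+ 2.
  have vE : v = v *m proj_pm Pi 1 + v *m proj_pm Pi (-1).
    by rewrite -mulmxDr proj_sum mulmx1.
  (* H need not respect the splitting v = a + b, but nonnegativity at a - b gives H(a + b, a + b) <=
     2 H(a, a) + 2 H(b, b) for the shifted form. *)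
  have := Hp (v *m proj_pm Pi 1 - v *m proj_pm Pi (-1)).
  have E1 : eigen Pi 1 (v *m proj_pm Pi 1) by apply: proj_pm_eigen => //; rewrite mulr1.
  have E2 : eigen Pi (-1) (v *m proj_pm Pi (-1)).
    by apply: proj_pm_eigen => //; rewrite mulrNN mulr1.
  have u1 := Hup 1 _ (or_introl erefl) E1; have u2 := Hup (-1) _ (or_intror erefl) E2.
  have n1 := ler_wpM2l C40 (Pn 1 v (or_introl erefl)).
  have n2 := ler_wpM2l C40 (Pn (-1) v (or_intror erefl)).
  set a := v *m proj_pm Pi 1 in vE u1 n1 *; set b := v *m proj_pm Pi (-1) in vE u2 n2 *.
  have -> : bf (H + (2 * eps) *: 1%:M) v v = bf (H + (2 * eps) *: 1%:M) (a + b) (a + b).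
    by rewrite -vE.
  rewrite !(bfDl, bfDr, bfNl, bfNr) /C5; lra.
move=> a b.
have Hs2 : (H + (2 * eps) *: 1%:M)^T = H + (2 * eps) *: 1%:M.
  by rewrite linearD linearZ /= trmx1 Hs.
have := psd_entry Hs2 Hp Hall a b; rewrite !mxE.
have : `|2 * eps * (a == b)%:R| <= 2 * eps.
  rewrite normrM ger0_norm ?mulr_ge0 //; apply: ler_piMr; first by rewrite mulr_ge0.
  by case: (a == b); rewrite ?normr1 ?normr0.
have := ler_normB (H a b + 2 * eps * (a == b)%:R) (2 * eps * (a == b)%:R).
rewrite addrK; lra.
Qed.

End ContactHessian.

(** * Matrix-valued functions *)

Section MatrixContinuity.
Context {R : realType} {m : nat}.
Local Notation rV := 'rV[R]_m.

Definition ctsm p q (B : rV -> 'M[R]_(p, q)) (x : rV) :=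
  forall a b, {for x, continuous (fun y => B y a b)}.

Lemma cts_eq (f f' : rV -> R) x : f =1 f' -> {for x, continuous f} -> {for x, continuous f'}.
Proof. by move=> /boolp.funext ->. Qed.

Lemma ctsmM p q r (B : rV -> 'M[R]_(p, q)) (B' : rV -> 'M[R]_(q, r)) x :
  ctsm B x -> ctsm B' x -> ctsm (fun y => B y *m B' y) x.
Proof.
move=> h h' a b; apply: cts_eq (_ : {for x, continuous (fun y => \sum_c B y a c * B' y c b)}).
  by move=> y; rewrite mxE.
by apply: cts_sum => c; apply: ctsM.
Qed.

Lemma ctsmD p q (B B' : rV -> 'M[R]_(p, q)) x :
  ctsm B x -> ctsm B' x -> ctsm (fun y => B y + B' y) x.
Proof.
move=> h h' a b; apply: cts_eq (ctsD (h a b) (h' a b)).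
by move=> y; rewrite mxE.
Qed.

Lemma ctsmZ p q c (B : rV -> 'M[R]_(p, q)) x : ctsm B x -> ctsm (fun y => c *: B y) x.
Proof.
move=> h a b; apply: cts_eq (ctsM (@cts_cst _ _ c x) (h a b)).
by move=> y; rewrite mxE.
Qed.

Lemma ctsmB p q (B B' : rV -> 'M[R]_(p, q)) x :
  ctsm B x -> ctsm B' x -> ctsm (fun y => B y - B' y) x.
Proof.
move=> h h' a b; apply: cts_eq (ctsD (h a b) (ctsN (h' a b))).
by move=> y; rewrite !mxE.
Qed.

Lemma ctsmT p q (B : rV -> 'M[R]_(p, q)) x : ctsm B x -> ctsm (fun y => (B y)^T) x.
Proof.
move=> h a b; apply: cts_eq (h b a).
by move=> y; rewrite mxE.
Qed.

Lemma ctsm_cst p q (B : 'M[R]_(p, q)) x : ctsm (fun=> B) x.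
Proof. by move=> a b; exact: cts_cst. Qed.

Lemma cts_tr p (B : rV -> 'M[R]_p) x : ctsm B x -> {for x, continuous (fun y => \tr (B y))}.
Proof. by move=> h; apply: cts_sum => a; exact: h. Qed.

Lemma cts_prod (I : finType) (f : I -> rV -> R) x :
  (forall i, {for x, continuous (f i)}) -> {for x, continuous (fun y => \prod_i f i y)}.
Proof.
move=> fc; rewrite unlock /=; elim: (index_enum I) => [|i s IH] /=.
  exact: cts_cst.
by apply: ctsM.
Qed.

Lemma cts_det p (B : rV -> 'M[R]_p) x : ctsm B x -> {for x, continuous (fun y => \det (B y))}.
Proof.
move=> h; apply: cts_sum => s; apply: ctsM; first exact: cts_cst.
by apply: cts_prod => i; exact: h.
Qed.

(** Stated for Cramer's formula because [invmx] is defined by cases on invertibility; the two agree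
    wherever B is invertible. *)
Lemma ctsm_inv (B : rV -> 'M[R]_m) x : ctsm B x -> B x \in unitmx ->
  ctsm (fun y => (\det (B y))^-1 *: \adj (B y)) x.
Proof.
move=> h Bu a b.
have dc : {for x, continuous (fun y => (\det (B y))^-1)}.
  apply: (cts_comp (cts_det h)); apply: inv_continuous.
  by move: Bu; rewrite unitmxE unitfE.
have ac : {for x, continuous (fun y => \adj (B y) a b)}.
  apply: cts_eq (_ : {for x, continuous (fun y => (-1) ^+ (b + a) * \det (row' b (col' a (B y))))}).
    by move=> y; rewrite mxE.
  apply: ctsM; first exact: cts_cst.
  apply: cts_det => c d; apply: cts_eq (h (lift b c) (lift a d)).
  by move=> y; rewrite !mxE.
apply: cts_eq (ctsM dc ac).
by move=> y; rewrite [RHS]mxE.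
Qed.

Lemma ctsm_near p q (B : rV -> 'M[R]_(p, q)) x e : ctsm B x -> 0 < e ->
  \forall y \near x, forall a b, `|B y a b - B x a b| <= e.
Proof.
move=> h e0; apply: near_forallV => a; apply: near_forallV => b.
have := proj1 (cts_atP _ _) (h a b) e e0; apply: nearS => y.
by rewrite distrC.
Qed.

Lemma ctsm_bound p q (B : rV -> 'M[R]_(p, q)) x : ctsm B x ->
  exists2 K : R, 0 <= K & \forall y \near x, forall a b, `|B y a b| <= K.
Proof.
move=> h; exists (1 + \sum_a \sum_b `|B x a b|).
  by rewrite addr_ge0 // sumr_ge0 // => a _; rewrite sumr_ge0.
apply: nearS (ctsm_near h ltr01) => y hy a b.
have : `|B x a b| <= \sum_a \sum_b `|B x a b|.
  rewrite (bigD1 a) //= (bigD1 b) //= -addrA lerDl addr_ge0 //.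
    by apply: sumr_ge0.
  by apply: sumr_ge0 => c _; apply: sumr_ge0.
have := hy a b; have := ler_normD (B y a b - B x a b) (B x a b); rewrite subrK; lra.
Qed.

Lemma bf_cts (B : rV -> 'M[R]_m) (u v : rV -> rV) x : ctsm B x -> ctsm u x -> ctsm v x ->
  {for x, continuous (fun y => bf (B y) (u y) (v y))}.
Proof. by move=> h1 h2 h3; apply: ctsmM; [exact: ctsmM|exact: ctsmT]. Qed.

Lemma pd_lower (B : 'M[R]_m) : pdf B -> exists2 c : R, 0 < c &
  forall v : rV, c * `|v| ^+ 2 <= bf B v v.
Proof.
move=> Bp; pose S : set rV := [set v | `|v| = 1].
(* An empty unit sphere means that 0 is the only vector; otherwise c is the minimum of the form on
   the sphere. *)
have [[v1 Sv1]|noS] := boolp.pselect (S !=set0); last first.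
  exists 1 => // v; have [->|v0] := eqVneq v 0.
    by rewrite normr0 expr0n mulr0 /bf mul0mx mul0mx mxE.
  case: noS; exists (`|v|^-1 *: v); rewrite /S /= normrZ normfV normr_id mulVf //.
  by rewrite normr_eq0.
have ncts x : {for x, continuous (fun v : rV => `|v|)} by exact: norm_continuous.
have Sc : closed S.
  move=> x clx; apply/eqP; rewrite -subr_eq0 -normr_le0; apply/ler_addgt0Pl => e e0.
  have [z [zS zx]] := clx _ (proj1 (cts_atP _ _) (ncts x) e e0).
  by move: zx; rewrite zS addr0.
have bc x : S x -> {for x, continuous (fun v => bf B v v)}.
  by move=> _; apply: bf_cts; [exact: ctsm_cst|move=> a b; rewrite ord1; exact: cts_coord..].
have [x Sx xmin] := @closed_min _ _ S (fun v => bf B v v) 1 (ex_intro _ v1 Sv1) Sc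
  (fun v (Sv : S v) => eq_ind_r (fun t : R => t <= 1) (lexx 1) Sv) bc.
have x0 : x != 0 by rewrite -normr_eq0 Sx oner_eq0.
exists (bf B x x) => [|v]; first exact: Bp.
have [->|v0] := eqVneq v 0.
  by rewrite normr0 expr0n mulr0 /bf mul0mx mul0mx mxE.
have nv : `|v| != 0 by rewrite normr_eq0.
have Sv : S (`|v|^-1 *: v) by rewrite /S /= normrZ normfV normr_id mulVf.
have := xmin _ Sv; rewrite bfZl bfZr mulrA -expr2 exprVn => h.
by rewrite mulrC -ler_pdivlMl ?exprn_gt0 ?normr_gt0.
Qed.

Lemma pd_near (B : rV -> 'M[R]_m) x : ctsm B x -> pdf (B x) ->
  exists2 c : R, 0 < c & \forall y \near x, forall v : rV, c * `|v| ^+ 2 <= bf (B y) v v.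
Proof.
move=> h Bp; have [c c0 cB] := pd_lower Bp.
exists (c / 2); first by rewrite divr_gt0.
pose e := c / (2 * (m%:R * m%:R + 1)).
have mm : 0 <= m%:R * m%:R :> R by exact: mulr_ge0.
have e0 : 0 < e by rewrite divr_gt0 // mulr_gt0 // ltr_wpDl.
apply: nearS (ctsm_near h e0) => y hy v.
have -> : bf (B y) v v = bf (B x) v v + bf (B y - B x) v v.
  by rewrite bf_add bf_opp; ring.
have h1 : `|bf (B y - B x) v v| <= m%:R * m%:R * e * (`|v| * `|v|).
  by apply: bf_le => a b; rewrite !mxE.
have h2 : m%:R * m%:R * e * (`|v| * `|v|) <= c / 2 * (`|v| * `|v|).
  apply: ler_wpM2r; first exact: mulr_ge0.
  rewrite /e mulrA ler_pdivrMr; last by rewrite mulr_gt0 // ltr_wpDl.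
  have : 0 <= c * (m%:R * m%:R) by rewrite mulr_ge0 // ltW.
  lra.
have := cB v; move: h1; rewrite ler_norml expr2 => /andP[h3 _]; lra.
Qed.

End MatrixContinuity.

(** * Smooth functions and the chain rule *)

Section SmoothFunctions.
Context {R : realType} {m : nat}.
Local Notation rV := 'rV[R]_m.
Local Notation e_ a := (delta_mx 0 a : rV).

Definition pd1 (f : rV -> R) (a : 'I_m) (x : rV) : R := 'D_(e_ a) f x.
Definition pd2 (f : rV -> R) (a b : 'I_m) (x : rV) : R := 'D_(e_ a) (pd1 f b) x.

Lemma smooth_C2on (U : set rV) (f : rV -> R) : smooth_on U f -> C2on U f (pd1 f) (pd2 f).
Proof.
move=> fs; have [_ H2] := fs 2%N.
split=> [x Ux a|b x Ux a].
  have [d1 [c1 _]] := H2 a; split; last exact: c1.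
  by split; [exact: d1|].
have [_ [_ /(_ a) [d2 c2]]] := H2 b; split; last by exact: (proj1 c2).
by split; [exact: d2|].
Qed.

Lemma C1on_chain (U V : set rV) (phi : rV -> rV) (D : 'I_m -> 'I_m -> rV -> R)
    (h : rV -> R) dh : open U -> open V ->
  (forall b, C1on U (fun y => phi y 0 b) (D^~ b)) -> (forall x, U x -> V (phi x)) ->
  C1on V h dh ->
  C1on U (h \o phi) (fun a x => \sum_c D a c x * dh c (phi x)).
Proof.
move=> Uo Vo pC UV hC x Ux a.
have [pd jac] := C1_vec_diff Uo pC Ux.
have [hd hdE] := C1_diff Vo hC (UV x Ux).
have pc : {for x, continuous phi} by exact: differentiable_continuous.
split; last first.
  apply: cts_sum => c; apply: ctsM; first by have [_ ] := pC c x Ux a.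
  have [_ dc] := hC _ (UV x Ux) c.
  exact: (continuous_comp pc dc).
have cd : differentiable ((h : rV -> R^o) \o phi) x by exact: differentiable_comp.
split; first exact: diff_derivable.
rewrite (deriveE _ cd) (diff_comp pd hd) /= hdE /lform; apply: eq_bigr => c _.
congr (_ * _); have -> : D a c x = jacobian phi x a c by rewrite jac mxE.
by rewrite /jacobian mxE.
Qed.

(** Turns two expressions of one function, in two charts, into an identity between their
    derivatives. *)
Lemma C1on_unique (U : set rV) (f f' : rV -> R) df df' : open U ->
  C1on U f df -> C1on U f' df' -> (forall x, U x -> f x = f' x) ->
  forall x, U x -> forall a, df a x = df' a x.
Proof.
move=> Uo fC fC' ff x Ux a.
have [d1 _] := fC x Ux a; have [d2 _] := fC' x Ux a.
have <- : 'D_(e_ a) f x = df a x by exact: derive_val.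
have <- : 'D_(e_ a) f' x = df' a x by exact: derive_val.
apply: near_eq_derive.
by apply/nearVP; have [r r0 rU] := open_ballV Uo Ux; exists r => // y /rU /ff.
Qed.

End SmoothFunctions.

(** * Chart independence of i del delbar *)

Section Transition.
Context {R : realType} {m : nat}.
Local Notation rV := 'rV[R]_m.

Variables (U V : set rV) (phi : rV -> rV) (D : 'I_m -> 'I_m -> rV -> R)
  (hphi : 'I_m -> 'I_m -> 'I_m -> rV -> R).
Hypothesis Uo : open U.
Hypothesis Vo : open V.
Hypothesis phiC : forall b, C2on U (fun y => phi y 0 b) (D^~ b) (hphi b).
Hypothesis phiV : forall x, U x -> V (phi x).
Variables (J1 J2 : rV -> 'M[R]_m) (dJ1 dJ2 : 'I_m -> 'I_m -> 'I_m -> rV -> R).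
Hypothesis J1C : forall b c, C1on U (fun y => J1 y b c) (fun a => dJ1 a b c).
Hypothesis J2C : forall b c, C1on V (fun y => J2 y b c) (fun a => dJ2 a b c).
Local Notation Dmx x := (\matrix_(a, b) D a b x).
Hypothesis J1D : forall x, U x -> J1 x *m Dmx x = Dmx x *m J2 (phi x).
Variables (f1 f2 : rV -> R) (df1 df2 : 'I_m -> rV -> R) (hf1 hf2 : 'I_m -> 'I_m -> rV -> R).
Hypothesis f1C : C2on U f1 df1 hf1.
Hypothesis f2C : C2on V f2 df2 hf2.
Hypothesis f12 : forall x, U x -> f1 x = f2 (phi x).

Lemma transition_df x : U x -> forall a, df1 a x = \sum_c D a c x * df2 c (phi x).
Proof.
have pC b := proj1 (phiC b).
exact: (C1on_unique Uo (proj1 f1C) (C1on_chain Uo Vo pC phiV (proj1 f2C)) f12).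
Qed.

Lemma dJdf_C1on (W : set rV) (J : rV -> 'M[R]_m) dJ (f : rV -> R) df hf : open W ->
  (forall b c, C1on W (fun y => J y b c) (fun a => dJ a b c)) -> C2on W f df hf ->
  forall b, C1on W (dJdf J df b) (fun a => ddJdf J dJ df hf a b).
Proof.
move=> Wo JC fC b; have -> : (fun a => ddJdf J dJ df hf a b) = (fun a x =>
    \sum_c (J x b c * hf a c x + df c x * dJ a b c x)).
  apply: boolp.funext => a; apply: boolp.funext => x; apply: eq_bigr => c _; ring.
by apply: C1on_sum => c; apply: C1on_mul => //; exact: (proj2 fC).
Qed.

Lemma transition_dJdf x : U x -> forall b,
  dJdf J1 df1 b x = \sum_c D b c x * dJdf J2 df2 c (phi x).
Proof.
move=> Ux b; rewrite /dJdf.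
have J1D' d : \sum_c J1 x b c * D c d x = \sum_c D b c x * J2 (phi x) c d.
  have := J1D Ux => /matrixP/(_ b d); rewrite !mxE => E.
  transitivity (\sum_c J1 x b c * (\matrix_(a, b) D a b x) c d).
    by apply: eq_bigr => c _; rewrite mxE.
  by rewrite E; apply: eq_bigr => c _; rewrite mxE.
transitivity (\sum_c \sum_d J1 x b c * D c d x * df2 d (phi x)).
  apply: eq_bigr => c _; rewrite transition_df // mulr_sumr.
  by apply: eq_bigr => d _; rewrite mulrA.
rewrite exchange_big /=.
transitivity (\sum_d \sum_c D b c x * J2 (phi x) c d * df2 d (phi x)).
  by apply: eq_bigr => d _; rewrite -!mulr_suml J1D'.
rewrite exchange_big /=; apply: eq_bigr => c _; rewrite mulr_sumr.
by apply: eq_bigr => d _; rewrite mulrA.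
Qed.

(* The second derivatives of [phi] cancel by symmetry. *)
Lemma transition_curl x : U x ->
  curl_mx J1 dJ1 df1 hf1 x = Dmx x *m curl_mx J2 dJ2 df2 hf2 (phi x) *m (Dmx x)^T.
Proof.
move=> Ux.
have dE a b : ddJdf J1 dJ1 df1 hf1 a b x =
  \sum_c (D b c x * (\sum_d D a d x * ddJdf J2 dJ2 df2 hf2 d c (phi x))
          + dJdf J2 df2 c (phi x) * hphi c a b x).
  have pC d := proj1 (phiC d).
  have rC : C1on U (fun y => \sum_c D b c y * (dJdf J2 df2 c \o phi) y)
      (fun a y => \sum_c (D b c y * (\sum_d D a d y * ddJdf J2 dJ2 df2 hf2 d c (phi y))
          + (dJdf J2 df2 c \o phi) y * hphi c a b y)).
    apply: C1on_sum => c; apply: C1on_mul => //.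
      by have := proj2 (phiC c) b.
    exact: C1on_chain Uo Vo pC phiV (dJdf_C1on Vo J2C f2C c).
  have ff y : U y -> dJdf J1 df1 b y = \sum_c D b c y * (dJdf J2 df2 c \o phi) y.
    by move=> Uy; exact: transition_dJdf.
  exact: (C1on_unique Uo (dJdf_C1on Uo J1C f1C b) rC ff Ux a).
apply/matrixP => a b; rewrite mxE !dE !big_split /=.
have -> : \sum_i dJdf J2 df2 i (phi x) * hphi i a b x =
          \sum_i dJdf J2 df2 i (phi x) * hphi i b a x.
  by apply: eq_bigr => c _; rewrite (schwarz a b Uo (phiC c) Ux).
rewrite opprD addrACA subrr addr0.
have -> : \sum_c D b c x * (\sum_d D a d x * ddJdf J2 dJ2 df2 hf2 d c (phi x)) =
  \sum_c \sum_d D a d x * ddJdf J2 dJ2 df2 hf2 d c (phi x) * D b c x.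
  by apply: eq_bigr => c _; rewrite mulr_sumr; apply: eq_bigr => d _; rewrite mulrC.
have -> : \sum_c D a c x * (\sum_d D b d x * ddJdf J2 dJ2 df2 hf2 d c (phi x)) =
  \sum_c \sum_d D a d x * ddJdf J2 dJ2 df2 hf2 c d (phi x) * D b c x.
  rewrite exchange_big /=; apply: eq_bigr => c _; rewrite mulr_sumr.
  by apply: eq_bigr => d _; ring.
rewrite -sumrB mxE; apply: eq_bigr => c _.
rewrite !mxE -sumrB mulr_suml; apply: eq_bigr => d _; rewrite !mxE; ring.
Qed.

Lemma transition_beta x : U x -> beta_mx J1 dJ1 df1 hf1 x =
  Dmx x *m beta_mx J2 dJ2 df2 hf2 (phi x) *m (Dmx x)^T.
Proof.
move=> Ux; rewrite /beta_mx transition_curl // -scalemxAr -scalemxAl; congr (_ *: _).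
rewrite mulmxDr mulmxDl; congr (_ + _).
rewrite !mulmxA J1D // -!mulmxA -trmx_mul J1D //.
by rewrite trmx_mul !mulmxA.
Qed.

End Transition.

(** * Generalized Kahler manifolds in charts *)

Section ChartData.
Context {R : realType} {n : nat} {M : topologicalType}.
Local Notation m := (n + n)%N.
Local Notation rV := 'rV[R]_m.
Local Notation C := R[i].
Local Notation toC := (map_mx (real_complex R)).
Variables (A : smooth_atlas R m M) (g JA JB : tensor A).
Hypothesis gK : generalized_kahler g JA JB.
Hypothesis commAB : commuting JA JB.

Local Notation Pi := (Pi_of JA JB).

Lemma open_chart_img (i : chart_index A) : open (chart_img i).
Proof. exact: chart_img_open. Qed.

Lemma chart_inv_dom (i : chart_index A) x : chart_img i x -> chart_dom i (chart_inv i x).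
Proof. by move=> [p pi <-]; rewrite chartK. Qed.

Lemma chart_invK (i : chart_index A) x : chart_img i x -> chart i (chart_inv i x) = x.
Proof. by move=> [p pi <-]; rewrite chartK. Qed.

Lemma overlapP (i j : chart_index A) x :
  overlap i j x <-> chart_img i x /\ chart_dom j (chart_inv i x).
Proof.
split=> [[p [pi pj] <-]|[xi xj]].
  by rewrite chartK //; split => //; exists p.
by exists (chart_inv i x); [split => //; exact: chart_inv_dom|exact: chart_invK].
Qed.

Lemma overlap_open (i j : chart_index A) : open (overlap i j).
Proof.
rewrite openE => x /overlapP[xi xj].
have h1 : \forall y \near x, chart_img i y.
  by apply: open_nbhs_nbhs; split => //; exact: chart_img_open.
have h2 : \forall y \near x, chart_dom j (chart_inv i y).
  apply: (chart_inv_continuous xi); apply: open_nbhs_nbhs; split => //.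
  exact: chart_dom_open.
apply: nearS (nearI h1 h2) => y [y1 y2]; exact/overlapP.
Qed.

Lemma transition_img (i j : chart_index A) x : overlap i j x -> chart_img j (transition i j x).
Proof. by move=> /overlapP[xi xj]; exists (chart_inv i x). Qed.

Lemma smooth_ctsm p q (U : set rV) (F : rV -> 'M[R]_(p, q)) x :
  smooth_mx_on U F -> U x -> ctsm F x.
Proof. by move=> Fs Ux a b; have [c _] := Fs a b 0%N; exact: c. Qed.

Section At.
Variables (i : chart_index A) (x : rV).
Hypothesis Ux : chart_img i x.

Lemma gk_sym : (g i x)^T = g i x.
Proof. by have [] := proj2 (gk_metric gK) i x Ux. Qed.

Lemma gk_pos : pdf (g i x).
Proof. by have [_] := proj2 (gk_metric gK) i x Ux. Qed.

Lemma gk_JJ : JA i x *m JA i x = - 1%:M.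
Proof. by have [_ + _] := gk_JA gK; apply. Qed.

Lemma gk_Jg : JA i x *m g i x *m (JA i x)^T = g i x.
Proof. exact: gk_hermitian_A gK _ _ Ux. Qed.

Lemma gk_JPi : JA i x *m Pi i x = Pi i x *m JA i x.
Proof. by rewrite /Pi_of mulmxA commAB. Qed.

Lemma gk_PiPi : Pi i x *m Pi i x = 1%:M.
Proof.
rewrite /Pi_of -mulmxA [JA i x *m _]mulmxA commAB // -mulmxA gk_JJ mulmxN mulmx1.
have [_ + _] := gk_JB gK => JBJ.
by rewrite mulmxN JBJ // opprK.
Qed.

Lemma gk_g_ctsm : ctsm (g i) x.
Proof. exact: smooth_ctsm (proj1 (proj1 (gk_metric gK)) i) Ux. Qed.

Lemma gk_JA_ctsm : ctsm (JA i) x.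
Proof. by have [[Js _] _ _] := gk_JA gK; exact: smooth_ctsm (Js i) Ux. Qed.

Lemma gk_Pi_ctsm : ctsm (Pi i) x.
Proof.
apply: ctsmM gk_JA_ctsm.
by have [[Js _] _ _] := gk_JB gK; exact: smooth_ctsm (Js i) Ux.
Qed.

Lemma gk_proj_ctsm eps : ctsm (fun y => proj_pm (Pi i y) eps) x.
Proof. by apply/ctsmZ/ctsmD; [exact: ctsm_cst|apply/ctsmZ/gk_Pi_ctsm]. Qed.

End At.

Definition dJA (i : chart_index A) (a b c : 'I_m) : rV -> R := pd1 (fun y => JA i y b c) a.

Lemma JA_C1on i b c : C1on (chart_img i) (fun y => JA i y b c) (fun a => dJA i a b c).
Proof. by have [[Js _] _ _] := gk_JA gK; exact: proj1 (smooth_C2on (Js i b c)). Qed.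

Lemma dJA_mx_ctsm i c x : chart_img i x -> ctsm (dJ_mx (dJA i) c) x.
Proof.
move=> Ux a b; apply: cts_eq (_ : {for x, continuous (fun y => dJA i a b c y + - dJA i b a c y)}).
  by move=> y; rewrite !mxE.
have h a' b' : {for x, continuous (dJA i a' b' c)} by have [_] := @JA_C1on i b' c x Ux a'.
by apply: ctsD => //; apply: ctsN.
Qed.

Variable u : M -> R.
Hypothesis us : smooth_fun A u.

Local Notation f i := (u \o chart_inv i).
Definition ddbar_mx (i : chart_index A) (x : rV) : 'M[R]_m :=
  beta_mx (JA i) (dJA i) (pd1 (f i)) (pd2 (f i)) x.
Local Notation beta := ddbar_mx.

Lemma chart_C2on (i : chart_index A) : C2on (chart_img i) (f i) (pd1 (f i)) (pd2 (f i)).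
Proof. exact: smooth_C2on (us i). Qed.

Lemma chart_hess_sym (i : chart_index A) x : chart_img i x -> (hess (pd2 (f i)) x)^T = hess (pd2 (f i)) x.
Proof.
move=> Ux; apply/matrixP => a b; rewrite !mxE.
exact: (schwarz b a (@open_chart_img i) (chart_C2on i) Ux).
Qed.

Lemma ddbar_mxE i x w : chart_img i x ->
  ddbar (JA i) (f i) x w = form_mx (beta i x) x w.
Proof.
by move=> Ux; exact: (ddbarE (@open_chart_img i) (@JA_C1on i) (@gk_JJ i) (chart_C2on i)).
Qed.

Lemma ddbar_mxJ i x : chart_img i x -> JA i x *m beta i x *m (JA i x)^T = beta i x.
Proof. by move=> Ux; apply: (@beta_J _ _ _ (chart_img i)) => // y; exact: gk_JJ. Qed.

Lemma ddbar_mx_anti i x : (beta i x)^T = - beta i x.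
Proof. exact: beta_anti. Qed.

Lemma omega_pmE eps i x w : chart_img i x ->
  omega_pm g JA JB eps i x w = form_mx (omega_mx (g i x) (JA i x) (Pi i x) eps) x w.
Proof.
by move=> Ux; rewrite /omega_pm (part_pm_mx _ _ (N := JA i x *m g i x)) //; apply/JgJ/gk_Jg.
Qed.

Lemma ddbar_pmE eps i x w : chart_img i x ->
  ddbar_pm JA JB eps u i x w =
  form_mx (proj_pm (Pi i x) eps *m beta i x *m (proj_pm (Pi i x) eps)^T) x w.
Proof.
move=> Ux; rewrite /ddbar_pm (part_pm_mx _ _ (N := beta i x)) //.
  by move=> w'; exact: ddbar_mxE.
exact: ddbar_mxJ.
Qed.

Lemma form_mxD (N N' : 'M[R]_m) x w : form_mx (N + N') x w = form_mx N x w + form_mx N' x w.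
Proof. by rewrite !form_mx_pair pair_form_add. Qed.

Lemma form_mxB (N N' : 'M[R]_m) x w : form_mx (N - N') x w = form_mx N x w - form_mx N' x w.
Proof.
rewrite !form_mx_pair pair_form_add -scaleN1r pair_form_scale.
by rewrite rmorphN1 mulN1r.
Qed.

Lemma wedge_plus k F i x v : chart_img i x ->
  wedge_pow (fun y w => omega_pm g JA JB 1 i y w + ddbar_pm JA JB 1 u i y w) k x v =
    F%:C * wedge_pow (omega_pm g JA JB 1 i) k x v ->
  wedge_pow (form_mx (proj_pm (Pi i x) 1 *m (JA i x *m g i x + beta i x) *m
                      (proj_pm (Pi i x) 1)^T)) k x v =
    F%:C * wedge_pow (form_mx (omega_mx (g i x) (JA i x) (Pi i x) 1)) k x v.
Proof.
move=> Ux H.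
rewrite (wedge_pow_ext (a' := fun y w => omega_pm g JA JB 1 i y w + ddbar_pm JA JB 1 u i y w)).
  by rewrite H; congr (_ * _); apply: wedge_pow_ext => w; rewrite omega_pmE.
by move=> w; rewrite omega_pmE // ddbar_pmE // -form_mxD -mulmxDl -mulmxDr.
Qed.

Lemma wedge_minus k F i x v : chart_img i x ->
  wedge_pow (fun y w => omega_pm g JA JB (-1) i y w - ddbar_pm JA JB (-1) u i y w) k x v =
    F%:C * wedge_pow (omega_pm g JA JB (-1) i) k x v ->
  wedge_pow (form_mx (proj_pm (Pi i x) (-1) *m (JA i x *m g i x - beta i x) *m
                      (proj_pm (Pi i x) (-1))^T)) k x v =
    F%:C * wedge_pow (form_mx (omega_mx (g i x) (JA i x) (Pi i x) (-1))) k x v.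
Proof.
move=> Ux H.
rewrite (wedge_pow_ext (a' := fun y w => omega_pm g JA JB (-1) i y w - ddbar_pm JA JB (-1) u i y w)).
  by rewrite H; congr (_ * _); apply: wedge_pow_ext => w; rewrite omega_pmE.
by move=> w; rewrite omega_pmE // ddbar_pmE // -form_mxB -mulmxBl -mulmxBr.
Qed.

Lemma mx_of_form_mx (a : @Defs.form R m 2) N x : (forall w, a x w = form_mx N x w) ->
  mx_of_form a x = toC N.
Proof.
move=> aN; apply/matrixP => s t; rewrite !mxE aN /form_mx /= -rowE trmx_delta -colE.
by rewrite !mxE.
Qed.

Definition lap_A (i : chart_index A) (x : rV) : 'M[R]_m := 2^-1 *: invmx (g i x).
Definition lap_B (i : chart_index A) (x : rV) (c : 'I_m) : R :=
  4^-1 * \tr (invmx (g i x) *m JA i x *m dJ_mx (dJA i) c x).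

Lemma trace_formE i x : chart_img i x ->
  complex.Re (trace_form (fundamental_form g JA i) (ddbar (JA i) (f i)) x) =
  Lop (lap_A i x) (lap_B i x) (hess (pd2 (f i)) x) ((pd1 (f i))^~ x).
Proof.
move=> Ux; rewrite /trace_form (@mx_of_form_mx _ (JA i x *m g i x)) //.
rewrite (@mx_of_form_mx _ (beta i x)); last by move=> w; exact: ddbar_mxE.
rewrite -map_invmx -map_mxM trace_map_mx /lap_A /lap_B.
rewrite -(trace_hess (dJA i) (pd1 (f i)) (chart_hess_sym Ux) (gk_JJ Ux) (gk_pos Ux) (gk_Jg Ux)).
by rewrite halfC -rmorphM.
Qed.

Lemma ddbar_mx_form i x v : chart_img i x -> bf (beta i x) v (v *m JA i x) =
  2^-1 * (bf (hess (pd2 (f i)) x) v v +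
          bf (hess (pd2 (f i)) x) (v *m JA i x) (v *m JA i x))
  - 2^-1 * bf (torsion_mx (dJA i) (pd1 (f i)) x) v (v *m JA i x).
Proof. by move=> Ux; apply: beta_form; [exact: chart_hess_sym|exact: gk_JJ]. Qed.

(* Positivity of omega_- - i del_- delbar_- u at [x]. *)
Definition minus_pos (i : chart_index A) (x : rV) :=
  forall v, v != 0 -> eigen (Pi i x) (-1) v ->
    bf (beta i x) v (v *m JA i x) < bf (g i x) v v.

(** All tensors involved transform by the differential of the transition map, so positivity is a
    property of the point of M and the connectedness argument makes sense. *)
Lemma minus_pos_transition i j x : overlap i j x ->
  minus_pos j (transition i j x) -> minus_pos i x.
Proof.
move=> xij posj v v0 vE.
have [xi xj] := proj1 (overlapP i j x) xij.
pose phi := transition i j.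
pose D a b := pd1 (fun y => phi y 0 b) a.
have phiC b : C2on (overlap i j) (fun y => phi y 0 b) (D^~ b) (pd2 (fun y => phi y 0 b)).
  by apply: smooth_C2on; exact: (chart_transition i j 0 b).
have OU y : overlap i j y -> chart_img i y by move=> /overlapP[].
have [_ DE] := C1_vec_diff (@overlap_open i j) (fun b => proj1 (phiC b)) xij.
have DEy y : overlap i j y -> jacobian phi y = \matrix_(a, b) D a b y.
  by move=> yij; have [] := C1_vec_diff (@overlap_open i j) (fun b => proj1 (phiC b)) yij.
have [[_ JAt] _ _] := gk_JA gK; have [[_ JBt] _ _] := gk_JB gK.
have gt := proj2 (proj1 (gk_metric gK)).
have JD y : overlap i j y ->
    JA i y *m (\matrix_(a, b) D a b y) = (\matrix_(a, b) D a b y) *m JA j (phi y).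
  by move=> yij; rewrite -DEy //; exact: JAt.
have f12 y : overlap i j y -> f i y = f j (phi y).
  by move=> /overlapP[y1 y2]; rewrite /phi /transition /= chartK.
have JC1 b c := C1on_sub OU (@JA_C1on i b c).
have fC1 : C2on (overlap i j) (f i) (pd1 (f i)) (pd2 (f i)).
  by have [h1 h2] := chart_C2on i; split=> [|b]; [exact: C1on_sub h1|exact: C1on_sub (h2 b)].
have bE := transition_beta (@overlap_open i j) (@open_chart_img j) phiC
  (@transition_img i j) JC1 (@JA_C1on j) JD fC1 (chart_C2on j) f12 xij.
rewrite -DE in bE; set Dx := jacobian phi x in bE *.
have gE : g i x = Dx *m g j (phi x) *m Dx^T by exact: gt.
have JE : JA i x *m Dx = Dx *m JA j (phi x) by exact: JAt.
have BE : JB i x *m Dx = Dx *m JB j (phi x) by exact: JBt.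
have w0 : v *m Dx != 0.
  apply: contraNneq v0 => w0; have := @gk_pos i x xi v.
  rewrite gE bf_mul w0 /bf !mul0mx mxE ltxx => h.
  exact: contraT h.
have wE : eigen (Pi j (phi x)) (-1) (v *m Dx).
  rewrite /eigen /Pi_of -!mulmxA [Dx *m _]mulmxA -BE -!mulmxA -JE.
  by rewrite scalemxAl -vE /Pi_of !mulmxA.
have := posj _ w0 wE; rewrite -/phi gE bf_mul.
suff -> : bf (beta i x) v (v *m JA i x) = bf (beta j (phi x)) (v *m Dx) (v *m Dx *m JA j (phi x)) by [].
by rewrite /ddbar_mx bE bf_mul -!mulmxA JE.
Qed.

End ChartData.

(** * Global positivity on T_- *)

Section CompactUniform.
Context {R : realType} {M : topologicalType}.

(** Compactness in near-covering form, with the filter at +oo for the bound; monotonicity in B makes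
    local bounds valid for all larger ones. *)
Lemma compact_unif (P : M -> R -> Prop) : compact [set: M] ->
  (forall (p : M) (B B' : R), B <= B' -> P p B -> P p B') ->
  (forall p : M, exists B : R, \forall q \near p, P q B) -> exists B : R, forall q, P q B.
Proof.
move=> /compact_near_coveringP Mc mono loc.
have Hcov x : [set: M] x -> \forall z \near x & B \near (+oo : set_system R), P z B.
  move=> _; have [B HB] := loc x.
  exists ([set z | P z B], [set B' | B <= B']); first by split => //; exact: nbhs_pinfty_ge (num_real B).
  by move=> [z B'] [/= zB BB']; exact: mono zB.
have [B HB] := @filter_ex _ _ _ _ (Mc R _ (fun B q => P q B) _ Hcov).
by exists B => q; exact: HB.
Qed.

(** The continuity method. Closedness is phrased by neighbourhoods that meet P, so that a good point
    can be chosen inside a coordinate cube. *)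
Lemma connected_unif (P : M -> Prop) : connected [set: M] ->
  (exists p, P p) -> (forall p, P p -> \forall q \near p, P q) ->
  (forall p, (forall V, nbhs p V -> exists2 q, V q & P q) -> P p) -> forall p, P p.
Proof.
move=> Mconn [p0 Pp0] Po Pc p.
have E : [set q | P q] = [set: M].
  apply: Mconn; first by exists p0.
    exists [set q | P q]; last by rewrite setTI.
    by rewrite openE => q /Po.
  exists [set q | P q]; last by rewrite setTI.
  move=> q clq; apply: Pc => V Vq; have [z [/= Pz Vz]] := clq _ Vq.
  by exists z.
have : [set: M] p by [].
by rewrite -E.
Qed.

Lemma continuous_max (u : M -> R) : compact [set: M] -> [set: M] !=set0 ->
  continuous u -> exists p, forall q, u q <= u p.
Proof.
move=> Mc M0 uc.
have [p _ pmax] := compact_EVT_max M0 Mc (continuous_subspaceT uc).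
by exists p => q; apply: pmax; rewrite inE.
Qed.

End CompactUniform.

Section GlobalPositivity.
Context {R : realType} {n : nat} {M : topologicalType}.
Local Notation m := (n + n)%N.
Local Notation rV := 'rV[R]_m.
Variables (A : smooth_atlas R m M) (g JA JB : tensor A).
Hypothesis gK : generalized_kahler g JA JB.
Hypothesis commAB : commuting JA JB.
Local Notation Pi := (Pi_of JA JB).
Variables k l : nat.
Hypothesis rank_plus : forall i x, chart_img i x -> rank_T (JA i) (Pi i) 1 x = k.
Hypothesis rank_minus : forall i x, chart_img i x -> rank_T (JA i) (Pi i) (-1) x = l.
Hypothesis M_nonempty : [set: M] !=set0.
Hypothesis M_compact : compact [set: M].
Hypothesis M_connected : connected [set: M].

Variable u : M -> R.
Hypothesis us : smooth_fun A u.
Local Notation f i := (u \o chart_inv i).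
Local Notation beta i x := (ddbar_mx JA u i x).
Local Notation P eps i x := (proj_pm (Pi i x) eps).

Lemma chart_near (p : M) (i : chart_index A) (Q : rV -> Prop) : chart_dom i p ->
  (\forall y \near chart i p, Q y) -> \forall q \near p, chart_dom i q /\ Q (chart i q).
Proof.
move=> pi Qx.
have h1 : \forall q \near p, chart_dom i q.
  by apply: open_nbhs_nbhs; split => //; exact: chart_dom_open.
have h2 : \forall q \near p, Q (chart i q) by exact: (chart_continuous pi Qx).
have F : Filter (nbhs p) by exact: nbhs_filter.
by apply: filterS (filterI h1 h2).
Qed.

Lemma chart_img_at (p : M) (i : chart_index A) : chart_dom i p -> chart_img i (chart i p).
Proof. by move=> pi; exists p. Qed.

Lemma chart_fE (p : M) (i : chart_index A) : chart_dom i p -> f i (chart i p) = u p.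
Proof. by move=> pi; rewrite /= chartK. Qed.

Lemma smooth_continuous : continuous u.
Proof.
move=> p; have [i pi] := chart_cover A p.
have Ux := chart_img_at pi.
have fc : {for chart i p, continuous (f i)}.
  exact: (C1_cts (@open_chart_img _ _ _ _ i) (proj1 (chart_C2on us i)) Ux).
suff : u @ (nbhs p) --> (u p : R^o) by [].
have F : Filter (nbhs p) by exact: nbhs_filter.
apply/cvgrPdist_le => e e0.
have := chart_near pi (proj1 (cts_atP _ _) fc e e0).
by apply: filterS => q [qi]; rewrite !chart_fE.
Qed.

Lemma ddbar_mx_ctsm i x : chart_img i x -> ctsm (ddbar_mx JA u i) x.
Proof.
move=> Ux; have JAc := gk_JA_ctsm gK Ux.
have cc : ctsm (curl_mx (JA i) (dJA JA i) (pd1 (f i)) (pd2 (f i))) x.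
  have dc a b : {for x, continuous (ddJdf (JA i) (dJA JA i) (pd1 (f i)) (pd2 (f i)) a b)}.
    apply: cts_sum => c; apply: ctsD; apply: ctsM.
    - by have [_] := JA_C1on gK b c Ux a.
    - exact: (C1_cts (@open_chart_img _ _ _ _ i) (proj2 (chart_C2on us i) c) Ux).
    - exact: JAc.
    - by have [_] := proj2 (chart_C2on us i) c x Ux a.
  move=> a b; apply: cts_eq (ctsD (dc a b) (ctsN (dc b a))).
  by move=> y; rewrite mxE.
apply: ctsmZ; apply: ctsmD => //; apply: ctsmM; last exact: ctsmT.
exact: ctsmM.
Qed.

Lemma minus_bf i x v : bf (beta i x) v (v *m JA i x) = bf (beta i x *m (JA i x)^T) v v.
Proof. by rewrite /bf trmx_mul !mulmxA. Qed.

Lemma minus_mx_sym i x : chart_img i x ->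
  (g i x - beta i x *m (JA i x)^T)^T = g i x - beta i x *m (JA i x)^T.
Proof.
move=> Ux; have JJ := gk_JJ gK Ux.
rewrite linearB /= (gk_sym gK Ux) trmx_mul trmxK ddbar_mx_anti mulmxN opprK.
have := ddbar_mxJ gK u Ux => /(congr1 (fun N => N *m (JA i x)^T)).
rewrite -!mulmxA -trmx_mul JJ linearN /= trmx1 !mulmxN mulmx1 => <-.
by rewrite opprK.
Qed.

(** T_- varies with the point, so the form on T_- is completed by g on T_+ to a form on the whole
    tangent space, whose positive definiteness is an open condition. *)
Lemma minus_pos_open i x : chart_img i x -> minus_pos g JA JB u i x ->
  \forall y \near x, minus_pos g JA JB u i y.
Proof.
move=> Ux pos.
pose K y := P 1 i y *m g i y *m (P 1 i y)^T
  + P (-1) i y *m (g i y - beta i y *m (JA i y)^T) *m (P (-1) i y)^T.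
have Pc eps : ctsm (fun y => P eps i y) x := @gk_proj_ctsm _ _ _ _ _ _ _ gK i x Ux eps.
have gc := gk_g_ctsm gK Ux; have Jc := gk_JA_ctsm gK Ux; have bc := ddbar_mx_ctsm Ux.
have Kc : ctsm K x.
  exact: ctsmD (ctsmM (ctsmM (Pc 1) gc) (ctsmT (Pc 1)))
    (ctsmM (ctsmM (Pc (-1)) (ctsmB gc (ctsmM bc (ctsmT Jc)))) (ctsmT (Pc (-1)))).
have KE y v : bf (K y) v v = bf (g i y) (v *m P 1 i y) (v *m P 1 i y)
   + (bf (g i y) (v *m P (-1) i y) (v *m P (-1) i y)
      - bf (beta i y) (v *m P (-1) i y) (v *m P (-1) i y *m JA i y)).
  by rewrite bf_add !bf_mul bf_add bf_opp minus_bf.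
have PP := gk_PiPi gK commAB Ux.
have E1 v : eigen (Pi i x) (-1) (v *m P (-1) i x).
  by apply: proj_pm_eigen => //; rewrite mulrNN mulr1.
have Kp : pdf (K x).
  move=> v v0; rewrite KE.
  have a0 : 0 <= bf (g i x) (v *m P 1 i x) (v *m P 1 i x).
    have [->|/(gk_pos gK Ux)/ltW//] := eqVneq (v *m P 1 i x) 0.
    by rewrite /bf !mul0mx mxE.
  have [w0|w0] := eqVneq (v *m P (-1) i x) 0.
    have bf0 (B : 'M[R]_m) w : bf B 0 w = 0 by rewrite /bf !mul0mx mxE.
    rewrite w0 !bf0 subrr addr0; apply: (gk_pos gK Ux).
    apply: contraNneq v0 => w1.
    by rewrite -[v]mulmx1 -(proj_sum (Pi i x)) mulmxDr w1 w0 addr0.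
  by rewrite ltr_wpDl // subr_gt0; apply: pos.
have [c c0 cK] := pd_near Kc Kp.
have Un : \forall y \near x, chart_img i y.
  by apply: open_nbhs_nbhs; split => //; exact: open_chart_img.
apply: nearS (nearI Un cK) => y [Uy cy] v v0 vE.
have PPy := gk_PiPi gK commAB Uy.
have vm : v *m P (-1) i y = v by apply: proj_pm_id => //; rewrite mulrNN mulr1.
have vp : v *m P 1 i y = 0.
  have : v *m (P 1 i y + P (-1) i y) = v by rewrite proj_sum mulmx1.
  by rewrite mulmxDr vm -[X in _ = X]add0r => /addIr.
have := cy v; rewrite KE vp vm.
have -> : bf (g i y) 0 0 = 0 by rewrite /bf !mul0mx mxE.
rewrite add0r -subr_gt0; apply: lt_le_trans.
by rewrite mulr_gt0 // exprn_gt0 // normr_gt0.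
Qed.

(** In the limit the form on T_- is still semidefinite. A vector of T_- at which it vanishes lies in
    its kernel, contradicting the nondegeneracy forced by the equation with F > 0. *)
Lemma minus_pos_closed i x F : chart_img i x -> 0 < F ->
  (forall v, wedge_pow (form_mx (P (-1) i x *m (JA i x *m g i x - beta i x) *m
                      (P (-1) i x)^T)) l x v =
    F%:C * wedge_pow (form_mx (omega_mx (g i x) (JA i x) (Pi i x) (-1))) l x v) ->
  (forall r : R, 0 < r -> exists y,
     [/\ `|y - x| < r, chart_img i y & minus_pos g JA JB u i y]) ->
  minus_pos g JA JB u i x.
Proof.
move=> Ux F0 W lim.
pose T y := g i y - beta i y *m (JA i y)^T.
pose N y := P (-1) i y *m T y *m (P (-1) i y)^T.
have Tc : ctsm T x.
  apply: ctsmB; first exact: (gk_g_ctsm gK Ux).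
  by apply: ctsmM; [exact: ddbar_mx_ctsm|apply: ctsmT; exact: (gk_JA_ctsm gK Ux)].
have Pc : ctsm (fun y => P (-1) i y) x := @gk_proj_ctsm _ _ _ _ _ _ _ gK i x Ux (-1).
have Nc : ctsm N x by exact: ctsmM (ctsmM Pc Tc) (ctsmT Pc).
have TE y v : bf (T y) v v = bf (g i y) v v - bf (beta i y) v (v *m JA i y).
  by rewrite bf_add bf_opp minus_bf.
have Np : psd (N x).
  move=> v; rewrite leNgt; apply/negP => neg.
  have cN : {for x, continuous (fun y => bf (N y) v v)}.
    by apply: bf_cts => //; exact: ctsm_cst.
  have e0 : 0 < - bf (N x) v v / 2 by rewrite divr_gt0 // oppr_gt0.
  have [r r0 rH] := proj1 (nearVP _ _) (proj1 (cts_atP _ _) cN _ e0).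
  have [y [yx Uy posy]] := lim r r0.
  have := rH y yx; rewrite ler_norml => /andP[h _].
  suff : 0 <= bf (N y) v v by lra.
  rewrite /N bf_mul TE.
  have PPy := gk_PiPi gK commAB Uy.
  have E1 : eigen (Pi i y) (-1) (v *m P (-1) i y).
    by apply: proj_pm_eigen => //; rewrite mulrNN mulr1.
  have [w0|w0] := eqVneq (v *m P (-1) i y) 0; first by rewrite w0 /bf !mul0mx mxE subrr.
  by rewrite subr_ge0 ltW //; apply: posy.
have PP := gk_PiPi gK commAB Ux; have JJ := gk_JJ gK Ux.
have JPi := gk_JPi commAB Ux; have Jg := gk_Jg gK Ux.
have m1 : (-1 : R) * -1 = 1 by rewrite mulrNN mulr1.
move=> v v0 vE.
have vm : v *m P (-1) i x = v by exact: proj_pm_id.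
have NE : bf (N x) v v = bf (g i x) v v - bf (beta i x) v (v *m JA i x).
  by rewrite /N bf_mul vm TE.
have := Np v; rewrite NE le_eqVlt subr_gt0 => /orP[/eqP E0|//]; exfalso.
have Ns : (N x)^T = N x by rewrite /N !trmx_mul trmxK minus_mx_sym // mulmxA.
have vN : v *m N x = 0.
  apply/rowP => a; have := psd_null Ns Np (etrans NE (esym E0)) (delta_mx 0 a).
  by rewrite /bf trmx_delta -colE !mxE.
apply: (wedge_nondeg (gk_sym gK Ux) (gk_pos gK Ux) JJ Jg JPi m1 (rank_minus Ux) _ F0 W v0 vE).
  apply: conj_proj_anti; rewrite linearB /= ddbar_mx_anti opprK opprB addrC.
  by rewrite (Jg_anti (gk_sym gK Ux) JJ Jg).
(* The symmetric form [N x] is the 2-form times J^T, so their kernels coincide. *)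
have JTu : (JA i x)^T \in unitmx by rewrite unitmx_tr; exact: unit_JJ.
suff vJT : v *m (P (-1) i x *m (JA i x *m g i x - beta i x) *m (P (-1) i x)^T) *m (JA i x)^T = 0.
  by move: vJT => /(congr1 (fun N => N *m invmx (JA i x)^T)); rewrite mulmxK // mul0mx.
rewrite -[RHS]vN /N -!mulmxA; congr (v *m (_ *m _)).
rewrite -trmx_mul proj_pmJ // trmx_mul mulmxA; congr (_ *m _).
by rewrite mulmxBl Jg.
Qed.

(** At a maximum the gradient, hence the torsion, vanishes and the Hessian is nonpositive, so i del
    delbar u <= 0 < g. *)
Lemma minus_pos_max i x : chart_img i x -> (\forall y \near x, f i y <= f i x) ->
  minus_pos g JA JB u i x.
Proof.
move=> Ux fmax v v0 vE.
have Uo := @open_chart_img _ _ _ _ i.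
pose h y := (-1) * f i y.
have hC : C2on (chart_img i) h (fun a y => (-1) * pd1 (f i) a y)
    (fun a b y => (-1) * pd2 (f i) a b y).
  have [h1 h2] := chart_C2on us i.
  by split=> [|b]; apply: C1on_scale.
have hmin : \forall y \near x, h x <= h y by apply: nearS fmax => y; rewrite /h; lra.
have df0 a : pd1 (f i) a x = 0.
  by have := C1_min Uo (proj1 hC) Ux hmin a; lra.
have Hp := C2_min_psd Uo hC Ux hmin.
have HE : hess (fun a b y => (-1) * pd2 (f i) a b y) x = - hess (pd2 (f i)) x.
  by apply/matrixP => a b; rewrite !mxE mulN1r.
have Z0 : torsion_mx (dJA JA i) (pd1 (f i)) x = 0.
  by rewrite /torsion_mx big1 // => c _; rewrite df0 scale0r.
rewrite (ddbar_mx_form gK us v Ux) Z0.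
have -> : bf (0 : 'M[R]_m) v (v *m JA i x) = 0 by rewrite /bf mulmx0 mul0mx mxE.
have := Hp v; have := Hp (v *m JA i x); rewrite HE !bf_opp.
have := gk_pos gK Ux v0; lra.
Qed.

Hypothesis wedge_m : exists Fm : M -> R, forall i x v, chart_img i x ->
  wedge_pow (fun y w => omega_pm g JA JB (-1) i y w - ddbar_pm JA JB (-1) u i y w) l x v =
  (expR (Fm (chart_inv i x)))%:C * wedge_pow (omega_pm g JA JB (-1) i) l x v.

(* Positivity holds at a maximum of [u], is an open condition, and is closed
   because the top power of omega_- - i del_- delbar_- u never degenerates. *)
Lemma minus_pos_everywhere i x : chart_img i x -> minus_pos g JA JB u i x.
Proof.
move=> Ux; have [Fm W] := wedge_m.
pose G (p : M) := exists2 j : chart_index A, chart_dom j p & minus_pos g JA JB u j (chart j p).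
have Gi p (j : chart_index A) : chart_dom j p -> G p -> minus_pos g JA JB u j (chart j p).
  move=> pj [j' pj' pos]; apply: (minus_pos_transition gK us (j := j')).
    by exists p.
  by rewrite /transition /= chartK.
suff GT : forall p, G p.
  by rewrite -(chart_invK Ux); apply: Gi (GT _); exact: chart_inv_dom.
apply: connected_unif M_connected _ _ _.
- have [p pmax] := continuous_max M_compact M_nonempty smooth_continuous.
  have [j pj] := chart_cover A p; exists p, j => //.
  apply: minus_pos_max; first exact: chart_img_at.
  by apply/nearVP; exists 1 => // y _; rewrite chart_fE //=; exact: pmax.
- move=> p [j pj pos].
  have := chart_near pj (minus_pos_open (chart_img_at pj) pos).
  have F : Filter (nbhs p) by exact: nbhs_filter.
  by apply: filterS => q [qj posq]; exists j.
- move=> p lim; have [j pj] := chart_cover A p; exists j => //.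
  apply: (minus_pos_closed (F := expR (Fm p)) (chart_img_at pj) (expR_gt0 _)).
    move=> v; apply: (wedge_minus gK us (chart_img_at pj)).
    by rewrite W; [rewrite chartK|exact: chart_img_at].
  move=> r r0.
  have nb : \forall y \near chart j p, `|y - chart j p| < r by apply/nearVP; exists r.
  have [q [qj qr] Gq] := lim _ (chart_near pj nb).
  by exists (chart j q); split; [exact: qr|exact: chart_img_at|exact: Gi].
Qed.

(** F_+ is an arbitrary function tied to u only by the equation. Its range must be bounded above for
    [sup (range Fp)] to bound it, since [sup] has a default value otherwise. *)
Lemma ratio_bounded (Fp : M -> R) : (forall i x v, chart_img i x ->
    wedge_pow (fun y w => omega_pm g JA JB 1 i y w + ddbar_pm JA JB 1 u i y w) k x v =
    (expR (Fp (chart_inv i x)))%:C * wedge_pow (omega_pm g JA JB 1 i) k x v) ->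
  has_ubound (range Fp).
Proof.
move=> W.
have [Kw Kw0 Kw_le] := @wedge_pow_le R m k.
have [B HB] : exists B, forall q, Fp q <= B.
  apply: compact_unif => // [p B B' BB' pB|p]; first exact: le_trans pB BB'.
  have [i pi] := chart_cover A p; have Ux := chart_img_at pi.
  set x := chart i p in Ux.
  have Pc : ctsm (fun y => P 1 i y) x := @gk_proj_ctsm _ _ _ _ _ _ _ gK i x Ux 1.
  have Jc := gk_JA_ctsm gK Ux; have gc := gk_g_ctsm gK Ux.
  have [K1 K10 HK1] := ctsm_bound Jc.
  have ac : ctsm (fun y => P 1 i y *m (JA i y *m g i y + beta i y) *m (P 1 i y)^T) x.
    exact: ctsmM (ctsmM Pc (ctsmD (ctsmM Jc gc) (ddbar_mx_ctsm Ux))) (ctsmT Pc).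
  have [K2 K20 HK2] := ctsm_bound ac.
  have [c c0 cg] := pd_near gc (gk_pos gK Ux).
  pose K := K1 + K2.
  have K0 : 0 <= K by rewrite addr_ge0.
  pose D : R := m%:R * (m%:R * (m%:R * K)).
  have w0 : 0 < @wedge_const R k * c ^+ k by rewrite mulr_gt0 ?wedge_const_gt0 ?exprn_gt0.
  exists (Kw * K ^+ k * D ^+ k / (@wedge_const R k * c ^+ k)).
  have := chart_near pi (nearI HK1 (nearI HK2 cg)).
  have F : Filter (nbhs p) by exact: nbhs_filter.
  apply: filterS => q [qi [h1 [h2 h3]]]; have Uq := chart_img_at qi.
  (* A bound on exp F_+ suffices, as 1 + F_+ <= exp F_+. *)
  rewrite ler_pdivlMr //; apply: le_trans (_ : expR (Fp q) * (@wedge_const R k * c ^+ k) <= _).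
    apply: ler_wpM2r; first exact: ltW.
    by have := expR_ge1Dx (Fp q); lra.
  rewrite mulrC.
  have h1' a b : `|JA i (chart i q) a b| <= K by have := h1 a b; rewrite /K; lra.
  have h2' a b : `|(P 1 i (chart i q) *m (JA i (chart i q) *m g i (chart i q)
      + beta i (chart i q)) *m (P 1 i (chart i q))^T) a b| <= K.
    by have := h2 a b; rewrite /K; lra.
  apply: (ratio_bound (gk_sym gK Uq) (gk_pos gK Uq) (gk_JJ gK Uq) (gk_Jg gK Uq)
    (gk_JPi commAB Uq) (mulr1 1) (rank_plus Uq) Kw0 Kw_le K0 c0 h1' h3 (expR_gt0 _) _ h2').
  move=> v; apply: (wedge_plus gK us Uq).
  by rewrite W //; rewrite chartK.
by exists B => _ [q _ <-]; exact: HB.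
Qed.

End GlobalPositivity.

(** * Numerical inequalities behind the choice of the cube *)

Section RealEstimates.
Context {R : realType}.

Lemma ler_sum5 (a b c d e : R) : 0 <= a -> 0 <= b -> 0 <= c -> 0 <= d ->
  [/\ a <= a + b + c + d + `|e|, b <= a + b + c + d + `|e|, c <= a + b + c + d + `|e|,
      d <= a + b + c + d + `|e| & e <= a + b + c + d + `|e|].
Proof. by move=> a0 b0 c0 d0; have := normr_ge0 e; have := ler_norm e; split; lra. Qed.

Lemma trace_drift (t sg mm : R) : `|mm / 2 - t| <= 8^-1 -> `|sg| <= 8^-1 ->
  `|2 * (t + sg) - mm| <= 2^-1.
Proof. by rewrite !ler_norml => /andP[h2 h3] /andP[h4 h5]; apply/andP; split; lra. Qed.

Lemma gradient_drift (q r z : R) : 0 < r -> r * (16 * (q + 1)) <= 1 -> q * z <= q * (2 * r) ->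
  q * z <= 8^-1.
Proof. by lra. Qed.

(** Here b = q(z), X = L q and W is the error from replacing the coefficients by those at the
    centre. Without errors the claim is m b <= (m + 1) b; half of the gap b pays for X - m, half for
    W. *)
Lemma power_subharmonic (b W X mm dqz c1z : R) : 0 <= b -> 0 <= mm ->
  `|X - mm| <= 2^-1 -> `|W| <= dqz -> dqz * (4 * (mm + 1)) <= c1z -> c1z <= b ->
  b * X <= 2 * (mm + 1) * (2^-1 * b + W).
Proof.
rewrite !ler_norml => b0 m0 /andP[_ X1] /andP[W1 _] h1 h2.
have h3 := ler_wpM2l b0 (_ : X <= mm + 2^-1).
apply: le_trans (h3 _) _; first by lra.
have : (mm + 1) * (- W) <= (mm + 1) * dqz by apply: ler_wpM2l; lra.
lra.
Qed.

End RealEstimates.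

(** * Coordinate cubes adapted to the operator *)

Section CubeData.
Context {R : realType} {n : nat} {M : topologicalType}.
Local Notation m := (n + n)%N.
Local Notation rV := 'rV[R]_m.
Variables (A : smooth_atlas R m M) (g JA JB : tensor A).
Hypothesis gK : generalized_kahler g JA JB.
Hypothesis commAB : commuting JA JB.
Local Notation Pi := (Pi_of JA JB).
Hypothesis n0 : (0 < n)%N.
Local Notation s := (m.-1%:R / 2 : R).

Lemma ctsm_near_eq p q (B B' : rV -> 'M[R]_(p, q)) x : ctsm B x ->
  (\forall y \near x, B y = B' y) -> ctsm B' x.
Proof.
move=> Bc BB' a b; apply/cts_atP => e e0.
have Bx : B x = B' x.
  by have [r r0 rH] := proj1 (nearVP _ _) BB'; apply: rH; rewrite subrr normr0.
have := proj1 (cts_atP _ _) (Bc a b) e e0 => h.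
by apply: nearS (nearI h BB') => y [h1 h2]; rewrite -Bx -h2.
Qed.

Lemma ginv_ctsm i x : chart_img i x -> ctsm (fun y => invmx (g i y)) x.
Proof.
move=> Ux; have gu := pdf_unit (gk_pos gK Ux).
apply: ctsm_near_eq (ctsm_inv (gk_g_ctsm gK Ux) gu) _.
have Un : \forall y \near x, chart_img i y.
  by apply: open_nbhs_nbhs; split => //; exact: open_chart_img.
by apply: nearS Un => y Uy; rewrite /invmx (pdf_unit (gk_pos gK Uy)).
Qed.

Lemma lap_B_cts i x c : chart_img i x -> {for x, continuous (fun y => lap_B g JA i y c)}.
Proof.
move=> Ux; apply: ctsM; first exact: cts_cst.
apply: cts_tr; apply: ctsmM (ctsmM (ginv_ctsm Ux) (gk_JA_ctsm gK Ux)) _.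
exact: (@dJA_mx_ctsm _ _ _ _ _ _ _ gK i c x Ux).
Qed.

(* A coordinate cube on which the trace operator is so close to half the Laplacian
   of the flat metric g(xc) that the powers of the distance with exponent
   1 - m are subharmonic; at [xc] itself 2 - m would do. *)
Record cube_data (i : chart_index A) (xc : rV) (r0 c1 c2 K : R) : Prop := CubeData {
  cube_r0 : 0 < r0;
  cube_r01 : r0 <= 1;
  cube_c1 : 0 < c1;
  cube_c2 : 0 < c2;
  cube_K0 : 0 <= K;
  cube_img : forall x, `|x - xc| <= r0 -> chart_img i x;
  cube_Q1 : forall v : rV, c1 * `|v| ^+ 2 <= bf (g i xc) v v;
  cube_Q2 : forall v : rV, bf (g i xc) v v <= c2 * `|v| ^+ 2;
  cube_g : forall x, `|x - xc| <= r0 -> forall v : rV, c1 * `|v| ^+ 2 <= bf (g i x) v v;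
  cube_bound : forall x, `|x - xc| <= r0 ->
    [/\ forall a b, `|JA i x a b| <= K, forall a b, `|g i x a b| <= K,
        forall a b, `|Pi i x a b| <= K,
        forall a b, `|omega_mx (g i x) (JA i x) (Pi i x) 1 a b| <= K &
        forall c a b, `|dJ_mx (dJA JA i) c x a b| <= K];
  cube_AQ1 : forall x z : rV, `|x - xc| <= r0 -> `|z| <= 2 * r0 ->
    1 <= 2 * (\tr (lap_A g i x *m g i xc) + \sum_c (z *m g i xc) 0 c * lap_B g JA i x c);
  cube_AQ2 : forall x z : rV, `|x - xc| <= r0 -> `|z| <= 2 * r0 ->
    bf (g i xc) z z *
      (2 * (\tr (lap_A g i x *m g i xc) + \sum_c (z *m g i xc) 0 c * lap_B g JA i x c))
    <= 4 * (s + 1) * bf (lap_A g i x) (z *m g i xc) (z *m g i xc)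
}.

(** With coefficients frozen at [xc] and no drift, L q = m and A(zQ, zQ) = q / 2, so both operator
    conditions hold with a margin, and continuity gives a cube on which they persist. *)
Lemma cube_exists i xc : chart_img i xc -> exists r0 c1 c2 K, cube_data i xc r0 c1 c2 K.
Proof.
move=> Ux; pose Q := g i xc.
have gc := gk_g_ctsm gK Ux; have Jc := gk_JA_ctsm gK Ux.
have Pc := @gk_Pi_ctsm _ _ _ _ _ _ _ gK i xc Ux.
have prc : ctsm (fun y => proj_pm (Pi i y) 1) xc := @gk_proj_ctsm _ _ _ _ _ _ _ gK i xc Ux 1.
have oc : ctsm (fun y => omega_mx (g i y) (JA i y) (Pi i y) 1) xc.
  exact: ctsmM (ctsmM prc (ctsmM Jc gc)) (ctsmT prc).
have [c1 c10 Hc1] := pd_near gc (gk_pos gK Ux).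
have [K1 K10 HK1] := ctsm_bound Jc.
have [K2 K20 HK2] := ctsm_bound gc.
have [K3 K30 HK3] := ctsm_bound Pc.
have [K4 K40 HK4] := ctsm_bound oc.
have [K5 HK5] : exists K5 : R, \forall y \near xc, forall c a b, `|dJ_mx (dJA JA i) c y a b| <= K5.
  have H c : exists K : R, 0 <= K /\ \forall y \near xc, forall a b, `|dJ_mx (dJA JA i) c y a b| <= K.
    have [K K0 HK] := ctsm_bound (@dJA_mx_ctsm _ _ _ _ _ _ _ gK i c xc Ux).
    by exists K.
  have [k kP] := boolp.choice H; exists (\sum_c k c).
  have : \forall y \near xc, forall c a b, `|dJ_mx (dJA JA i) c y a b| <= k c.
    by apply: near_forallV => c; have [] := kP c.
  apply: nearS => y yP c a b; apply: le_trans (yP c a b) _.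
  by rewrite (bigD1 c) //= lerDl; apply: sumr_ge0 => d _; have [] := kP d.
have [K6 K60 HK6] : exists2 K6 : R, 0 <= K6 & \forall y \near xc, forall c, `|lap_B g JA i y c| <= K6.
  have : ctsm (fun y => \row_c lap_B g JA i y c) xc.
    move=> a b; have h := @lap_B_cts i xc b Ux; apply: cts_eq h.
    by move=> y; rewrite mxE.
  move=> /ctsm_bound[K K0 HK]; exists K => //.
  by apply: nearS HK => y hy c; have := hy 0 c; rewrite mxE.
pose K := K1 + K2 + K3 + K4 + `|K5|.
have K0 : 0 <= K by rewrite !addr_ge0.
have [KK1 KK2 KK3 KK4 KK5] := ler_sum5 K5 K10 K20 K30 K40; rewrite -/K in KK1 KK2 KK3 KK4 KK5.
have m1 : 1 <= n%:R :> R by rewrite ler1n.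
have mE : m%:R = n%:R + n%:R :> R by rewrite natrD.
have m0 : 0 < m%:R :> R by lra.
pose c2 := m%:R * m%:R * K2 + 1.
have mm0 : 0 <= m%:R * m%:R :> R by exact: mulr_ge0.
have c20 : 0 < c2 by rewrite ltr_wpDl // mulr_ge0.
have Ac : ctsm (lap_A g i) xc := ctsmZ (ginv_ctsm Ux).
have trc : {for xc, continuous (fun y => \tr (lap_A g i y *m Q))}.
  exact: cts_tr (ctsmM Ac (@ctsm_cst _ _ _ _ Q xc)).
have Qu : Q \in unitmx := pdf_unit (gk_pos gK Ux).
have trQ : \tr (lap_A g i xc *m Q) = m%:R / 2.
  by rewrite /lap_A -scalemxAl mulVmx // mxtraceZ mxtrace1 mulrC.
have e8 : 0 < (8^-1 : R) by rewrite invr_gt0.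
have Htr := proj1 (cts_atP _ _) trc _ e8.
pose q := (m%:R * m%:R) * (m%:R * K2) ^+ 2.
have q0 : 0 <= q by rewrite mulr_ge0 // sqr_ge0.
(* Varying the leading coefficients by d changes A(zQ, zQ) by at most d q |z|^2, and 4 (m + 1) d q
   <= c1 is what [power_subharmonic] tolerates. *)
pose d := c1 / (4 * (m%:R + 1) * (q + 1)).
have d0 : 0 < d by rewrite divr_gt0 // !mulr_gt0 // ltr_wpDl // ltW.
have HA := ctsm_near Ac d0.
have Un : \forall y \near xc, chart_img i y.
  by apply: open_nbhs_nbhs; split => //; exact: open_chart_img.
have [r r00 rH] := proj1 (nearVP _ _) (nearI Un (nearI Hc1 (nearI HK1 (nearI HK2 (nearI HK3
  (nearI HK4 (nearI HK5 (nearI HK6 (nearI Htr HA))))))))).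
pose q2 := m%:R * (m%:R * K2) * K6.
have q20 : 0 <= q2 by apply: mulr_ge0 => //; apply: mulr_ge0 => //; exact: mulr_ge0.
(* r / 2 keeps the closed cube inside the open neighbourhood, 1 is a normalization, and the last
   term bounds the drift by 1/8 for |z| <= 2 r0. *)
pose r0 := Num.min (Num.min (r / 2) 1) (16 * (q2 + 1))^-1.
have r0p : 0 < r0 by rewrite !lt_min divr_gt0 //= ltr01 invr_gt0 mulr_gt0 // ltr_wpDl.
have r0r : r0 < r.
  by apply: (@le_lt_trans _ _ (r / 2)); [rewrite !ge_min lexx|lra].
have r0q : r0 * (16 * (q2 + 1)) <= 1.
  by rewrite -ler_pdivlMr ?mul1r ?ge_min ?lexx ?orbT // mulr_gt0 // ltr_wpDl.
have near (x : rV) : `|x - xc| <= r0 -> `|x - xc| < r by move=> h; apply: le_lt_trans h r0r.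
have [_ [gxc [_ [gxK _]]]] := rH xc (near xc ltac:(by rewrite subrr normr0 ltW)).
have drift (x z : rV) : `|x - xc| <= r0 -> `|z| <= 2 * r0 ->
    `|2 * (\tr (lap_A g i x *m Q) + \sum_c (z *m Q) 0 c * lap_B g JA i x c) - m%:R| <= 2^-1.
  move=> /near/rH[_ [_ [_ [_ [_ [_ [_ [hB [ht _]]]]]]]]] zr.
  have h1 : `|\sum_c (z *m Q) 0 c * lap_B g JA i x c| <= 8^-1.
    apply: le_trans (ler_norm_sum _ _ _) _.
    apply: (@le_trans _ _ (\sum_(c < m) (m%:R * K2 * `|z| * K6))).
      apply: ler_sum => c _; rewrite normrM; apply: ler_pM => //.
      apply: le_trans (coord_le_norm _ _) _.
      by apply: mulmx_norm_le => // a b; exact: gxK.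
    rewrite sumr_const card_ord -[leLHS]mulr_natl.
    have h2 : q2 * `|z| <= q2 * (2 * r0) by exact: ler_wpM2l.
    rewrite (_ : m%:R * (m%:R * K2 * `|z| * K6) = q2 * `|z|); last by rewrite /q2; ring.
    exact: gradient_drift r0p r0q h2.
  by rewrite trQ in ht; exact: trace_drift.
exists r0, c1, c2, K; split => //.
- by rewrite !ge_min lexx orbT.
- by move=> x /near/rH[].
- move=> v; apply: le_trans (bf_sq_le v gxK) _.
  by apply: ler_wpM2r; [exact: sqr_ge0|rewrite /c2 lerDl].
- by move=> x /near/rH[_ []].
- move=> x /near/rH[_ [_ [h1 [h2 [h3 [h4 [h5 _]]]]]]]; split.
  + by move=> a b; apply: le_trans (h1 a b) KK1.
  + by move=> a b; apply: le_trans (h2 a b) KK2.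
  + by move=> a b; apply: le_trans (h3 a b) KK3.
  + by move=> a b; apply: le_trans (h4 a b) KK4.
  + by move=> c a b; apply: le_trans (h5 c a b) KK5.
- by move=> x z xr zr; have := drift x z xr zr; rewrite ler_norml -/Q => /andP[]; lra.
- move=> x z xr zr; rewrite -/Q.
  have := drift x z xr zr; set X := 2 * _ => Xm.
  have [_ [_ [_ [_ [_ [_ [_ [_ [_ hA]]]]]]]]] := rH x (near x xr).
  have Q0 : c1 * `|z| ^+ 2 <= bf Q z z := gxc z.
  have bQ0 : 0 <= bf Q z z by apply: le_trans Q0; rewrite mulr_ge0 ?sqr_ge0 // ltW.
  have AE : bf (lap_A g i xc) (z *m Q) (z *m Q) = 2^-1 * bf Q z z.
    rewrite bf_scale /bf trmx_mul (gk_sym gK Ux) -/Q -!mulmxA.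
    by rewrite (mulmxA (invmx Q)) mulVmx // mul1mx.
  have Ad : `|bf (lap_A g i x - lap_A g i xc) (z *m Q) (z *m Q)|
      <= m%:R * m%:R * d * (`|z *m Q| * `|z *m Q|).
    by apply: bf_le => a b; rewrite !mxE; have := hA a b; rewrite !mxE.
  have zQ : `|z *m Q| * `|z *m Q| <= (m%:R * K2) ^+ 2 * `|z| ^+ 2.
    rewrite -exprMn expr2; apply: ler_pM => //; exact: mulmx_norm_le.
  have h1 : m%:R * m%:R * d * (`|z *m Q| * `|z *m Q|) <= d * q * `|z| ^+ 2.
    apply: le_trans (_ : m%:R * m%:R * d * ((m%:R * K2) ^+ 2 * `|z| ^+ 2) <= _).
      by apply: ler_wpM2l => //; rewrite mulr_ge0 // ltW.
    by rewrite /q le_eqVlt; apply/orP; left; apply/eqP; ring.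
  have h2 : d * q * (4 * (m%:R + 1)) <= c1.
    rewrite /d; have q1 : 0 < q + 1 by rewrite ltr_wpDl.
    have -> : c1 / (4 * (m%:R + 1) * (q + 1)) * q * (4 * (m%:R + 1)) = c1 * (q / (q + 1)).
      by field; rewrite !gt_eqF // ltr_wpDl // ltW.
    by apply: ler_piMr; [exact: ltW|rewrite ler_pdivrMr // mul1r lerDl].
  have h3 := ler_wpM2r (sqr_ge0 `|z|) h2.
  have AxE : bf (lap_A g i x) (z *m Q) (z *m Q) =
    2^-1 * bf Q z z + bf (lap_A g i x - lap_A g i xc) (z *m Q) (z *m Q).
    by rewrite -AE bf_add bf_opp; ring.
  rewrite AxE; set W := bf (_ - _) _ _ in Ad *.
  have sE : 4 * (s + 1) = 2 * (m%:R + 1).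
    by rewrite -[in RHS](prednK (n := m)) ?addn_gt0 ?n0 // -natr1; field.
  rewrite sE; apply: power_subharmonic bQ0 (ltW m0) Xm (le_trans Ad h1) _ Q0.
  by rewrite mulrAC.
Qed.

End CubeData.

(** * Growth estimates on a cube, uniform in u *)

Section Growth.
Context {R : realType} {n : nat} {M : topologicalType}.
Local Notation m := (n + n)%N.
Local Notation rV := 'rV[R]_m.
Variables (A : smooth_atlas R m M) (g JA JB : tensor A).
Hypothesis gK : generalized_kahler g JA JB.
Hypothesis commAB : commuting JA JB.
Local Notation Pi := (Pi_of JA JB).
Variables k l : nat.
Hypothesis rank_plus : forall i x, chart_img i x -> rank_T (JA i) (Pi i) 1 x = k.
Hypothesis rank_minus : forall i x, chart_img i x -> rank_T (JA i) (Pi i) (-1) x = l.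
Hypothesis M_nonempty : [set: M] !=set0.
Hypothesis M_compact : compact [set: M].
Hypothesis M_connected : connected [set: M].
Hypothesis n0 : (0 < n)%N.
Local Notation s := (m.-1%:R / 2 : R).
Local Notation f u i := (u \o chart_inv i).

(** The class of functions over which all constants are uniform: [Fs] bounds exp F_+ and [lam] is
    the defect in the trace condition. *)
Record admissible (Fs lam : R) (u : M -> R) : Prop := Admissible {
  adm_smooth : smooth_fun A u;
  adm_plus : exists2 Fp : M -> R, (forall p, expR (Fp p) <= Fs) & forall i x v, chart_img i x ->
    wedge_pow (fun y w => omega_pm g JA JB 1 i y w + ddbar_pm JA JB 1 u i y w) k x v =
    (expR (Fp (chart_inv i x)))%:C * wedge_pow (omega_pm g JA JB 1 i) k x v;
  adm_minus : exists Fm : M -> R, forall i x v, chart_img i x ->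
    wedge_pow (fun y w => omega_pm g JA JB (-1) i y w - ddbar_pm JA JB (-1) u i y w) l x v =
    (expR (Fm (chart_inv i x)))%:C * wedge_pow (omega_pm g JA JB (-1) i) l x v;
  adm_trace : forall i x, chart_img i x ->
    - lam < complex.Re (trace_form (fundamental_form g JA i) (ddbar (JA i) (f u i)) x)
}.

Variables (Fs lam : R).
Hypothesis lam0 : 0 <= lam.
Hypothesis Fs0 : 0 <= Fs.
Variables (i : chart_index A) (xc : rV) (r0 c1 c2 K : R).
Hypothesis cube : cube_data g JA JB i xc r0 c1 c2 K.

(** The factor ensures r1 <= r0 / 8 and 8 c2 r1 <= c1 r0, so that q is smaller between points of the
    inner cube than from there to the outer boundary. *)
Definition inner_radius : R := r0 * (c1 / (8 * (c1 + c2))).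
Local Notation r1 := inner_radius.

Let c10 := cube_c1 cube.
Let c20 := cube_c2 cube.
Let r00 := cube_r0 cube.

Let kap0 : 0 < c1 / (8 * (c1 + c2)).
Proof. by rewrite divr_gt0 // mulr_gt0 // addr_gt0. Qed.

Let kap8 : c1 / (8 * (c1 + c2)) <= 8^-1.
Proof.
rewrite ler_pdivrMr; last by rewrite mulr_gt0 // addr_gt0.
by move: c20; lra.
Qed.

Lemma inner_radius_gt0 : 0 < r1.
Proof. by rewrite /r1 mulr_gt0. Qed.

Lemma inner_radius_lt : r1 < r0.
Proof. by rewrite /r1 gtr_pMr //; apply: le_lt_trans kap8 _; lra. Qed.

Lemma inner_radius_small : 4 * c2 * r1 ^+ 2 < c1 * (r0 - r1) ^+ 2.
Proof.
have := kap8; have := kap0; rewrite /r1; set t := c1 / _ => t0 t8.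
have -> : 4 * c2 * (r0 * t) ^+ 2 = r0 ^+ 2 * (4 * c2 * t ^+ 2) by ring.
have -> : c1 * (r0 - r0 * t) ^+ 2 = r0 ^+ 2 * (c1 * (1 - t) ^+ 2) by ring.
rewrite ltr_pM2l ?exprn_gt0 //.
have tE : 8 * c2 * t <= c1.
  rewrite /t; have c12 : 0 < c1 + c2 by rewrite addr_gt0.
  have -> : 8 * c2 * (c1 / (8 * (c1 + c2))) = c1 * (c2 / (c1 + c2)) by field; rewrite gt_eqF.
  by apply: ler_piMr; [exact: ltW|rewrite ler_pdivrMr // mul1r lerDr ltW].
clearbody t.
have h1 : 4 * c2 * t ^+ 2 <= c1 * 16^-1.
  have -> : 4 * c2 * t ^+ 2 = 8 * c2 * t * (t / 2) by rewrite expr2; field.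
  by apply: ler_pM => //; [rewrite !mulr_ge0 // ltW|rewrite divr_ge0 // ltW|lra].
apply: le_lt_trans h1 _; rewrite ltr_pM2l //.
have h2 : 7 / 8 <= 1 - t by lra.
have : (7 / 8) ^+ 2 <= (1 - t) ^+ 2 by apply: lerXn2r; rewrite ?nnegrE; lra.
by apply: lt_le_trans; lra.
Qed.

Let s0 : 0 < s.
Proof. by rewrite divr_gt0 // ltr0n; move: n0; case: n => // n'; rewrite addSn addnS. Qed.

Let sE : 2 * s = m.-1%:R.
Proof. by rewrite mulrC divfK // pnatr_eq0. Qed.

Let m0 : (0 < m)%N.
Proof. by rewrite addn_gt0 n0. Qed.

Let Asym x : `|x - xc| <= r0 -> (lap_A g i x)^T = lap_A g i x.
Proof.
move=> xr; have Ux := cube_img cube xr.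
by rewrite /lap_A linearZ /= trmx_inv (gk_sym gK Ux).
Qed.

Let Apos x : `|x - xc| <= r0 -> pdf (lap_A g i x).
Proof.
move=> xr; have Ux := cube_img cube xr; have gu := pdf_unit (gk_pos gK Ux).
move=> v v0; rewrite /lap_A bf_scale mulr_gt0 ?invr_gt0 //.
have w0 : v *m invmx (g i x) != 0.
  by apply: contraNneq v0 => w0; rewrite -[v](mulmxKV gu) w0 mul0mx.
have := gk_pos gK Ux w0; rewrite /bf trmx_mul trmx_inv (gk_sym gK Ux).
by rewrite mulmxKV // !mulmxA.
Qed.

Let Lf u : admissible Fs lam u -> forall x, `|x - xc| <= r0 ->
  - lam < Lop (lap_A g i x) (lap_B g JA i x) (hess (pd2 (f u i)) x) ((pd1 (f u i))^~ x).
Proof.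
move=> adm x xr; have Ux := cube_img cube xr.
by rewrite -(trace_formE gK (adm_smooth adm) Ux); exact: adm_trace adm i x Ux.
Qed.

Let th := spread_const (m := m) c1 c2 r0 r1 s.

Let th0 : 0 < th.
Proof.
by apply: spread_const_gt0 => //;
  [exact: inner_radius_gt0|exact: inner_radius_lt|exact: inner_radius_small].
Qed.

Let Ccst : R := lam * (c2 * r0 ^+ 2).

Let Ccst0 : 0 <= Ccst.
Proof. by rewrite mulr_ge0 // mulr_ge0 ?(ltW c20) // exprn_ge0 // ltW. Qed.

(** Brings bounds into the form B (w + 1), which absorbs additive constants and so can be
    chained. *)
Let affine (c X w K' : R) : 0 < c -> 0 <= X -> 0 <= w -> c * (K' - 2) <= w + X ->
  K' <= ((1 + X) / c + 2) * (w + 1).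
Proof.
move=> c0 X0 w0 h.
have h1 : K' - 2 <= (w + X) / c by rewrite ler_pdivlMr // mulrC.
have h2 : (w + X) / c <= (1 + X) / c * (w + 1).
  rewrite mulrAC ler_pM2r ?invr_gt0 //.
  have := mulr_ge0 X0 w0; lra.
lra.
Qed.

(** [spread] with a single pole. Its constant deteriorates like h^m, but here h is fixed before
    u. *)
Lemma growth_ball (y0 : rV) (h : R) : `|y0 - xc| <= r1 -> 0 < h -> h <= r0 ->
  exists2 B : R, 0 <= B & forall u S, admissible Fs lam u -> (forall q, u q <= S) ->
    forall K', (forall x, `|x - y0| <= h -> `|x - xc| <= r0 -> K' <= S - f u i x) ->
    forall x, `|x - xc| <= r1 -> K' <= B * (S - f u i x + 1).
Proof.
move=> y0c h0 hr0.
pose c := Num.min 1 (th * (#|{: unit}|%:R * h ^+ m)).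
have c0 : 0 < c by rewrite lt_min ltr01 mulr_gt0 // card_unit mul1r exprn_gt0.
have B0 : 0 <= (1 + Ccst) / c + 2.
  by apply: addr_ge0 => //; apply: divr_ge0; [exact: addr_ge0|exact: ltW].
exists ((1 + Ccst) / c + 2) => // u S adm uS K' K'h x xr.
have w0 : 0 <= S - f u i x by rewrite subr_ge0; exact: uS.
have [K'0|K'0] := ltP K' 0.
  by apply: le_trans (ltW K'0) _; rewrite mulr_ge0 // addr_ge0.
apply: affine => //; apply: (@le_trans _ _ (c * K')).
  by apply: ler_wpM2l; [exact: ltW|lra].
apply: (@spread R m (chart_img i) xc r0 r1 c1 c2 (g i xc) (lap_A g i) (lap_B g JA i) s
  (@open_chart_img _ _ _ _ i) (cube_img cube) _ c10 c20 (cube_Q1 cube) (cube_Q2 cube)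
  Asym Apos m0 s0 sE inner_radius_gt0 inner_radius_lt inner_radius_small (cube_AQ1 cube)
  (cube_AQ2 cube) (f u i) (pd1 (f u i)) (pd2 (f u i)) (chart_C2on (adm_smooth adm) i)
  lam S lam0 (Lf adm) _ unit (fun=> y0)) => //.
- by apply: (gk_sym gK); apply: (cube_img cube); rewrite subrr normr0 ltW.
- by move=> z zr; exact: uS.
Qed.

(** [spread_from_min] with an eps depending on the cube only; the Hessian bound at contact points
    then depends on the cube, k and Fs, hence so does the lower bound [nu] for N h^m. *)
Lemma growth_min : exists2 B : R, 0 <= B & forall u S, admissible Fs lam u ->
  (forall q, u q <= S) -> forall x0, `|x0 - xc| <= r1 / 2 ->
  (forall q, u (chart_inv i x0) <= u q) ->
  forall x, `|x - xc| <= r1 -> S - f u i x0 <= B * (S - f u i x + 1).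
Proof.
have K0 := cube_K0 cube.
have r10 := inner_radius_gt0; have r1r0 := inner_radius_lt.
have r01 := cube_r01 cube.
(* Contact points have |df| <= 3 eps r1 / 2 <= 3 eps, so the torsion is at most zeta = 3 m K eps.
   All terms to be absorbed are thus linear in eps, with total coefficient X. *)
pose X : R := m%:R * (1 + (m%:R * K) ^+ 2) + 2^-1 * (m%:R * m%:R * (3 * m%:R * K) * (m%:R * K)).
have mR0 : 0 <= m%:R :> R by [].
have X0 : 0 <= X.
  by rewrite addr_ge0 ?mulr_ge0 ?addr_ge0 ?sqr_ge0.
pose eps := Num.min 1 (c1 / (2 * (X + 1))).
have X1 : 0 < X + 1 by rewrite ltr_wpDl.
have eps0 : 0 < eps by rewrite lt_min ltr01 divr_gt0 // mulr_gt0.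
have eps1 : eps <= 1 by rewrite ge_min lexx.
have epsX : eps * X <= 2^-1 * c1.
  apply: (@le_trans _ _ (c1 / (2 * (X + 1)) * X)).
    by apply: ler_wpM2r => //; rewrite ge_min lexx orbT.
  have -> : c1 / (2 * (X + 1)) * X = 2^-1 * (c1 * (X / (X + 1))) by field; rewrite gt_eqF.
  rewrite ler_pM2l ?invr_gt0 //; apply: ler_piMr; first exact: ltW.
  by rewrite ler_pdivrMr // mul1r lerDl.
pose zeta := 3 * m%:R * K * eps.
have zeta0 : 0 <= zeta by rewrite !mulr_ge0 // ltW.
have small : eps * m%:R * (1 + (m%:R * K) ^+ 2)
    + 2^-1 * (m%:R * m%:R * zeta * (m%:R * K)) <= 2^-1 * c1.
  apply: le_trans epsX; rewrite le_eqVlt; apply/orP; left; apply/eqP.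
  by rewrite /zeta /X; ring.
have [C1 C10 C1P] := @contact_hess R m k K c1 eps zeta Fs K0 c10 (ltW eps0) zeta0 Fs0 small.
pose nu := (eps * (r1 / 2) / (m%:R * (m%:R * (C1 + 1) + 2 * eps))) ^+ m.
have mRp : 0 < m%:R :> R by rewrite ltr0n.
have L0 : 0 < m%:R * (C1 + 1) + 2 * eps.
  by apply: addr_gt0; apply: mulr_gt0 => //; rewrite ltr_wpDl.
have nu0 : 0 < nu.
  apply: exprn_gt0; apply: divr_gt0; apply: mulr_gt0 => //; exact: divr_gt0.
pose c := Num.min 1 (th * nu).
have c0 : 0 < c by rewrite lt_min ltr01 mulr_gt0.
have B0 : 0 <= (1 + Ccst) / c + 2.
  by apply: addr_ge0 => //; apply: divr_ge0; [exact: addr_ge0|exact: ltW].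
exists ((1 + Ccst) / c + 2) => // u S adm uS x0 x0c umin x xr.
have us := adm_smooth adm.
have w0 : 0 <= S - f u i x by rewrite subr_ge0; exact: uS.
apply: affine => //.
have r1le : r1 / 2 <= 1 by lra.
apply: (@spread_from_min R m (chart_img i) xc r0 r1 c1 c2 (g i xc) (lap_A g i) (lap_B g JA i) s
  (@open_chart_img _ _ _ _ i) (cube_img cube) _ c10 c20 (cube_Q1 cube) (cube_Q2 cube)
  Asym Apos m0 s0 sE inner_radius_gt0 inner_radius_lt inner_radius_small (cube_AQ1 cube)
  (cube_AQ2 cube) (f u i) (pd1 (f u i)) (pd2 (f u i)) (chart_C2on us i)
  lam S lam0 (Lf adm) _ x0 eps C1) => //.
- by apply: (gk_sym gK); apply: (cube_img cube); rewrite subrr normr0 ltW.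
- by move=> z zr; exact: uS.
- by move=> z _; exact: umin.
- apply: mulr_ile1; rewrite ?exprn_ge0 ?(ltW eps0) ?divr_ge0 ?(ltW r10) //.
  by rewrite expr_le1 // divr_ge0 // ltW.
move=> z zx0 dz Hz.
have zr : `|z - xc| <= r0 by have := ler_distD x0 z xc; lra.
have Uz := cube_img cube zr.
have [Jb gb Pib ob db] := cube_bound cube zr.
have [Fp FpFs Wp] := adm_plus adm.
have Zb a b : `|torsion_mx (dJA JA i) (pd1 (f u i)) z a b| <= zeta.
  rewrite /torsion_mx summxE; apply: le_trans (ler_norm_sum _ _ _) _.
  apply: (@le_trans _ _ (\sum_(c < m) (3 * eps * K))).
    apply: ler_sum => d _; rewrite mxE normrM; apply: ler_pM => //.
    apply: le_trans (dz d) _; apply: ler_piMr => //.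
    by rewrite mulr_ge0 // ltW.
  by rewrite sumr_const card_ord -[leLHS]mulr_natl /zeta; lra.
have pos := minus_pos_everywhere gK commAB rank_minus M_nonempty M_compact M_connected us
  (adm_minus adm) Uz.
have neg v : eigen (Pi i z) (-1) v ->
    bf (ddbar_mx JA u i z) v (v *m JA i z) <= bf (g i z) v v.
  move=> vE; have [->|v0] := eqVneq v 0; first by rewrite /bf !mul0mx mxE.
  exact: ltW (pos v v0 vE).
have W v : wedge_pow (form_mx (proj_pm (Pi i z) 1 *m (JA i z *m g i z + ddbar_mx JA u i z)
     *m (proj_pm (Pi i z) 1)^T)) k z v = (expR (Fp (chart_inv i z)))%:C *
    wedge_pow (form_mx (omega_mx (g i z) (JA i z) (Pi i z) 1)) k z v.
  by apply: (wedge_plus gK us Uz); exact: Wp.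
move=> a b; have := C1P (JA i z) (g i z) (Pi i z) (torsion_mx (dJA JA i) (pd1 (f u i)) z)
  (hess (pd2 (f u i)) z) (ddbar_mx JA u i z) z (expR (Fp (chart_inv i z)))
  (gk_sym gK Uz) (gk_pos gK Uz) (gk_JJ gK Uz) (gk_Jg gK Uz) (gk_JPi commAB Uz)
  (gk_PiPi gK commAB Uz) (rank_plus Uz) Jb gb Pib ob (cube_g cube zr)
  (ddbar_mx_anti JA u i z) (ddbar_mxJ gK u Uz) (fun v => ddbar_mx_form gK us v Uz) Zb
  (expR_gt0 _) (FpFs _) W neg (chart_hess_sym us Uz) Hz a b.
by rewrite mxE.
Qed.

End Growth.

(** * The oscillation bound *)

Section OscillationBound.
Context {R : realType} {n : nat} {M : topologicalType}.
Local Notation m := (n + n)%N.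
Variables (A : smooth_atlas R m M) (g JA JB : tensor A).
Hypothesis M_nonempty : [set: M] !=set0.
Hypothesis M_compact : compact [set: M].
Hypothesis M_connected : connected [set: M].

Lemma osc_le (u : M -> R) (B : R) : (forall p q, u p - u q <= B) ->
  sup (range u) - inf (range u) <= B.
Proof.
have [p0 _] := M_nonempty; move=> uB.
have r0 : range u !=set0 by exists (u p0), p0.
have lb q : sup (range u) <= u q + B.
  by apply: ge_sup => // _ [p _ <-]; have := uB p q; lra.
have : sup (range u) - B <= inf (range u).
  by apply: lb_le_inf => // _ [q _ <-]; have := lb q; lra.
lra.
Qed.

(** A chart with values in R^0 has at most one point in its domain, so u is locally constant. This
    case is separate because the barrier needs s > 0. *)
Lemma dim0_constant (u : M -> R) : n = 0%N -> forall p q, u p - u q <= 0.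
Proof.
move=> n0 p q.
have one (i : chart_index A) p1 p2 : chart_dom i p1 -> chart_dom i p2 -> p1 = p2.
  move=> d1 d2; rewrite -(chartK d1) -(chartK d2); congr chart_inv.
  by apply/rowP => a; have : (a < 0)%N by apply: leq_trans (ltn_ord a) _; rewrite n0.
suff : forall z, u z = u q by move=> ->; rewrite subrr.
apply: connected_unif M_connected _ _ _; first by exists q.
- move=> z zq; have [i zi] := chart_cover A z.
  have : \forall z' \near z, chart_dom i z'.
    by apply: open_nbhs_nbhs; split => //; exact: chart_dom_open.
  have F : Filter (nbhs z) by exact: nbhs_filter.
  by apply: filterS => z' z'i; rewrite (one i z' z).
- move=> z lim; have [i zi] := chart_cover A z.
  have nb : nbhs z (chart_dom i) by apply: open_nbhs_nbhs; split => //; exact: chart_dom_open.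
  by have [z' z'i <-] := lim _ nb; rewrite (one i z z').
Qed.

Hypothesis gK : generalized_kahler g JA JB.
Hypothesis commAB : commuting JA JB.
Local Notation Pi := (Pi_of JA JB).
Variables k l : nat.
Hypothesis rank_plus : forall i x, chart_img i x -> rank_T (JA i) (Pi i) 1 x = k.
Hypothesis rank_minus : forall i x, chart_img i x -> rank_T (JA i) (Pi i) (-1) x = l.
Hypothesis n0 : (0 < n)%N.
Variables (Fs lam : R).
Hypothesis lam0 : 0 <= lam.
Hypothesis Fs0 : 0 <= Fs.
Local Notation adm := (admissible g JA JB k l Fs lam).

Lemma local_min_growth (p : M) : exists2 V, nbhs p V &
  exists2 B : R, 0 <= B & forall u S, adm u -> (forall q, u q <= S) ->
    forall x0, V x0 -> (forall q, u x0 <= u q) -> forall q, V q ->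
    S - u x0 <= B * (S - u q + 1).
Proof.
have [i pi] := chart_cover A p; have Ux := chart_img_at pi.
have [r0 [c1 [c2 [K cube]]]] := cube_exists gK n0 Ux.
have r10 := inner_radius_gt0 cube; set r1 := inner_radius r0 c1 c2 in r10.
have [B B0 HB] := growth_min gK commAB rank_plus rank_minus M_nonempty M_compact M_connected
  n0 lam0 Fs0 cube.
exists [set q | chart_dom i q /\ `|chart i q - chart i p| <= r1 / 2].
  apply: (chart_near (Q := fun x => `|x - chart i p| <= r1 / 2) pi).
  by apply/nearVP; exists (r1 / 2); [rewrite divr_gt0|move=> y /ltW].
exists B => // u S au uS x0 [x0i x0r] umin q [qi qr].
have qr1 : `|chart i q - chart i p| <= r1 by lra.
have := HB u S au uS (chart i x0) x0r _ (chart i q) qr1.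
by rewrite /= !chartK //; apply.
Qed.

(** V is fixed before q0 and W: in the closedness argument p is a limit point, q0 a good point found
    in V, and W the neighbourhood on which the bound is already known. *)
Lemma local_propagation (p : M) : exists2 V, nbhs p V &
  forall q0 W, V q0 -> nbhs q0 W -> exists2 B : R, 0 <= B &
    forall u S, adm u -> (forall q, u q <= S) -> forall K',
      (forall q, W q -> K' <= S - u q) -> forall q, V q -> K' <= B * (S - u q + 1).
Proof.
have [i pi] := chart_cover A p; have Ux := chart_img_at pi.
have [r0 [c1 [c2 [K cube]]]] := cube_exists gK n0 Ux.
have r10 := inner_radius_gt0 cube; set r1 := inner_radius r0 c1 c2 in r10.
exists [set q | chart_dom i q /\ `|chart i q - chart i p| <= r1].
  apply: (chart_near (Q := fun x => `|x - chart i p| <= r1) pi).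
  by apply/nearVP; exists r1; [|move=> y /ltW].
move=> q0 W [q0i q0r] Wq0; set y0 := chart i q0.
have nW : \forall x \near y0, W (chart_inv i x).
  by apply: (chart_inv_continuous (chart_img_at q0i)); rewrite chartK.
have [h1 h10 h1W] := proj1 (nearVP _ _) nW.
pose h := Num.min (h1 / 2) r0.
have h0 : 0 < h by rewrite lt_min divr_gt0 //= (cube_r0 cube).
have hr0 : h <= r0 by rewrite ge_min lexx orbT.
have [B B0 HB] := growth_ball gK k l n0 Fs lam0 cube q0r h0 hr0.
exists B => // u S au uS K' K'W q [qi qr].
have := HB u S au uS K' _ (chart i q) qr; rewrite /= chartK //; apply.
move=> x xh _; apply: K'W; apply: h1W; apply: le_lt_trans xh _.
by apply: (@le_lt_trans _ _ (h1 / 2)); [rewrite ge_min lexx|lra].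
Qed.

(** For minima in a small V, the points with a locally uniform bound form an open set, closed by
    propagation, hence all of M; compactness makes the bound uniform in q, and a second use of
    compactness makes it uniform in the location of the minimum. *)
Lemma oscillation_bound : exists B : R, forall u, adm u -> forall p q, u p - u q <= B.
Proof.
have [B HB] : exists B : R, forall x0 u S, adm u -> (forall q, u q <= S) ->
    (forall q, u x0 <= u q) -> forall q, S - u x0 <= B * (S - u q + 1).
  apply: (@compact_unif R M (fun x0 B => forall u S, adm u -> (forall q, u q <= S) ->
      (forall q, u x0 <= u q) -> forall q, S - u x0 <= B * (S - u q + 1))) => //.
    move=> x0 B B' BB' H u S au uS umin q; apply: le_trans (H u S au uS umin q) _.
    by apply: ler_wpM2r => //; have := uS q; lra.
  move=> p; have [V Vp [B0 B00 HV]] := local_min_growth p.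
  pose T q (B : R) := forall u S, adm u -> (forall q, u q <= S) -> forall x0, V x0 ->
    (forall q, u x0 <= u q) -> S - u x0 <= B * (S - u q + 1).
  have [B HB] : exists B : R, forall q, T q B.
    apply: (@compact_unif R M T) => // [q B B' BB' H u S au uS x0 Vx0 umin|].
      apply: le_trans (H u S au uS x0 Vx0 umin) _.
      by apply: ler_wpM2r => //; have := uS q; lra.
    apply: (@connected_unif M (fun q => exists B : R, \forall q' \near q, T q' B)) => //.
    - exists p, B0; have F : Filter (nbhs p) by exact: nbhs_filter.
      by apply: filterS Vp => q Vq u S au uS x0 Vx0 umin; exact: HV.
    - move=> q [B HB]; have F : Filter (nbhs q) by exact: nbhs_filter.
      by apply: filterS (nbhs_interior HB) => q' HB'; exists B.
    move=> q lim; have [V2 V2q HV2] := local_propagation q.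
    have [q0 V2q0 [B1 HB1]] := lim V2 V2q.
    have [B2 B20 HB2] := HV2 q0 _ V2q0 HB1.
    pose B1' := `|B1| + 1.
    have B10 : 0 < B1' by rewrite ltr_wpDl.
    exists (B1' * (B2 + 1)); have F : Filter (nbhs q) by exact: nbhs_filter.
    apply: filterS V2q => q' V2q' u S au uS x0 Vx0 umin.
    have w0 q1 : 0 <= S - u q1 by rewrite subr_ge0.
    (* The bound known near q0 is solved for S - u there, and the resulting constant is propagated
       to q'. *)
    have h1 : (S - u x0) / B1' - 1 <= B2 * (S - u q' + 1).
      apply: (HB2 u S au uS _ _ q' V2q') => q1 Tq1.
      rewrite lerBlDr ler_pdivrMr //; apply: le_trans (Tq1 u S au uS x0 Vx0 umin) _.
      rewrite mulrC; apply: ler_wpM2l; first by have := w0 q1; lra.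
      by apply: le_trans (ler_norm B1) _; rewrite lerDl.
    have : (S - u x0) / B1' <= (B2 + 1) * (S - u q' + 1) by have := w0 q'; lra.
    by rewrite ler_pdivrMr // => h2; apply: le_trans h2 _; rewrite mulrC mulrA.
  exists B; have F : Filter (nbhs p) by exact: nbhs_filter.
  by apply: filterS Vp => x0 Vx0 u S au uS umin q; exact: HB.
exists B => u au p q.
have uc := smooth_continuous (adm_smooth au).
have [pM uM] := continuous_max M_compact M_nonempty uc.
have [pm um] : exists p, forall q, u p <= u q.
  have [] := continuous_max (u := fun q => - u q) M_compact M_nonempty _.
    by move=> z; apply: continuousN; exact: uc.
  by move=> z zm; exists z => z'; have := zm z'; rewrite lerN2.
(* At a maximum point S - u = 0, so the growth bound from the minimum becomes the oscillation
   bound. *)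
have := HB pm u (u pM) au uM um pM; rewrite subrr add0r mulr1.
have := uM p; have := um q; lra.
Qed.

End OscillationBound.

Theorem theorem7p7 (R : realType) (n k l : nat) (M : topologicalType)
    (A : smooth_atlas R (n + n) M) (g JA JB : tensor A)
    (M_nonempty : [set: M] !=set0)
    (M_compact : compact [set: M])
    (M_connected : connected [set: M])
    (M_hausdorff : hausdorff_space M)
    (gK : generalized_kahler g JA JB)
    (commAB : commuting JA JB)
    (rank_plus : forall i x, chart_img i x ->
       rank_T (JA i) (Pi_of JA JB i) 1 x = k)
    (rank_minus : forall i x, chart_img i x ->
       rank_T (JA i) (Pi_of JA JB i) (-1) x = l) :
  exists C : R -> R -> R -> R,
    forall (u Fp Fm : M -> R) (lambda : R),
      smooth_fun A u ->
      (forall i x v, chart_img i x ->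
         wedge_pow (fun y w => omega_pm g JA JB 1 i y w
                               + ddbar_pm JA JB 1 u i y w) k x v =
         (expR (Fp (chart_inv i x)))%:C
           * wedge_pow (omega_pm g JA JB 1 i) k x v) ->
      (forall i x v, chart_img i x ->
         wedge_pow (fun y w => omega_pm g JA JB (-1) i y w
                               - ddbar_pm JA JB (-1) u i y w) l x v =
         (expR (Fm (chart_inv i x)))%:C
           * wedge_pow (omega_pm g JA JB (-1) i) l x v) ->
      (forall i x, chart_img i x ->
         - lambda < complex.Re
           (trace_form (fundamental_form g JA i)
              (ddbar (JA i) (u \o chart_inv i)) x)) ->
      sup (range u) - inf (range u) <= C (sup (range Fp)) (inf (range Fm)) lambda.
Proof.
have [n0|n0] := posnP n.
  exists (fun _ _ _ => 0) => u Fp Fm lambda _ _ _ _; apply: osc_le => //.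
  exact: (dim0_constant A M_connected).
(* The comparison argument needs a nonnegative defect, while lambda may be negative; max(lambda, 0)
   only weakens the trace condition. *)
have H (p : R * R) : exists B : R, forall u,
    admissible g JA JB k l (expR p.1) (Num.max p.2 0) u -> forall x y, u x - u y <= B.
  apply: (oscillation_bound M_nonempty M_compact M_connected gK commAB rank_plus rank_minus n0).
    by rewrite le_max lexx orbT.
  exact: expR_ge0.
have [C CP] := boolp.choice H.
exists (fun a _ c => C (a, c)) => u Fp Fm lambda us Wp Wm tr.
apply: osc_le => //; apply: (CP (sup (range Fp), lambda)); split => //=.
- exists Fp => // p; rewrite ler_expR; apply: ub_le_sup; last by exists p.
  exact: (ratio_bounded gK commAB rank_plus M_compact us Wp).
- by exists Fm.
- by move=> i x Ux; apply: le_lt_trans (tr i x Ux); rewrite lerN2 le_max lexx.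
Qed.
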